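(* Let $X$ be a smooth, connected, paracompact Hausdorff manifold of dimension $n$, let $G$ be a Lie group, and let $\Psi:G\times X\supseteq\mathcal{V}\to X$ be a regular (local, smooth) Lie group action on $X$ with $s$-dimensional orbits. Then each point $x_0\in X$ possesses a neighborhood $U$ such that the following statements are equivalent for each $u\in\mathcal{G}(U)$: (i) $u$ is invariant under $\Psi$. (ii) $u$ possesses a representative $(u_\varepsilon)_\varepsilon$ such that each $u_\varepsilon\in C^\infty(U)$ is invariant under $\Psi$.
   Context: Let $I=(0,1]$. For a smooth manifold $M$, $\mathcal{E}_M(M)$ denotes the set of nets $(u_\varepsilon)_{\varepsilon\in I}$ in $C^\infty(M)$ that are moderate: for every compact $K\subset M$ and every linear differential operator $P$ on $M$ with smooth coefficients there is $N\in\mathbb{N}$ with $\sup_{x\in K}|Pu_\varepsilon(x)|=O(\varepsilon^{-N})$ as $\varepsilon\to 0$. $\mathcal{N}(M)$ denotes the set of negligible nets: for all such $K,P$ and every $m\in\mathbb{N}$, $\sup_{x\in K}|Pu_\varepsilon(x)|=O(\varepsilon^{m})$. The Colombeau algebra is $\mathcal{G}(M)=\mathcal{E}_M(M)/\mathcal{N}(M)$; write $u=[(u_\varepsilon)_\varepsilon]$. If $F:M'\to M$ is smooth, $u\circ F:=[(u_\varepsilon\circ F)_\varepsilon]\in\mathcal{G}(M')$. $\Psi:\mathcal{V}\to X$ is a smooth local transformation group in the usual sense (as in Olver's books): $\mathcal{V}\subseteq G\times X$ is open with $\{e\}\times X\subseteq\mathcal{V}$, $\Psi(e,x)=x$, and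 $\Psi(g,\Psi(h,x))=\Psi(gh,x)$ and $\Psi(g^{-1},\Psi(g,x))=x$ wherever defined. It is called regular if all orbits have the same dimension as submanifolds and each point in $X$ has a base of neighborhoods whose elements intersect each orbit in a connected subset thereof. Invariance: $u\in\mathcal{G}(X)$ is invariant under $\Psi$ if $u\circ\Psi=u\circ\pi_2$ in $\mathcal{G}(\mathcal{V})$, where $\pi_2:G\times X\to X$ is the projection onto the second factor. For an open set $U\subseteq X$, invariance is understood with respect to the restricted local action: with $\mathcal{V}_U=\{(g,x)\in\mathcal{V}: x\in U,\ \Psi(g,x)\in U\}$, $u\in\mathcal{G}(U)$ is invariant under $\Psi$ if $u\circ\Psi=u\circ\pi_2$ in $\mathcal{G}(\mathcal{V}_U)$, and a function $f\in C^\infty(U)$ is invariant under $\Psi$ if $f\circ\Psi=f\circ\pi_2$ on $\mathcal{V}_U$. *)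

(* Defs.v *)
From HB Require Import structures.
From mathcomp Require Import all_boot all_order all_algebra.
From mathcomp Require Import all_classical all_reals all_analysis.

Set Implicit Arguments.
Unset Strict Implicit.
Unset Printing Implicit Defensive.

Import Order.TTheory GRing.Theory Num.Theory.
Import numFieldNormedType.Exports.

Local Open Scope classical_set_scope.
Local Open Scope ring_scope.

(* Throughout, an object living on an open subset D of a space T is a total
   function on T, of which only the values on D matter. *)

Section Smoothness.
Context {R : realType} {n : nat}.

Fixpoint partial (l : seq 'I_n) (f : 'rV[R]_n -> R) : 'rV[R]_n -> R :=
  if l is i :: l' then fun x => 'D_(delta_mx 0 i) (partial l' f) x else f.

Definition euclid_smooth (D : set 'rV[R]_n) (f : 'rV[R]_n -> R) : Prop :=
  forall (l : seq 'I_n) x, D x ->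
    {for x, continuous (partial l f)} /\
    forall i, derivable (partial l f) x (delta_mx 0 i).

End Smoothness.

(* [chart_from] matters only on the image of [chart_dom] under [chart_to]. *)
Record chart (R : realType) (T : topologicalType) (n : nat) := Chart {
  chart_dom : set T;
  chart_to : T -> 'rV[R]_n;
  chart_from : 'rV[R]_n -> T
}.

Record is_chart (R : realType) (T : topologicalType) (n : nat)
    (c : chart R T n) : Prop := {
  chart_open_dom : open (chart_dom c);
  chart_open_im : open (chart_to c @` chart_dom c);
  chart_to_continuous : {within chart_dom c, continuous (chart_to c)};
  chart_from_continuous :
    {within chart_to c @` chart_dom c, continuous (chart_from c)};
  chart_toK : forall x, chart_dom c x -> chart_from c (chart_to c x) = x
}.

Record smooth_atlas (R : realType) (T : topologicalType) (n : nat)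
    (A : set (chart R T n)) : Prop := {
  atlas_chart : forall c, A c -> is_chart c;
  atlas_cover : forall x, exists2 c, A c & chart_dom c x;
  atlas_compat : forall c d, A c -> A d -> forall j,
    euclid_smooth (chart_to c @` (chart_dom c `&` chart_dom d))
      (fun y => chart_to d (chart_from c y) 0 j)
}.

Definition prod_chart (R : realType) (S T : topologicalType) (m n : nat)
    (c : chart R S m) (d : chart R T n) : chart R (S * T)%type (m + n) :=
  Chart (chart_dom c `*` chart_dom d)
        (fun p => row_mx (chart_to c p.1) (chart_to d p.2))
        (fun y => (chart_from c (lsubmx y), chart_from d (rsubmx y))).

Definition prod_atlas (R : realType) (S T : topologicalType) (m n : nat)
    (A : set (chart R S m)) (B : set (chart R T n)) :
    set (chart R (S * T)%type (m + n)) :=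
  [set c | exists2 a, A a & exists2 b, B b & c = prod_chart a b].

Definition smooth_fun (R : realType) (T : topologicalType) (n : nat)
    (A : set (chart R T n)) (D : set T) (f : T -> R) : Prop :=
  forall c, A c ->
    euclid_smooth (chart_to c @` (chart_dom c `&` D)) (f \o chart_from c).

Definition smooth_map (R : realType) (S T : topologicalType) (m n : nat)
    (A : set (chart R S m)) (B : set (chart R T n))
    (D : set S) (F : S -> T) : Prop :=
  (forall x, D x -> {for x, continuous F}) /\
  forall d, B d -> forall j,
    smooth_fun A (D `&` F @^-1` chart_dom d) (fun x => chart_to d (F x) 0 j).

Definition paracompact (T : topologicalType) : Prop :=
  forall C : set (set T), (forall O, C O -> open O) ->
    \bigcup_(O in C) O = setT ->
  exists D : set (set T),
    [/\ forall O, D O -> open O,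
        \bigcup_(O in D) O = setT,
        forall O, D O -> exists2 Q, C Q & O `<=` Q &
        forall x : T, exists2 W, nbhs x W &
          finite_set [set O | D O /\ O `&` W !=set0]].

(* Matrix of the differential of F at p in the charts c and d;
   row i holds the i-th partial derivatives. *)
Definition jacobian_mx (R : realType) (S T : topologicalType) (m n : nat)
    (c : chart R S m) (d : chart R T n) (F : S -> T) (p : S) :
    'M[R]_(m, n) :=
  \matrix_(i, j)
    'D_(delta_mx 0 i) (fun y => chart_to d (F (chart_from c y)) 0 j : R)
      (chart_to c p).

Definition immersion (R : realType) (S T : topologicalType) (m n : nat)
    (A : set (chart R S m)) (B : set (chart R T n)) (F : S -> T) : Prop :=
  smooth_map A B setT F /\
  forall p c d, A c -> B d -> chart_dom c p -> chart_dom d (F p) ->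
    \rank (jacobian_mx c d F p) = m.

(* Immersed submanifolds: N need not carry the subspace topology. *)
Definition submanifold (R : realType) (T : topologicalType) (n : nat)
    (A : set (chart R T n)) (s : nat) (N : set T) : Prop :=
  exists (S : topologicalType) (AS : set (chart R S s)) (phi : S -> T),
    [/\ smooth_atlas AS /\ hausdorff_space S /\ @second_countable S,
        immersion AS A phi, injective phi & range phi = N].

#[short(type="topologicalSpaceGroupType")]
HB.structure Definition TopologicalSpaceGroup :=
  {G of Group G & Topological G}.

Record lie_group (R : realType) (G : topologicalSpaceGroupType) (m : nat)
    (AG : set (chart R G m)) : Prop := {
  lie_atlas : smooth_atlas AG;
  lie_hausdorff : hausdorff_space G;
  lie_second_countable : @second_countable G;
  lie_mul : smooth_map (prod_atlas AG AG) AG setT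
              (fun p : G * G => (p.1 * p.2)%g);
  lie_inv : smooth_map AG AG setT (fun g : G => (g^-1)%g)
}.

Record local_action (R : realType) (G : topologicalSpaceGroupType)
    (X : topologicalType) (m n : nat)
    (AG : set (chart R G m)) (AX : set (chart R X n))
    (V : set (G * X)) (Psi : G * X -> X) : Prop := {
  action_open : open V;
  action_dom1 : forall x, V (1%g, x);
  action_smooth : smooth_map (prod_atlas AG AX) AX V Psi;
  action_1 : forall x, Psi (1%g, x) = x;
  action_mul : forall g h x,
    V (h, x) -> V (g, Psi (h, x)) -> V ((g * h)%g, x) ->
    Psi (g, Psi (h, x)) = Psi ((g * h)%g, x);
  (* As in Olver, the domain is stable under inversion of the action. *)
  action_inv : forall g x, V (g, x) ->
    V ((g^-1)%g, Psi (g, x)) /\ Psi ((g^-1)%g, Psi (g, x)) = x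
}.

Section Orbits.
Context {G : topologicalSpaceGroupType} {X : topologicalType}.
Variables (V : set (G * X)) (Psi : G * X -> X).

Definition group_invariant (O : set X) : Prop :=
  forall g x, O x -> V (g, x) -> O (Psi (g, x)).

(* For a local action, x and y may lie in one orbit without y = Psi (g, x)
   for any g; orbits are the minimal nonempty invariant subsets. *)
Definition is_orbit (O : set X) : Prop :=
  [/\ O !=set0, group_invariant O &
      forall Q, Q !=set0 -> group_invariant Q -> Q `<=` O -> Q = O].

Definition regular_action (R : realType) (n : nat) (AX : set (chart R X n))
    (s : nat) : Prop :=
  (forall O, is_orbit O -> submanifold AX s O) /\
  forall x : X, exists B : set (set X),
    nbhs x = filter_from B id /\
    forall W O, B W -> is_orbit O -> connected (W `&` O).

Definition restricted_dom (U : set X) : set (G * X) :=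
  [set p | [/\ V p, U p.2 & U (Psi p)]].

Definition invariant_fun (R : realType) (U : set X) (f : X -> R) : Prop :=
  forall p, restricted_dom U p -> f (Psi p) = f p.2.

End Orbits.

Section Colombeau.
Context {R : realType} {T : topologicalType} {n : nat}.
Variables (A : set (chart R T n)) (D : set T).

(* Only the values at parameters in ]0, 1] matter. *)
Definition net := R -> T -> R.

Definition smooth_net (u : net) : Prop :=
  forall eps, 0 < eps <= 1 -> smooth_fun A D (u eps).

(* The coefficients are indexed by words i_1 ... i_j of length at most k rather
   than by multi-indices; partial derivatives commute, so this describes the
   same operators. *)
Definition diff_operator (P : (T -> R) -> (T -> R)) : Prop :=
  exists k : nat, forall c, A c ->
  exists2 a : seq 'I_n -> T -> R,
    forall l, smooth_fun A (chart_dom c `&` D) (a l) &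
    forall f x, smooth_fun A D f -> chart_dom c x -> D x ->
      P f x = \sum_(j < k.+1) \sum_(t : j.-tuple 'I_n)
                a t x * partial t (f \o chart_from c) (chart_to c x).

Definition sup_norm (K : set T) (f : T -> R) : R := sup [set `|f x| | x in K].

(* f = O(g) as its argument tends to 0 through positive reals. *)
Definition bigO_at0 (f g : R -> R) : Prop :=
  let F := at_right (0 : R) in f =O_ F g.

Definition moderate (u : net) : Prop :=
  smooth_net u /\
  forall K P, compact K -> K `<=` D -> diff_operator P ->
  exists N : nat,
    bigO_at0 (fun eps => sup_norm K (P (u eps))) (fun eps => eps ^- N).

Definition negligible_net (u : net) : Prop :=
  smooth_net u /\
  forall K P, compact K -> K `<=` D -> diff_operator P ->
  forall m : nat,
    bigO_at0 (fun eps => sup_norm K (P (u eps))) (fun eps => eps ^+ m).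

Definition colombeau_class (u : net) : set net :=
  [set v | moderate v /\ negligible_net (fun eps x => v eps x - u eps x)].

(* The elements of G(D) = E_M(D) / N(D) are the cosets of the moderate nets. *)
Definition colombeau : set (set net) :=
  [set u | exists2 v, moderate v & u = colombeau_class v].

End Colombeau.

Arguments net : clear implicits.

(* The class of (v_eps \o F), as the union over all representatives v of u. *)
Definition colombeau_comp (R : realType) (S T : topologicalType) (m : nat)
    (A : set (chart R S m)) (D : set S) (F : S -> T) (u : set (net R T)) :
    set (net R S) :=
  \bigcup_(v in u) colombeau_class A D (fun eps => v eps \o F).

Definition invariant_gen (R : realType) (G : topologicalSpaceGroupType)
    (X : topologicalType) (m n : nat)
    (AG : set (chart R G m)) (AX : set (chart R X n))
    (V : set (G * X)) (Psi : G * X -> X) (U : set X)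
    (u : set (net R X)) : Prop :=
  let VU := restricted_dom V Psi U in
  colombeau_comp (prod_atlas AG AX) VU Psi u =
  colombeau_comp (prod_atlas AG AX) VU snd u.

(* Main.v *)
Require Import Defs.
From HB Require Import structures.
From mathcomp Require Import all_boot all_order all_algebra.
From mathcomp Require Import all_classical all_reals all_analysis.
From mathcomp Require Import ring lra zify.

Set Implicit Arguments.
Unset Strict Implicit.
Unset Printing Implicit Defensive.

Import Order.TTheory GRing.Theory Num.Theory.
Import numFieldNormedType.Exports.

Local Open Scope classical_set_scope.
Local Open Scope ring_scope.

(** Why the theorem is true.  Around [x0] there is a smooth retraction [tau] of
    a neighborhood [U] onto a cross section of the orbits: [tau] is constant on
    the intersection of [U] with each orbit, and [tau x] is obtained from [x] by
    a group element [gamma x] depending smoothly on [x], that is,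
    [tau x = Psi (gamma x, x)] (lemma [cross_section]).  Given an invariant
    generalized function with representative [u], the nets [u o tau] are
    invariant functions, and [u o tau - u] is the pullback of the negligible net
    [u o Psi - u o snd] along [x |-> (gamma x, x)], so [u o tau] represents the
    same class.  Conversely, on an invariant representative the compositions
    with [Psi] and with the projection coincide, and another representative
    changes both by negligible nets.  No integration of vector fields is
    involved.

    The analytic ingredient is that moderate and negligible nets are stable
    under composition with smooth maps.  By the chain rule for iterated partial
    derivatives ([partial_comp]), an operator applied to [f o F] is locally
    bounded by derivatives of [f] in one chart; multiplied by a bump function
    these become globally defined operators ([composition_dominated]).

    The geometric ingredient is the cross section.  Let [r] be the rank of the
    differential at the identity of the orbit map of [c].  Moving a transversal
    through [c] by group elements gives a map with invertible differential, and
    the inverse function theorem turns it into slice coordinates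
    ([slice_exists]): each point near [c] is [Psi (sigma x, tau x)] with
    [tau x] on the transversal.  The rank is constant along orbits
    ([orbit_rank_act]), so on an orbit of rank [r] the transverse coordinate is
    locally constant under the action.  An orbit consists of countably many
    pieces, since the group is second countable ([reach_countable]); hence the
    transverse coordinate takes only countably many values on the orbit, and it
    is constant on connected subsets of the orbit ([transverse_connected]).

    Regularity enters twice.  First, the orbits are submanifolds of the same
    dimension [s], and this forces the rank to be [s] at every point: the
    transverse coordinate is constant along connected pieces of the submanifold,
    whence [s <= r] ([submanifold_dim_le_rank]), and a slice is covered by
    countably many compact pieces of the submanifold, whence [r <= s] by Baire's
    theorem ([rank_le_submanifold_dim]).  Thus the slice coordinates at [x0] suit
    all orbits nearby.  Second, a small neighborhood of [x0] meets each orbit in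
    a connected set, on which the transverse coordinate, hence [tau], is
    constant. *)

(** * Mean value estimates and the classes C^k *)

Section LineMeanValue.
Context {R : realType} {V : normedModType R}.

Lemma mean_value_line (f : V -> R) (x v : V) (c eta d : R) :
  (forall t, `|t| <= `|d| -> 0 <= t * d ->
     derivable f (x + t *: v) v /\ `|'D_v f (x + t *: v) - c| <= eta) ->
  `|f (x + d *: v) - f x - c * d| <= eta * `|d|.
Proof.
move=> H.
pose g t := f (x + t *: v) - c * t.
have gD t : `|t| <= `|d| -> 0 <= t * d ->
    is_derive t 1 g ('D_v f (x + t *: v) - c).
  move=> t1 t2; have [df _] := H t t1 t2.
  have dft : is_derive t (1 : R) (fun t => f (x + t *: v)) ('D_v f (x + t *: v)).
    have E : (fun h : R => h^-1 *: (((fun t => f (x + t *: v)) \o shift t) (h *: 1) - f (x + t *: v)))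
      = (fun h : R => h^-1 *: ((f \o shift (x + t *: v)) (h *: v) - f (x + t *: v))).
      apply/funext => h /=; congr (_ *: (f _ - _)).
      by rewrite [h%:A]mulr1 scalerDl addrC addrA addrAC addrC addrA.
    by split; rewrite /derivable /derive E.
  rewrite /g; apply: is_deriveB.
  have := is_deriveZ c (is_derive_id t (1 : R)).
  by rewrite /GRing.scale /= mulr1.
have gc : forall a b, (forall t, t \in `[a, b] -> `|t| <= `|d| /\ 0 <= t * d) ->
    {within `[a, b], continuous g}.
  move=> a b Hab; apply: derivable_within_continuous => t tab.
  by have [t1 t2] := Hab t tab; have [] := gD t t1 t2.
have -> : f (x + d *: v) - f x - c * d = g d - g 0.
  by rewrite /g scale0r addr0 mulr0 subr0 addrAC.
have [d0|d0] := leP 0 d.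
  have Hd t : t \in `[0, d] -> `|t| <= `|d| /\ 0 <= t * d.
    rewrite in_itv /= => /andP[t0 td].
    by rewrite ger0_norm// ger0_norm// td mulr_ge0.
  have [||e /Hd[e1 e2] ->] := @MVT_segment R g
      (fun t => 'D_v f (x + t *: v) - c) 0 d d0.
  - by move=> t /subset_itv_oo_cc /Hd[]; exact: gD.
  - exact: gc.
  - by rewrite subr0 normrM ler_wpM2r// (H e e1 e2).2.
have Hd t : t \in `[d, 0] -> `|t| <= `|d| /\ 0 <= t * d.
  rewrite in_itv /= => /andP[t0 td].
  by rewrite ler0_norm// ltr0_norm// lerN2 t0 mulr_le0// ltW.
have [||e /Hd[e1 e2] E] := @MVT_segment R g
    (fun t => 'D_v f (x + t *: v) - c) d 0 (ltW d0).
- by move=> t /subset_itv_oo_cc /Hd[]; exact: gD.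
- exact: gc.
- by rewrite distrC E sub0r normrM normrN ler_wpM2r// (H e e1 e2).2.
Qed.

End LineMeanValue.

Section Telescoping.
Context {R : realType} {n : nat}.
Implicit Types (f : 'rV[R]_n -> R) (a x y : 'rV[R]_n).

Lemma mx_norm_entry m p (A : 'M[R]_(m, p)) i j : `|A i j| <= `|A|.
Proof.
rewrite [leRHS]/Num.Def.normr/= mx_normrE.
exact: (le_bigmax _ (fun k : 'I_m * 'I_p => `|A k.1 k.2|) (i, j)).
Qed.

Lemma mx_norm_le m p (A : 'M[R]_(m, p)) e :
  0 <= e -> (forall i j, `|A i j| <= e) -> `|A| <= e.
Proof.
move=> e0 H; rewrite [leLHS]/Num.Def.normr/= mx_normrE.
by apply: bigmax_le => // -[i j] _; exact: H.
Qed.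

Lemma rV_ballP a x r : ball a r x <-> 0 < r /\ forall i, `|a 0 i - x 0 i| < r.
Proof.
split=> [|[r0 H]].
  move=> [r0 /= H]; split => // i.
  by have := H 0 i; rewrite /ball /= .
by split => // i j; rewrite ord1 /ball /=; exact: H.
Qed.

(** Moving from [x] to [y] one coordinate at a time never leaves the ball,
    which is a cube; each step is a one-variable mean value theorem. *)
Lemma partial_mean_value f (c : 'I_n -> R) eta a r :
  (forall z, ball a r z -> forall i, derivable f z (delta_mx 0 i) /\
     `|'D_(delta_mx 0 i) f z - c i| <= eta) ->
  forall x y, ball a r x -> ball a r y ->
  `|f y - f x - \sum_i c i * (y 0 i - x 0 i)| <= n%:R * (eta * `|y - x|).
Proof.
move=> H x y ax ay.
have [n0|[i0]] : n = 0%N \/ inhabited 'I_n.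
  by case: (n) => [|k]; [left|right; exact: (inhabits ord0)].
  have -> : y = x by apply/matrixP => i j; exfalso; case: j => j; rewrite n0.
  rewrite !subrr sub0r normrN big1 ?normr0 ?mulr0//.
  by move=> i; rewrite subrr mulr0.
have eta0 : 0 <= eta by apply: le_trans (H x ax i0).2.
pose p (k : nat) : 'rV[R]_n := \row_j (if (j < k)%N then y 0 j else x 0 j).
have p0 : p 0%N = x by apply/matrixP => i j; rewrite mxE ltn0 ord1.
have pn : p n = y by apply/matrixP => i j; rewrite mxE ltn_ord ord1.
have pS (k : 'I_n) : p k.+1 = p k + (y 0 k - x 0 k) *: delta_mx 0 k.
  apply/matrixP => i j; rewrite !mxE ord1 eqxx /=.
  rewrite ltnS leq_eqVlt; have [->|jk] := eqVneq j k.
    by rewrite eqxx ltnn /= mulr1 addrC subrK.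
  have jk' : (j == k :> nat) = false by apply/negbTE.
  by rewrite jk' mulr0 addr0.
have -> : f y - f x = \sum_(k < n) (f (p k.+1) - f (p k)).
  rewrite -{1}pn -{1}p0 -(telescope_sumr (f \o p))// big_mkord.
  by [].
rewrite -sumrB (le_trans (ler_norm_sum _ _ _))//.
have -> : n%:R * (eta * `|y - x|) = \sum_(i < n) (eta * `|y - x|).
  by rewrite sumr_const card_ord mulr_natl.
apply: ler_sum => k _; rewrite pS.
apply: (@le_trans _ _ (eta * `|y 0 k - x 0 k|)); last first.
  rewrite ler_wpM2l//; have := mx_norm_entry (y - x) 0 k; by rewrite !mxE.
apply: mean_value_line => t t1 t2; apply: H.
have /rV_ballP[r0 bx] := ax; have /rV_ballP[_ by_] := ay.
apply/rV_ballP; split => // j; rewrite !mxE eqxx /=.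
have [->|jk] := eqVneq j k; last first.
  by rewrite mulr0 addr0; case: ifP.
rewrite ltnn mulr1; move: (bx k) (by_ k) t1 t2.
move: (a 0 k) (x 0 k) (y 0 k) => a' x' y'.
rewrite !ltr_norml => /andP[A1 A2] /andP[A3 A4].
have [d0|d0] := leP 0 (y' - x').
  rewrite (ger0_norm d0); case: (ltgtP 0 (y' - x')) d0 => // [d0 _|d0 _].
    rewrite ler_norml pmulr_lge0// => /andP[B1 B2] B3.
    by apply/andP; split; lra.
  rewrite -d0 normr_le0 => /eqP ->; rewrite addr0 => _.
  by apply/andP; split; lra.
rewrite (ltr0_norm d0) ler_norml nmulr_lge0// => /andP[B1 B2] B3.
by apply/andP; split; lra.
Qed.

(** The mean value estimate with all slopes and errors zero. *)
Lemma partials_zero_const f a r :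
  (forall z, ball a r z -> forall i, derivable f z (delta_mx 0 i) /\
     'D_(delta_mx 0 i) f z = 0) ->
  forall x, ball a r x -> f x = f a.
Proof.
move=> H x ax.
have a_a : ball a r a.
  by move: ax => /rV_ballP[r0 _]; exact: ballxx.
have := @partial_mean_value f (fun=> 0) 0 a r _ a x a_a ax.
rewrite big1; last by move=> i _; rewrite mul0r.
rewrite mul0r mulr0 normr_le0 subr0 subr_eq0 => E; apply/eqP/E.
by move=> z /H Hz i; have [? ->] := Hz i; rewrite subrr normr0.
Qed.

(** The class C^k, as a property of the germ of [f] at [y]. *)
Fixpoint Ck (k : nat) (f : 'rV[R]_n -> R) (y : 'rV[R]_n) : Prop :=
  match k with
  | 0 => \forall z \near y, {for z, continuous f}
  | k'.+1 => (\forall z \near y, {for z, continuous f} /\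
                forall i, derivable f z (delta_mx 0 i)) /\
             forall i, Ck k' ('D_(delta_mx 0 i) f) y
  end.

(** Requiring all the classes C^k on a common neighborhood makes smoothness an
    open condition. *)
Definition smooth_at f y := \forall z \near y, forall k, Ck k f z.

Lemma Ck_continuous k f y : Ck k f y -> {for y, continuous f}.
Proof.
by case: k => [|k] /= => [/nbhs_singleton|[/nbhs_singleton[]]].
Qed.

Lemma Ck_near k f y : Ck k f y -> \forall z \near y, Ck k f z.
Proof.
elim: k f => [|k IH] f /=; first by move=> /near_join.
move=> [/near_join H1 H2].
have {}H2 : \forall z \near y, forall i, Ck k ('D_(delta_mx 0 i) f) z.
  apply: (@filter_forall _ _ (fun i z => Ck k ('D_(delta_mx 0 i) f) z)
    (nbhs y)) => i; exact: IH.
exact: filterS2 H1 H2.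
Qed.

Lemma CkW k f y : Ck k.+1 f y -> Ck k f y.
Proof.
elim: k f => [|k IH] f /= [H1 H2].
  by near=> z; have [] : {for z, continuous f} /\
        (forall i, derivable f z (delta_mx 0 i)) by near: z.
by split => // i; apply: IH; exact: H2.
Unshelve. all: by end_near. Qed.

Lemma Ck_le k l f y : (k <= l)%N -> Ck l f y -> Ck k f y.
Proof.
move=> /subnK <-; elim: (l - k)%N => // j IH; rewrite addSn => /CkW; exact: IH.
Qed.

Lemma near_eq_cont f g y : {near y, f =1 g} ->
  {for y, continuous f} -> {for y, continuous g}.
Proof.
move=> fg; rewrite /prop_for /continuous_at -(nbhs_singleton fg) => cf.
exact: cvg_trans (@near_eq_cvg _ _ (nbhs y) _ _ _ fg) cf.
Qed.

Lemma Ck_eq k f g y : {near y, f =1 g} -> Ck k f y -> Ck k g y.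
Proof.
elim: k f g => [|k IH] f g fg /=.
  move=> cf; have /near_join fg' := fg; move: fg' cf.
  by apply: filterS2 => z; exact: near_eq_cont.
move=> [H1 H2]; have /near_join fg' := fg; split.
  near=> z.
  have [cf df] : {for z, continuous f} /\
        (forall i, derivable f z (delta_mx 0 i)) by near: z.
  have fgz : {near z, f =1 g} by near: z.
  split; first exact: near_eq_cont cf.
  by move=> i; apply: near_eq_derivable (df i).
move=> i; apply: IH (H2 i); near=> z; apply: near_eq_derive.
by near: z.
Unshelve. all: by end_near. Qed.

Lemma smooth_at_Ck k f y : smooth_at f y -> Ck k f y.
Proof. by move/nbhs_singleton; exact. Qed.

Lemma smooth_at_near f y : smooth_at f y -> \forall z \near y, smooth_at f z.
Proof. by move/near_join. Qed.

Lemma smooth_at_eq f g y : {near y, f =1 g} -> smooth_at f y -> smooth_at g y.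
Proof.
by move/near_join; apply: filterS2 => z fg sf k; exact: Ck_eq (sf k).
Qed.

Lemma smooth_at_cont f y : smooth_at f y -> {for y, continuous f}.
Proof. by move=> /(smooth_at_Ck 0) /Ck_continuous. Qed.

Lemma smooth_at_derivable f y i : smooth_at f y -> derivable f y (delta_mx 0 i).
Proof. by move=> /(smooth_at_Ck 1) [/nbhs_singleton[_]]. Qed.

Lemma smooth_at_D f y i :
  smooth_at f y -> smooth_at ('D_(delta_mx 0 i) f) y.
Proof. by apply: filterS => z sf k; exact: (sf k.+1).2. Qed.

Lemma partial_rcons l i f :
  partial (rcons l i) f = partial l ('D_(delta_mx 0 i) f).
Proof. by elim: l => //= j l ->. Qed.

Lemma smooth_at_partial f y l : smooth_at f y -> smooth_at (partial l f) y.
Proof. by move=> sf; elim: l => //= i l; exact: smooth_at_D. Qed.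

Lemma euclid_smoothP (D : set 'rV[R]_n) f : open D ->
  euclid_smooth D f <-> forall y, D y -> smooth_at f y.
Proof.
move=> oD; split; last first.
  move=> H l x Dx; split.
    exact/smooth_at_cont/smooth_at_partial/H.
  by move=> i; apply/smooth_at_derivable/smooth_at_partial/H.
move=> sf y Dy.
have DD z : D z -> nbhs z D by move=> Dz; exact: open_nbhs_nbhs.
apply: filterS (DD y Dy) => {Dy}y Dy k.
have {sf} : forall l z, D z -> {for z, continuous (partial l f)} /\
    forall i, derivable (partial l f) z (delta_mx 0 i) by [].
elim: k f => [|k IH] f sf /=.
  by apply: filterS (DD y Dy) => z Dz; have [] := sf [::] z Dz.
split; last by move=> i; apply: IH => l z Dz; rewrite -partial_rcons; exact: sf.
by apply: filterS (DD y Dy) => z; exact: (sf [::] z).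
Qed.

End Telescoping.

(** * Chain rule and closure properties *)

HB.instance Definition _ (R : realType) (m n : nat) := Complete.on 'M[R]_(m, n).

Lemma near_all (T : topologicalType) (y : T) (P : T -> Prop) :
  (forall z, P z) -> \forall z \near y, P z.
Proof. by move=> H; apply: filterS filterT => z _. Qed.

Section ContinuityOfVectors.
Context {R : realType}.

Lemma cvg_coord (T : Type) (F : set_system T) (FF : Filter F) n
    (G : T -> 'rV[R]_n) (l : 'rV[R]_n) :
  (G x @[x --> F] --> l) <-> forall j, G x 0 j @[x --> F] --> l 0 j.
Proof.
split=> [Gl j|H].
  by apply: (cvg_comp G (fun M : 'rV[R]_n => M 0 j) Gl); exact: coord_continuous.
apply/cvgrPdist_le => e e0.
have {}H : \forall x \near F, forall j, `|l 0 j - G x 0 j| <= e.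
  apply: (@filter_forall _ _ (fun j x => `|l 0 j - G x 0 j| <= e) F) => j.
  by have /cvgrPdist_le := H j; apply.
apply: filterS H => x Hx; apply: mx_norm_le; first exact: ltW.
by move=> i j; rewrite ord1 !mxE.
Qed.

Lemma continuous_coordP (T : topologicalType) n (G : T -> 'rV[R]_n) (y : T) :
  {for y, continuous G} <-> forall j, {for y, continuous (fun x => G x 0 j)}.
Proof. exact: cvg_coord. Qed.

End ContinuityOfVectors.

Section ChainRule.
Context {R : realType} {n : nat}.

Lemma Ck1_partial_near (f : 'rV[R]_n -> R) y eta : 0 < eta -> Ck 1 f y ->
  exists2 r, 0 < r & forall z, ball y r z -> forall i,
    derivable f z (delta_mx 0 i) /\
    `|'D_(delta_mx 0 i) f z - 'D_(delta_mx 0 i) f y| <= eta.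
Proof.
move=> eta0 [H1 H2].
have H3 : \forall z \near y, forall i,
    `|'D_(delta_mx 0 i) f z - 'D_(delta_mx 0 i) f y| <= eta.
  apply: (@filter_forall _ _ (fun i z =>
    `|'D_(delta_mx 0 i) f z - 'D_(delta_mx 0 i) f y| <= eta) (nbhs y)) => i.
  have /nbhs_singleton := H2 i => /cvgrPdist_le /(_ _ eta0) h.
  by apply: filterS h => z; rewrite distrC.
have [r /= r0 H] := (nbhs_ballP _ _).1 (filterI H1 H3).
exists r => // z /H [[_ dz] ez] i; split; [exact: dz|exact: ez].
Qed.

(** The chain rule is proved directly from the mean value estimate: the
    difference quotient of [f \o G] is a combination of those of the coordinates
    of [G], up to an error that is small relative to the increment of [G]. *)
Lemma is_derive_comp_rV (V : normedModType R) (f : 'rV[R]_n -> R)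
    (G : V -> 'rV[R]_n) (y v : V) :
  Ck 1 f (G y) -> derivable G y v ->
  is_derive y v (fun z => f (G z))
    (\sum_j ('D_v G y) 0 j * 'D_(delta_mx 0 j) f (G y)).
Proof.
move=> Cf dG; set D := 'D_v G y.
pose c j := 'D_(delta_mx 0 j) f (G y).
pose q (h : R) := h^-1 *: (G (h *: v + y) - G y).
have qD : q h @[h --> 0^'] --> D by exact: dG.
have Gcv : G (h *: v + y) @[h --> 0^'] --> G y.
  have : h *: q h + G y @[h --> 0^'] --> 0 *: D + G y.
    apply: cvgD; last exact: cvg_cst.
    apply: cvgZ => //; exact: cvg_within.
  rewrite scale0r add0r; apply: cvg_trans; apply: near_eq_cvg.
  near=> h; rewrite /q scalerA divff ?scale1r ?subrK//.
  by near: h; exact: nbhs_dnbhs_neq.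
pose s (h : R) : R := \sum_j q h 0 j * c j.
have scv : s h @[h --> 0^'] --> (\sum_j D 0 j * c j : R).
  apply: (@cvg_big R _ +%R 0 predT (fun p => @add_continuous R p) _ _ _
    (fun j (h : R) => q h 0 j * c j) (fun j => D 0 j * c j)) => // j _.
  apply: cvgM; last exact: cvg_cst.
  by move: j; apply/cvg_coord.
pose err (h : R) : R := h^-1 * (f (G (h *: v + y)) - f (G y)) - s h.
have ecv : err h @[h --> 0^'] --> (0 : R).
  apply/cvgrPdist_le => e e0.
  pose eta := e / (n%:R + 1) / (`|D| + 1).
  have D1 : 0 < `|D| + 1 by rewrite ltr_wpDl.
  have n1 : 0 < n%:R + 1 :> R by rewrite ltr_wpDl.
  have eta0 : 0 < eta by rewrite !divr_gt0.
  have [r r0 Hr] := Ck1_partial_near eta0 Cf.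
  near=> h.
  have h0 : h != 0 by near: h; exact: nbhs_dnbhs_neq.
  have bG : ball (G y) r (G (h *: v + y)).
    by near: h; have /cvgrPdist_lt /(_ _ r0) := Gcv;
      apply: filterS => h; rewrite -ball_normE.
  have qb : `|q h| <= `|D| + 1.
    near: h; have /cvgrPdist_le /(_ _ ltr01) := qD; apply: filterS => h.
    move=> H; rewrite -lerBlDl; apply: le_trans H.
    by rewrite distrC lerB_dist.
  have := partial_mean_value Hr (ballxx _ r0) bG.
  set S := \sum_i _ => Hm.
  have -> : err h = h^-1 * (f (G (h *: v + y)) - f (G y) - S).
    rewrite /err /s [RHS]mulrBr; congr (_ - _); rewrite mulr_sumr.
    by apply: eq_bigr => j _; rewrite !mxE mulrC mulrCA.
  rewrite sub0r normrN normrM.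
  apply: (@le_trans _ _ (`|h^-1| * (n%:R * (eta * `|G (h *: v + y) - G y|)))).
    by rewrite ler_wpM2l.
  have -> : `|h^-1| * (n%:R * (eta * `|G (h *: v + y) - G y|))
      = n%:R * (eta * `|q h|).
    by rewrite /q normrZ; ring.
  apply: (@le_trans _ _ ((n%:R + 1) * (eta * (`|D| + 1)))).
    apply: ler_pM; [by []|by rewrite mulr_ge0// ltW|by rewrite lerDl|].
    by rewrite ler_wpM2l// ltW.
  by rewrite /eta divfK ?gt_eqF// mulrC divfK ?gt_eqF//.
pose g (h : R) : R := h^-1 *: (((fun z => f (G z)) \o shift y) (h *: v) - f (G y)).
have H : g h @[h --> 0^'] --> (\sum_j D 0 j * c j : R).
  have E : (fun h => s h + err h) = g.
    by apply/funext => h; rewrite /err /= addrC subrK.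
  rewrite -E -[X in _ --> X]addr0. exact: cvgD.
 split; first by apply/cvg_ex; eexists; exact: H.
by apply: cvg_lim => //; exact: H.
Unshelve. all: by end_near. Qed.

Lemma Ck1_derive (f : 'rV[R]_n -> R) y v : Ck 1 f y ->
  is_derive y v f (\sum_j v 0 j * 'D_(delta_mx 0 j) f y).
Proof.
move=> Cf; have := @is_derive_comp_rV _ f id y v Cf (@derivable_id _ _ y v).
by rewrite derive_id.
Qed.

End ChainRule.

Section SmoothClosure.
Context {R : realType} {n : nat}.
Implicit Types (f g : 'rV[R]_n -> R) (y : 'rV[R]_n).

Lemma Ck_cst k (a : R) y : Ck k (fun=> a) y.
Proof.
elim: k a => [|k IH] a /=; first by apply: near_all => z; exact: cst_continuous.
split; first by apply: near_all => z; split => *; [exact: cst_continuous|exact: derivable_cst].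
move=> i; have -> : 'D_(delta_mx 0 i) (fun=> a) = (fun _ : 'rV[R]_n => 0 : R).
  by apply/funext => z; exact: derive_cst.
exact: IH.
Qed.

Lemma CkD k f g y : Ck k f y -> Ck k g y -> Ck k (fun z => f z + g z) y.
Proof.
elim: k f g => [|k IH] f g /=.
  by apply: filterS2 => z; exact: continuousD.
move=> [f1 f2] [g1 g2]; split.
  apply: filterS2 f1 g1 => z [cf df] [cg dg]; split; first exact: continuousD.
  by move=> i; exact: derivableD.
move=> i; apply: Ck_eq (IH _ _ (f2 i) (g2 i)).
by apply: filterS2 f1 g1 => z [cf df] [cg dg]; rewrite -deriveD.
Qed.

Lemma CkM k f g y : Ck k f y -> Ck k g y -> Ck k (fun z => f z * g z) y.
Proof.
elim: k f g => [|k IH] f g.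
  by apply: filterS2 => z; exact: continuousM.
move=> Cf Cg; have Cf' := CkW Cf; have Cg' := CkW Cg.
move: Cf Cg => [f1 f2] [g1 g2]; split.
  apply: filterS2 f1 g1 => z [cf df] [cg dg]; split; first exact: continuousM.
  by move=> i; exact: derivableM.
move=> i; apply: Ck_eq (CkD (IH _ _ Cf' (g2 i)) (IH _ _ Cg' (f2 i))).
by apply: filterS2 f1 g1 => z [cf df] [cg dg]; rewrite -deriveM.
Qed.

Lemma Ck_sum k (I : Type) (r : seq I) (P : pred I) (F : I -> 'rV[R]_n -> R) y :
  (forall i, P i -> Ck k (F i) y) ->
  Ck k (fun z => \sum_(i <- r | P i) F i z) y.
Proof.
move=> H; elim: r => [|i r IH].
  by apply: Ck_eq (Ck_cst k 0 y); apply: near_all => z; rewrite big_nil.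
have [Pi|Pi] := boolP (P i); last first.
  by apply: Ck_eq IH; apply: near_all => z; rewrite big_cons (negPf Pi).
by apply: Ck_eq (CkD (H i Pi) IH); apply: near_all => z; rewrite big_cons Pi.
Qed.

Lemma Ck_prod k (I : Type) (r : seq I) (P : pred I) (F : I -> 'rV[R]_n -> R) y :
  (forall i, P i -> Ck k (F i) y) ->
  Ck k (fun z => \prod_(i <- r | P i) F i z) y.
Proof.
move=> H; elim: r => [|i r IH].
  by apply: Ck_eq (Ck_cst k 1 y); apply: near_all => z; rewrite big_nil.
have [Pi|Pi] := boolP (P i); last first.
  by apply: Ck_eq IH; apply: near_all => z; rewrite big_cons (negPf Pi).
by apply: Ck_eq (CkM (H i Pi) IH); apply: near_all => z; rewrite big_cons Pi.
Qed.

Lemma CkN k f y : Ck k f y -> Ck k (fun z => - f z) y.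
Proof.
move=> Cf; apply: Ck_eq (CkM (Ck_cst k (-1) y) Cf).
by apply: near_all => z; rewrite mulN1r.
Qed.

Lemma CkV k f y : f y != 0 -> Ck k f y -> Ck k (fun z => (f z)^-1) y.
Proof.
move=> fy0; elim: k => [|k IH] Cf.
  have n0 : \forall z \near y, f z != 0.
    exact: (@cvgr_neq0 _ _ _ (nbhs y) _ f (f y) (Ck_continuous Cf) fy0).
  by apply: filterS2 n0 Cf => z; exact: continuousV.
have n0 : \forall z \near y, f z != 0.
  exact: (@cvgr_neq0 _ _ _ (nbhs y) _ f (f y) (Ck_continuous Cf) fy0).
have CV := IH (CkW Cf); move: Cf => [f1 f2]; split.
  apply: filterS2 n0 f1 => z fz [cf df]; split; first exact: continuousV.
  by move=> i; exact: derivableV.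
move=> i; apply: Ck_eq (CkN (CkM (CkM CV CV) (f2 i))).
apply: filterS2 n0 f1 => z fz [cf df].
rewrite [RHS](deriveV fz (df i)) /GRing.scale /=.
by rewrite mulNr -invfM -expr2.
Qed.

Lemma Ck_coord k i (y : 'rV[R]_n) : Ck k (fun z : 'rV[R]_n => z 0 i) y.
Proof.
have dc z v : is_derive z v (fun z : 'rV[R]_n => z 0 i) (v 0 i).
  have dz : derivable (id : 'rV[R]_n -> _) z v by exact: derivable_id.
  split; first by move/derivable_mxP : dz; exact.
  by have := derive_mx dz; rewrite derive_id => /matrixP /(_ 0 i); rewrite mxE.
case: k => [|k]; first by apply: near_all => z; exact: coord_continuous.
split.
  apply: near_all => z; split; first exact: coord_continuous.
  by move=> j; have [] := dc z (delta_mx 0 j).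
move=> j; have -> : 'D_(delta_mx 0 j) (fun z : 'rV[R]_n => z 0 i)
    = (fun _ : 'rV[R]_n => (delta_mx 0 j : 'rV[R]_n) 0 i : R).
  by apply/funext => z; have [] := dc z (delta_mx 0 j).
exact: Ck_cst.
Qed.

(** Induction on the order, through the formula for the first partial
    derivatives of a composition. *)
Lemma Ck_comp m k (f : 'rV[R]_m -> R) (G : 'rV[R]_n -> 'rV[R]_m) y :
  Ck k f (G y) -> (forall j, Ck k (fun z => G z 0 j) y) ->
  Ck k (fun z => f (G z)) y.
Proof.
elim: k f => [|k IH] f Cf CG.
  have cG : \forall z \near y, {for z, continuous G}.
    have : \forall z \near y, forall j, {for z, continuous (fun z => G z 0 j)}.
      by apply: (@filter_forall _ _ (fun j z =>
        {for z, continuous (fun z => G z 0 j)}) (nbhs y)) => j; exact: CG.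
    by apply: filterS => z /continuous_coordP.
  have cfG : \forall z \near y, {for G z, continuous f}.
    have cGy : G x @[x --> y] --> G y := nbhs_singleton cG.
    exact: cGy Cf.
  by apply: filterS2 cG cfG => z; exact: continuous_comp.
have CG' : \forall z \near y, forall j, Ck k.+1 (fun z => G z 0 j) z.
  apply: (@filter_forall _ _ (fun j z => Ck k.+1 (fun z => G z 0 j) z) (nbhs y)).
  by move=> j; exact: Ck_near.
have cG : \forall z \near y, {for z, continuous G}.
  by apply: filterS CG' => z Hz; apply/continuous_coordP => j;
     exact: Ck_continuous (Hz j).
have Cf' : \forall z \near y, Ck k.+1 f (G z).
  have cGy : G x @[x --> y] --> G y := nbhs_singleton cG.
  exact: cGy (Ck_near Cf).
have dG : \forall z \near y, forall i, derivable G z (delta_mx 0 i).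
  apply: filterS CG' => z Hz i; apply/derivable_mxP => a j; rewrite ord1.
  by have [/nbhs_singleton[_ d] _] := Hz j; exact: d.
have dfG : \forall z \near y, forall i,
    is_derive z (delta_mx 0 i) (fun z => f (G z))
     (\sum_j 'D_(delta_mx 0 i) (fun z => G z 0 j) z * 'D_(delta_mx 0 j) f (G z)).
  apply: filterS2 dG Cf' => z dz Cz i.
  have [] := is_derive_comp_rV (Ck_le (isT : 1 <= k.+1)%N Cz) (dz i).
  move=> d1 d2; split => //; rewrite d2; apply: eq_bigr => j _.
  by rewrite derive_mx// mxE.
split.
  apply: filterS3 cG Cf' dfG => z cz Cz dz; split.
    by apply: continuous_comp => //; exact: (@Ck_continuous _ _ k.+1).
  by move=> i; have [] := dz i.
move=> i; have := @Ck_sum k _ (index_enum 'I_m) predT (fun j z =>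
  'D_(delta_mx 0 i) (fun z => G z 0 j) z * 'D_(delta_mx 0 j) f (G z)) y.
have HI j : true -> Ck k (fun z =>
  'D_(delta_mx 0 i) (fun z => G z 0 j) z * 'D_(delta_mx 0 j) f (G z)) y.
  move=> _; apply: CkM; first exact: (CG j).2.
  exact: (IH _ (Cf.2 j) (fun l => CkW (CG l))).
move=> /(_ HI); apply: Ck_eq; apply: filterS dfG => z /(_ i) [_].
exact: esym.
Qed.

End SmoothClosure.

(** * Jacobian matrices and the inverse function theorem *)

Lemma near_eq_app (T : topologicalType) (U W : Type) (f : U -> W)
    (G H : T -> U) (y : T) :
  {near y, G =1 H} -> {near y, (fun z => f (G z)) =1 (fun z => f (H z))}.
Proof. by apply: filterS => z ->. Qed.

Section SmoothOperations.
Context {R : realType} {n : nat}.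
Implicit Types (f g : 'rV[R]_n -> R) (y : 'rV[R]_n).

Lemma smooth_at_cst (a : R) y : smooth_at (fun=> a) y.
Proof. by apply: near_all => z k; exact: Ck_cst. Qed.

Lemma smooth_atD f g y :
  smooth_at f y -> smooth_at g y -> smooth_at (fun z => f z + g z) y.
Proof. by apply: filterS2 => z sf sg k; exact: CkD. Qed.

Lemma smooth_atN f y : smooth_at f y -> smooth_at (fun z => - f z) y.
Proof. by apply: filterS => z sf k; exact: CkN. Qed.

Lemma smooth_atM f g y :
  smooth_at f y -> smooth_at g y -> smooth_at (fun z => f z * g z) y.
Proof. by apply: filterS2 => z sf sg k; exact: CkM. Qed.

Lemma smooth_at_sum (I : Type) (r : seq I) (P : pred I)
    (F : I -> 'rV[R]_n -> R) y :
  (forall i, P i -> smooth_at (F i) y) ->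
  smooth_at (fun z => \sum_(i <- r | P i) F i z) y.
Proof.
move=> H; elim: r => [|i r IH].
  apply: smooth_at_eq (smooth_at_cst 0 y).
  by apply: near_all => z; rewrite big_nil.
have [Pi|Pi] := boolP (P i); last first.
  by apply: smooth_at_eq IH; apply: near_all => z; rewrite big_cons (negPf Pi).
apply: smooth_at_eq (smooth_atD (H i Pi) IH).
by apply: near_all => z; rewrite big_cons Pi.
Qed.

Lemma smooth_at_coord i y : smooth_at (fun z : 'rV[R]_n => z 0 i) y.
Proof. by apply: near_all => z k; exact: Ck_coord. Qed.

Definition smoothv m (G : 'rV[R]_n -> 'rV[R]_m) y :=
  forall j, smooth_at (fun z => G z 0 j) y.

Lemma smoothv_near m (G : 'rV[R]_n -> 'rV[R]_m) y :
  smoothv G y -> \forall z \near y, smoothv G z.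
Proof.
move=> sG; apply: (@filter_forall _ _ (fun j z =>
  smooth_at (fun z => G z 0 j) z) (nbhs y)) => j.
exact: smooth_at_near.
Qed.

Lemma smoothv_eq m (G H : 'rV[R]_n -> 'rV[R]_m) y :
  {near y, G =1 H} -> smoothv G y -> smoothv H y.
Proof.
move=> GH sG j; apply: smooth_at_eq (sG j);
exact: (near_eq_app (fun v : 'rV[R]_m => v 0 j)).
Qed.

Lemma smoothv_cont m (G : 'rV[R]_n -> 'rV[R]_m) y :
  smoothv G y -> {for y, continuous G}.
Proof. by move=> sG; apply/continuous_coordP => j; exact: smooth_at_cont. Qed.

Lemma smooth_at_comp m f (G : 'rV[R]_m -> 'rV[R]_n) (y : 'rV[R]_m) :
  smooth_at f (G y) -> (forall j, smooth_at (fun z => G z 0 j) y) ->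
  smooth_at (fun z => f (G z)) y.
Proof.
move=> sf sG.
have cG : G x @[x --> y] --> G y.
  by apply/continuous_coordP => j; exact: smooth_at_cont.
have sf' : \forall z \near y, forall k, Ck k f (G z) by exact: cG sf.
have sG' : \forall z \near y, forall j, smooth_at (fun z => G z 0 j) z.
  apply: (@filter_forall _ _ (fun j z =>
    smooth_at (fun z => G z 0 j) z) (nbhs y)) => j; exact: smooth_at_near.
apply: filterS2 sf' sG' => z Cf CG k.
by apply: Ck_comp => // j; exact: smooth_at_Ck.
Qed.

End SmoothOperations.

Section Jacobian.
Context {R : realType}.

Definition jac m n (G : 'rV[R]_m -> 'rV[R]_n) (y : 'rV[R]_m) : 'M[R]_(m, n) :=
  \matrix_(i, j) 'D_(delta_mx 0 i) (fun z => G z 0 j : R) y.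

Lemma smoothv_comp m n p (G : 'rV[R]_m -> 'rV[R]_n) (H : 'rV[R]_n -> 'rV[R]_p) y :
  smoothv G y -> smoothv H (G y) -> smoothv (H \o G) y.
Proof.
by move=> sG sH j; exact: (@smooth_at_comp _ _ _ (fun z => H z 0 j) G y).
Qed.

Lemma smoothv_is_derive m n (G : 'rV[R]_m -> 'rV[R]_n) y v :
  smoothv G y -> is_derive y v G (v *m jac G y).
Proof.
move=> sG.
have dG j : is_derive y v (fun z => G z 0 j)
     (\sum_i v 0 i * 'D_(delta_mx 0 i) (fun z => G z 0 j) y).
  by apply: Ck1_derive; exact: smooth_at_Ck.
have dGv : derivable G y v.
  by apply/derivable_mxP => i j; rewrite ord1; have [] := dG j.
split => //; rewrite derive_mx//; apply/matrixP => i j; rewrite ord1 !mxE.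
by have [_ ->] := dG j; apply: eq_bigr => k _; rewrite !mxE.
Qed.

Lemma jac_comp m n p (G : 'rV[R]_m -> 'rV[R]_n) (H : 'rV[R]_n -> 'rV[R]_p) y :
  smoothv G y -> smoothv H (G y) -> jac (H \o G) y = jac G y *m jac H (G y).
Proof.
move=> sG sH; apply/matrixP => i j; rewrite !mxE.
have [d1 d2] := smoothv_is_derive (delta_mx 0 i) sG.
have [_ ->] := @is_derive_comp_rV _ _ _ (fun z => H z 0 j) G y (delta_mx 0 i)
  (smooth_at_Ck 1 (sH j)) d1.
by apply: eq_bigr => k _; rewrite d2 -rowE !mxE.
Qed.

Lemma jac_eq m n (G H : 'rV[R]_m -> 'rV[R]_n) y :
  {near y, G =1 H} -> jac G y = jac H y.
Proof.
move=> GH; apply/matrixP => i j; rewrite !mxE; apply: near_eq_derive.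
exact: (near_eq_app (fun v : 'rV[R]_n => v 0 j)).
Qed.

Lemma smoothv_affine m n (a : 'rV[R]_n) (B : 'M[R]_(m, n)) y :
  smoothv (fun z => a + z *m B) y.
Proof.
move=> j.
have := smooth_atD (smooth_at_cst (a 0 j) y) (@smooth_at_sum _ _ _
  (index_enum 'I_m) predT (fun i z => z 0 i * B i j) y
  (fun i _ => smooth_atM (smooth_at_coord i y) (smooth_at_cst (B i j) y))).
by apply: smooth_at_eq; apply: near_all => z; rewrite !mxE.
Qed.

Lemma jac_affine m n (a : 'rV[R]_n) (B : 'M[R]_(m, n)) y :
  jac (fun z => a + z *m B) y = B.
Proof.
apply/row_matrixP => i; rewrite !rowE.
have [_ <-] := smoothv_is_derive (delta_mx 0 i) (smoothv_affine a B y).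
pose q (h : R) := h^-1 *: (((fun z : 'rV[R]_m => a + z *m B) \o shift y)
  (h *: delta_mx 0 i) - (a + y *m B)).
have E : {near 0^', (fun=> delta_mx 0 i *m B) =1 q}.
  near=> h; rewrite /q /= mulmxDl -scalemxAl opprD addrACA subrr add0r addrK.
  by rewrite scalerA mulVf ?scale1r//; near: h; exact: nbhs_dnbhs_neq.
apply: cvg_lim => //.
exact: cvg_trans (@near_eq_cvg _ _ (0^') _ _ _ E) (cvg_cst _).
Unshelve. all: by end_near. Qed.

Lemma jac_id n (y : 'rV[R]_n) : jac id y = 1%:M.
Proof.
rewrite -(jac_affine 0 1%:M y); apply: jac_eq.
by apply: near_all => z; rewrite add0r mulmx1.
Qed.

Lemma smoothv_row_mx m n p (G : 'rV[R]_m -> 'rV[R]_n) (H : 'rV[R]_m -> 'rV[R]_p) y :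
  smoothv G y -> smoothv H y -> smoothv (fun z => row_mx (G z) (H z)) y.
Proof.
move=> sG sH j; case: (split_ordP j) => k ->.
  by apply: smooth_at_eq (sG k); apply: near_all => z; rewrite row_mxEl.
by apply: smooth_at_eq (sH k); apply: near_all => z; rewrite row_mxEr.
Qed.

Lemma jac_row_mx m n p (G : 'rV[R]_m -> 'rV[R]_n) (H : 'rV[R]_m -> 'rV[R]_p) y :
  jac (fun z => row_mx (G z) (H z)) y = row_mx (jac G y) (jac H y).
Proof.
apply/matrixP => i j; rewrite mxE; case: (split_ordP j) => k ->.
  by rewrite row_mxEl mxE; congr ('D__ _ _); apply/funext => z; rewrite row_mxEl.
by rewrite row_mxEr mxE; congr ('D__ _ _); apply/funext => z; rewrite row_mxEr.
Qed.

Lemma Ck_det k m n (M : 'rV[R]_m -> 'M[R]_n) y :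
  (forall i j, Ck k (fun z => M z i j) y) -> Ck k (fun z => \det (M z)) y.
Proof.
move=> CM; apply: Ck_sum => s _; apply: CkM; first exact: Ck_cst.
by apply: Ck_prod => i _; exact: CM.
Qed.

(** Cramer's rule. *)
Lemma Ck_invmx k m n (M : 'rV[R]_m -> 'M[R]_n) y :
  (forall i j, Ck k (fun z => M z i j) y) -> M y \in unitmx ->
  forall i j, Ck k (fun z => invmx (M z) i j) y.
Proof.
move=> CM uM i j.
have Cd := Ck_det CM.
have d0 : \det (M y) != 0 by rewrite -unitfE -unitmxE.
have nd : \forall z \near y, \det (M z) != 0.
  exact: (@cvgr_neq0 _ _ _ (nbhs y) _ _ _ (Ck_continuous Cd) d0).
have Cof : Ck k (fun z => \adj (M z) i j) y.
  have : Ck k (fun z => (-1) ^+ (j + i) * \det (row' j (col' i (M z)))) y.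
    apply: CkM; first exact: Ck_cst.
    apply: Ck_det => a b; apply: Ck_eq (CM (lift j a) (lift i b)).
    by apply: near_all => z; rewrite !mxE.
  by apply: Ck_eq; apply: near_all => z; rewrite mxE.
apply: Ck_eq (CkM (CkV d0 Cd) Cof).
by apply: filterS nd => z dz; rewrite /invmx unitmxE unitfE dz [RHS]mxE.
Qed.

Lemma cvg_mulmxr (T : Type) (F : set_system T) (FF : Filter F) m n
    (G : T -> 'rV[R]_m) (l : 'rV[R]_m) (A : 'M[R]_(m, n)) :
  G x @[x --> F] --> l -> G x *m A @[x --> F] --> l *m A.
Proof.
move=> /cvg_coord Gl; apply/cvg_coord => j.
have -> : (fun x => (G x *m A) 0 j) = fun x => \sum_i G x 0 i * A i j.
  by apply/funext => x; rewrite mxE.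
rewrite mxE.
apply: (@cvg_big R _ +%R 0 predT (fun p => @add_continuous R p) _ _ _
    (fun i x => G x 0 i * A i j)) => i _.
by apply: cvgM; [exact: Gl|exact: cvg_cst].
Qed.

End Jacobian.

Section InverseFunction.
Context {R : realType} {n : nat}.
Implicit Types (H : 'rV[R]_n -> 'rV[R]_n) (w y : 'rV[R]_n).

(** Strict differentiability: the uniformity in both points is what makes a map
    with invertible differential injective near [w]. *)
Lemma smoothv_strict m (H : 'rV[R]_n -> 'rV[R]_m) w eta :
  smoothv H w -> 0 < eta ->
  exists2 r, 0 < r & forall x y, ball w r x -> ball w r y ->
    `|H y - H x - (y - x) *m jac H w| <= eta * `|y - x|.
Proof.
move=> sH eta0.
have n1 : 0 < n%:R + 1 :> R by rewrite ltr_wpDl.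
pose e := eta / (n%:R + 1).
have e0 : 0 < e by rewrite divr_gt0.
pose P j (r : R) := forall z, ball w r z -> forall i,
    derivable (fun z => H z 0 j) z (delta_mx 0 i) /\
    `|'D_(delta_mx 0 i) (fun z => H z 0 j) z
      - 'D_(delta_mx 0 i) (fun z => H z 0 j) w| <= e.
have Pj : \forall r \near (0 : R)^'+, forall j, P j r.
  apply: (@filter_forall _ _ P (0^'+)) => j.
  have [r r0 Hr] := Ck1_partial_near e0 (smooth_at_Ck 1 (sH j)).
  near=> s => z bz; apply: Hr; apply: le_ball bz.
  by near: s; exact: nbhs_right_le.
have [r [r0 Hr]] : exists r, 0 < r /\ forall j, P j r.
  apply/(@filter_ex _ (0^'+)); apply: filterI => //; exact: nbhs_right_gt.
exists r => // x y bx by_.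
apply: mx_norm_le; first by rewrite mulr_ge0// ltW.
move=> i j; rewrite ord1 !mxE.
have := partial_mean_value (Hr j) bx by_.
have -> : \sum_i 'D_(delta_mx 0 i) (fun z => H z 0 j) w * (y 0 i - x 0 i)
    = \sum_i ((y - x) 0 i * jac H w i j).
  by apply: eq_bigr => k _; rewrite !mxE mulrC.
move=> /le_trans; apply.
rewrite mulrA ler_wpM2r//.
apply: (@le_trans _ _ ((n%:R + 1) * e)); first by rewrite ler_wpM2r ?lerDl// ltW.
by rewrite mulrC divfK ?gt_eqF.
Unshelve. all: by end_near. Qed.

Lemma jac1_expands H w : smoothv H w -> jac H w = 1%:M ->
  exists2 r, 0 < r & forall x y, ball w r x -> ball w r y ->
    `|H y - H x - (y - x)| <= 2^-1 * `|y - x| /\ `|y - x| <= 2 * `|H y - H x|.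
Proof.
move=> sH jH.
have [|r r0 Hr] := @smoothv_strict _ H w 2^-1 sH; first by rewrite invr_gt0.
exists r => // x y bx by_.
have := Hr x y bx by_; rewrite jH mulmx1 => h; split => //.
have := lerB_dist (y - x) (H y - H x).
by rewrite distrC => /le_trans/(_ h); lra.
Qed.

(** The preimage of [y] is the fixed point of the contraction
    [x |-> x - (H x - y)] of a closed ball. *)
Lemma local_surjection H w r : 0 < r ->
  (forall x y, ball w r x -> ball w r y ->
     `|H y - H x - (y - x)| <= 2^-1 * `|y - x|) ->
  forall y, ball (H w) (r / 4) y -> exists2 x, ball w r x & H x = y.
Proof.
move=> r0 Hr y; rewrite -ball_normE /= => yr.
pose U := closed_ball w (r / 2).
have r2 : 0 < r / 2 by rewrite divr_gt0.
have Ur x : U x -> ball w r x.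
  rewrite /U closed_ballE// /closed_ball_ /= -ball_normE /= => /le_lt_trans; apply.
  by lra.
pose T x := x - (H x - y).
have TU x : U x -> U (T x).
  move=> Ux; have := Hr w x (ballxx _ r0) (Ur _ Ux).
  move: (Ux); rewrite /U closed_ballE// /closed_ball_ /= => xw Hx.
  have -> : w - T x = (H x - H w - (x - w)) - (y - H w).
    by apply/matrixP => i j; rewrite !mxE; ring.
  rewrite (le_trans (ler_normB _ _))// -(distrC _ y) .
  move: xw Hx yr; rewrite (distrC w x) (distrC (H w) y).
  move: (`|_ - _ - _|) `|x - w| `|y - H w| => a b c; lra.


have ctr : is_contraction (@mkfun_fun _ _ U U T TU).
  exists (2^-1)%:nng. split. by rewrite /=; lra.
  move=> [x1 x2] /= [U1 U2]; rewrite /mkfun.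
  have -> : T x1 - T x2 = H x2 - H x1 - (x2 - x1).
    by apply/matrixP => i j; rewrite !mxE; ring.
  by rewrite (distrC x1); apply: Hr; exact: Ur.
have [||x Ux E] := banach_fixed_point ctr.
- exact: closed_ball_closed.
- by exists w; apply: closed_ballxx.
exists x; first by move: (Ur x Ux); rewrite -ball_normE.
move: E; rewrite /= /mkfun /T => /esym/eqP.
by rewrite subr_eq addrC -subr_eq subrr => /eqP/esym/eqP; rewrite subr_eq0 => /eqP.
Qed.

Lemma near_lipschitz_cvg (z : 'rV[R]_n -> 'rV[R]_n) y :
  (\forall y' \near y, `|z y' - z y| <= 2 * `|y' - y|) -> {for y, continuous z}.
Proof.
move=> lip; apply/(@cvgrPdist_le _ _ _ (nbhs y)) => e e0.
have e2 : 0 < e / 2 by rewrite divr_gt0.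
have /(@cvgrPdist_le _ _ _ (nbhs y)) /(_ _ e2) := @cvg_id _ (nbhs y).
apply: filterS2 lip => y' l h; rewrite distrC; apply: (le_trans l).
by rewrite distrC; lra.
Qed.

Lemma derive_local_inverse H (z : 'rV[R]_n -> 'rV[R]_n) y v :
  smoothv H (z y) -> jac H (z y) \in unitmx ->
  (\forall y' \near y, H (z y') = y') ->
  (\forall y' \near y, `|z y' - z y| <= 2 * `|y' - y|) ->
  is_derive y v z (v *m invmx (jac H (z y))).
Proof.
move=> sH uJ Hz lip; set A := jac H (z y).
pose q (h : R) := h^-1 *: (z (h *: v + y) - z y).
have line : h *: v + y @[h --> (0 : R)^'] --> y.
  rewrite -[X in _ --> X]add0r; apply: cvgD; last exact: cvg_cst.
  rewrite -[X in _ --> X](scale0r v); apply: cvgZr_tmp; exact: cvg_within.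
have zc := near_lipschitz_cvg lip.
have qA : q h *m A @[h --> 0^'] --> v.
  apply/cvgrPdist_le => e e0.
  pose eta := e / (2 * (`|v| + 1)).
  have v1 : 0 < `|v| + 1 by rewrite ltr_wpDl.
  have eta0 : 0 < eta by rewrite divr_gt0// mulr_gt0.
  have [r r0 Hr] := smoothv_strict sH eta0.
  near=> h.
  have h0 : h != 0 by near: h; exact: nbhs_dnbhs_neq.
  have E1 : H (z (h *: v + y)) = h *: v + y by near: h; apply: (line [set y' | H (z y') = y']); exact: Hz.
  have E2 : `|z (h *: v + y) - z y| <= 2 * `|h *: v + y - y|.
    near: h; apply: (line [set y' | `|z y' - z y| <= 2 * `|y' - y|]).
    exact: lip.
  have E3 : ball (z y) r (z (h *: v + y)).
    by near: h; apply: (line _ (zc _ (nbhsx_ballx (z y) r r0))).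
  have := Hr _ _ (ballxx _ r0) E3.
  rewrite E1 (nbhs_singleton Hz) -/A addrK => E4.
  have -> : v - q h *m A = h^-1 *: (h *: v - (z (h *: v + y) - z y) *m A).
    by rewrite scalerBr scalerA mulVf// scale1r /q -scalemxAl.
  rewrite normrZ normfV ler_pdivrMl ?normr_gt0//.
  apply: (le_trans E4).
  apply: (@le_trans _ _ (eta * (2 * (`|h| * (`|v| + 1))))).
    rewrite ler_wpM2l ?(ltW eta0)//; apply: (le_trans E2).
    by rewrite addrK normrZ ler_wpM2l// ler_wpM2l// lerDl.
  by rewrite /eta le_eqVlt; apply/orP; left; apply/eqP; field; rewrite gt_eqF.
have qcv : q h @[h --> 0^'] --> v *m invmx A.
  have -> : q = (fun h => q h *m A *m invmx A).
    by apply/funext => h; rewrite mulmxK.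
  exact: cvg_mulmxr.
by split; [apply/cvg_ex; eexists; exact: qcv|apply: cvg_lim => //; exact: qcv].
Unshelve. all: by end_near. Qed.

(** The local inverse exists and is Lipschitz by [local_surjection] and
    [jac1_expands].  Its first partial derivatives are the entries of the inverse
    Jacobian matrix at the value of the inverse itself, so each class C^k of the
    inverse gives the next one. *)
Theorem inverse_function H w : smoothv H w -> jac H w = 1%:M ->
  exists z : 'rV[R]_n -> 'rV[R]_n,
    [/\ smoothv z (H w), z (H w) = w,
        \forall y \near H w, H (z y) = y & \forall x \near w, z (H x) = x].
Proof.
move=> sH jH.
have [r1 r10 Hr1] := jac1_expands sH jH.
have nU : \forall x \near w, jac H x \in unitmx.
  have Cd : Ck 0 (fun x => \det (jac H x)) w.
    apply: Ck_det => i j.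
    have := smooth_at_Ck 0 (smooth_at_D i (sH j)).
    by apply: Ck_eq; apply: near_all => x; rewrite mxE.
  have d0 : \det (jac H w) != 0 by rewrite jH det1 oner_neq0.
  have h : \forall x \near w, \det (jac H x) != 0.
    exact: (@cvgr_neq0 _ _ _ (nbhs w) _ _ _ (Ck_continuous Cd) d0).
  by apply: filterS h => x; rewrite unitmxE unitfE.
have [r2 /= r20 Hr2] := (nbhs_ballP _ _).1 (filterI (smoothv_near sH) nU).
pose r := Num.min r1 r2.
have r0 : 0 < r by rewrite lt_min r10.
have br1 x : ball w r x -> ball w r1 x by apply: le_ball; rewrite ge_min lexx.
have br2 x : ball w r x -> ball w r2 x.
  by apply: le_ball; rewrite ge_min lexx orbT.
have Hr x y : ball w r x -> ball w r y ->
    `|H y - H x - (y - x)| <= 2^-1 * `|y - x| by move=> /br1 ? /br1 ?; apply Hr1.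
have inj x y : ball w r x -> ball w r y -> `|y - x| <= 2 * `|H y - H x|.
  by move=> /br1 ? /br1 ?; apply Hr1.
pose B := ball (H w) (r / 4).
have r4 : 0 < r / 4 by rewrite divr_gt0.
have HwB : B (H w) by exact: ballxx.
have oB : open B by exact: ball_open.
pose z y := xget w [set x | ball w r x /\ H x = y].
have zP y : B y -> ball w r (z y) /\ H (z y) = y.
  move=> By; have [x bx Hx] := local_surjection r0 Hr By.
  by apply: (@xgetPex _ w [set x | ball w r x /\ H x = y]); exists x.
have zlip y y' : B y -> B y' -> `|z y' - z y| <= 2 * `|y' - y|.
  by move=> /zP[b1 e1] /zP[b2 e2]; have := inj _ _ b1 b2; rewrite e1 e2.
have nB y : B y -> nbhs y B by move=> By; exact: open_nbhs_nbhs.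
have dz y v : B y -> is_derive y v z (v *m invmx (jac H (z y))).
  move=> By; have [/br2/Hr2[s1 u1] _] := zP y By.
  apply: derive_local_inverse => //.
    by apply: filterS (nB y By) => y' /zP[].
  by apply: filterS (nB y By) => y' By'; exact: zlip.
have zc y : B y -> {for y, continuous z}.
  move=> By; apply: near_lipschitz_cvg.
  by apply: filterS (nB y By) => y' By'; exact: zlip.
have zC k : forall y, B y -> forall j, Ck k (fun y => z y 0 j) y.
  elim: k => [|k IH] y By j.
    apply: filterS (nB y By) => y' By'.
    by have /continuous_coordP := zc y' By'; exact.
  have dzj y' i : B y' -> is_derive y' (delta_mx 0 i) (fun y => z y 0 j)
      (invmx (jac H (z y')) i j).
    move=> By'; have [d1 d2] := dz y' (delta_mx 0 i) By'; split.
      by move/derivable_mxP : d1; exact.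
    by move: d2; rewrite derive_mx// -rowE => /matrixP /(_ 0 j); rewrite !mxE.
  split.
    apply: filterS (nB y By) => y' By'; split.
      by have /continuous_coordP := zc y' By'; exact.
    by move=> i; have [] := dzj y' i By'.
  move=> i; have [/br2/Hr2[s1 u1] _] := zP y By.
  have : Ck k (fun y => invmx (jac H (z y)) i j) y.
    apply: (@Ck_invmx _ _ _ _ (fun y => jac H (z y))) => // a b.
    apply: (@Ck_comp _ _ _ _ (fun x => jac H x a b) z y); last by move=> l; exact: IH.
    have := smooth_at_Ck k (smooth_at_D a (s1 b)).
    by apply: Ck_eq; apply: near_all => x; rewrite mxE.
  apply: Ck_eq; apply: filterS (nB y By) => y' By'.
  by have [_ ->] := dzj y' i By'.
have zw x : ball w r x -> B (H x) -> z (H x) = x.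
  move=> bx /zP[b e]; apply/eqP; rewrite -subr_eq0 -normr_le0.
  by have := inj _ _ bx b; rewrite e subrr normr0 mulr0.
exists z; split.
- by move=> j; apply: filterS (nB _ HwB) => y By k; exact: zC.
- by apply: zw => //; exact: ballxx.
- by apply: filterS (nB _ HwB) => y /zP[].
- near=> x; apply: zw; near: x; first exact: nbhsx_ballx.
  exact: (smoothv_cont sH) (nB _ HwB).
Unshelve. all: by end_near. Qed.

End InverseFunction.

(** * Smooth maps between manifolds *)

Lemma near_comp (S T : topologicalType) (F : S -> T) (p : S) (P : T -> Prop) :
  {for p, continuous F} -> (\forall y \near F p, P y) ->
  \forall x \near p, P (F x).
Proof. by move=> cF H; exact: (cF P H). Qed.

Lemma open_near (T : topologicalType) (D : set T) p :
  open D -> D p -> \forall x \near p, D x.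
Proof. by move=> oD Dp; exact: open_nbhs_nbhs. Qed.

Lemma near_open (T : topologicalType) (D : set T) :
  (forall p, D p -> \forall x \near p, D x) -> open D.
Proof. by move=> H; rewrite openE => p /H. Qed.

Section Charts.
Context {R : realType} {T : topologicalType} {n : nat}.
Implicit Types (c : chart R T n) (p : T).

Lemma chart_to_cts c p : is_chart c -> chart_dom c p ->
  {for p, continuous (chart_to c)}.
Proof.
move=> ic dp; have := chart_to_continuous ic.
rewrite continuous_open_subspace; last exact: chart_open_dom.
by apply; rewrite inE.
Qed.

Lemma chart_from_cts c p : is_chart c -> chart_dom c p ->
  {for chart_to c p, continuous (chart_from c)}.
Proof.
move=> ic dp; have := chart_from_continuous ic.
rewrite continuous_open_subspace; last exact: chart_open_im.
by apply; rewrite inE; exists p.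
Qed.

Lemma near_chart_dom c p : is_chart c -> chart_dom c p ->
  \forall q \near p, chart_dom c q.
Proof. by move=> ic; apply: open_near; exact: chart_open_dom. Qed.

Lemma near_chart_im c p : is_chart c -> chart_dom c p ->
  \forall y \near chart_to c p, chart_dom c (chart_from c y) /\
    chart_to c (chart_from c y) = y.
Proof.
move=> ic dp.
have : \forall y \near chart_to c p, (chart_to c @` chart_dom c) y.
  by apply: open_near; [exact: chart_open_im|exists p].
by apply: filterS => _ [q dq <-]; rewrite (chart_toK ic).
Qed.

Lemma near_chart_from c p (P : T -> Prop) : is_chart c -> chart_dom c p ->
  (\forall q \near p, P q) -> \forall y \near chart_to c p, P (chart_from c y).
Proof.
move=> ic dp H; apply: near_comp; first exact: chart_from_cts.
by rewrite (chart_toK ic).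
Qed.

Lemma chart_image_open c (D : set T) : is_chart c -> open D ->
  open (chart_to c @` (chart_dom c `&` D)).
Proof.
move=> ic oD; apply: near_open => _ [p [dp Dp] <-].
have nD := near_chart_from ic dp (open_near oD Dp).
apply: filterS2 (near_chart_im ic dp) nD => y [dy E] Dy.
by exists (chart_from c y).
Qed.

End Charts.

Section SmoothMaps.
Context {R : realType}.

(** Pointwise versions of [smooth_fun] and [smooth_map], so that composing maps
    requires no bookkeeping of domains. *)
Definition smooth_fun_at (T : topologicalType) n (A : set (chart R T n)) (f : T -> R) p :=
  forall c, A c -> chart_dom c p -> smooth_at (f \o chart_from c) (chart_to c p).

Definition smooth_map_at (S T : topologicalType) m n (A : set (chart R S m))
    (B : set (chart R T n)) (F : S -> T) (p : S) :=
  {for p, continuous F} /\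
  forall d, B d -> chart_dom d (F p) ->
    forall j, smooth_fun_at A (fun x => chart_to d (F x) 0 j) p.

Section OneManifold.
Context (T : topologicalType) (n : nat) (A : set (chart R T n)).
Hypothesis hA : smooth_atlas A.

Lemma transition_smooth c d p : A c -> A d -> chart_dom c p -> chart_dom d p ->
  smoothv (fun y => chart_to d (chart_from c y)) (chart_to c p).
Proof.
move=> Ac Ad cp dp j.
have ic := atlas_chart hA Ac; have id_ := atlas_chart hA Ad.
have oI := chart_image_open ic (chart_open_dom id_).
have := atlas_compat hA Ac Ad j; rewrite (euclid_smoothP _ oI); apply.
by exists p.
Qed.

(** Other charts differ by a smooth transition map. *)
Lemma smooth_fun_at_chart c f p : A c -> chart_dom c p ->
  smooth_at (f \o chart_from c) (chart_to c p) -> smooth_fun_at A f p.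
Proof.
move=> Ac cp sf d Ad dp.
have ic := atlas_chart hA Ac; have id_ := atlas_chart hA Ad.
have E : smooth_at (fun y => (f \o chart_from c) (chart_to c (chart_from d y)))
    (chart_to d p).
  apply: smooth_at_comp; last exact: transition_smooth.
  by rewrite (chart_toK id_).
apply: smooth_at_eq E.
have := near_chart_from id_ dp (near_chart_dom ic cp).
by apply: filterS => y cy; rewrite /= (chart_toK ic).
Qed.

Lemma smooth_funP (D : set T) f : open D ->
  smooth_fun A D f <-> forall p, D p -> smooth_fun_at A f p.
Proof.
move=> oD; split=> [sf p Dp c Ac cp|sf c Ac].
  have oI := chart_image_open (atlas_chart hA Ac) oD.
  by have := sf c Ac; rewrite (euclid_smoothP _ oI); apply; exists p.
have oI := chart_image_open (atlas_chart hA Ac) oD.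
by rewrite (euclid_smoothP _ oI) => _ [p [cp Dp] <-]; exact: sf.
Qed.

Lemma smooth_fun_at_eq (f g : T -> R) p : {near p, f =1 g} -> smooth_fun_at A f p -> smooth_fun_at A g p.
Proof.
move=> fg sf c Ac cp; apply: smooth_at_eq (sf c Ac cp).
by have := near_chart_from (atlas_chart hA Ac) cp fg; apply: filterS.
Qed.

Lemma smooth_fun_at_cst a p : smooth_fun_at A (fun=> a) p.
Proof. by move=> c Ac cp; exact: smooth_at_cst. Qed.

Lemma smooth_fun_atD f g p : smooth_fun_at A f p -> smooth_fun_at A g p -> smooth_fun_at A (fun x => f x + g x) p.
Proof. by move=> sf sg c Ac cp; exact: smooth_atD (sf c Ac cp) (sg c Ac cp). Qed.

Lemma smooth_fun_atM f g p : smooth_fun_at A f p -> smooth_fun_at A g p -> smooth_fun_at A (fun x => f x * g x) p.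
Proof. by move=> sf sg c Ac cp; exact: smooth_atM (sf c Ac cp) (sg c Ac cp). Qed.

Lemma smooth_fun_at_cont f p : smooth_fun_at A f p -> {for p, continuous f}.
Proof.
move=> sf; have [c Ac cp] := atlas_cover hA p.
have ic := atlas_chart hA Ac.
have cf := smooth_at_cont (sf c Ac cp).
have := @continuous_comp _ _ _ (chart_to c) (f \o chart_from c) p
  (chart_to_cts ic cp) cf.
rewrite /prop_for /continuous_at /= (chart_toK ic cp).
have E : {near p, (f \o chart_from c) \o chart_to c =1 f}.
  by apply: filterS (near_chart_dom ic cp) => x dx; rewrite /= (chart_toK ic).
by apply: cvg_trans; exact: (near_eq_cvg E).
Qed.

End OneManifold.

Section TwoManifolds.
Context (S T : topologicalType) (m n : nat).
Context (A : set (chart R S m)) (B : set (chart R T n)).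
Hypothesis (hA : smooth_atlas A) (hB : smooth_atlas B).

Lemma smooth_map_at_smoothv c d F p : A c -> B d -> chart_dom c p ->
  chart_dom d (F p) -> smooth_map_at A B F p ->
  smoothv (fun y => chart_to d (F (chart_from c y))) (chart_to c p).
Proof. by move=> Ac Bd cp dp [_ sF] j; exact: (sF d Bd dp j c Ac cp). Qed.

Lemma smooth_fun_at_comp f F p : smooth_map_at A B F p -> smooth_fun_at B f (F p) -> smooth_fun_at A (f \o F) p.
Proof.
move=> sF sf; have [c Ac cp] := atlas_cover hA p.
have [d Bd dp] := atlas_cover hB (F p).
have ic := atlas_chart hA Ac; have id_ := atlas_chart hB Bd.
apply: (smooth_fun_at_chart hA Ac cp).
have sFv := smooth_map_at_smoothv Ac Bd cp dp sF.
have E : smooth_at (fun y => (f \o chart_from d) (chart_to d (F (chart_from c y))))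
    (chart_to c p).
  apply: smooth_at_comp; last exact: sFv.
  by rewrite (chart_toK ic cp); exact: sf.
apply: smooth_at_eq E.
have := near_chart_from ic cp (near_comp sF.1 (near_chart_dom id_ dp)).
by apply: filterS => y dy; rewrite /= (chart_toK id_).
Qed.

Lemma smooth_map_at_chart d F p : B d -> chart_dom d (F p) -> {for p, continuous F} ->
  (forall j, smooth_fun_at A (fun x => chart_to d (F x) 0 j) p) -> smooth_map_at A B F p.
Proof.
move=> Bd dp cF sF; split => // e Be ep j.
have [c Ac cp] := atlas_cover hA p.
have ic := atlas_chart hA Ac; have id_ := atlas_chart hB Bd.
apply: (smooth_fun_at_chart hA Ac cp).
have E : smooth_at (fun y => chart_to e (chart_from d
    (chart_to d (F (chart_from c y)))) 0 j) (chart_to c p).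
  apply: (@smooth_at_comp _ _ _ (fun y => chart_to e (chart_from d y) 0 j)
    (fun y => chart_to d (F (chart_from c y)))).
    rewrite (chart_toK ic cp); exact: (transition_smooth hB).
  by move=> k; exact: sF.
apply: smooth_at_eq E.
have := near_chart_from ic cp (near_comp cF (near_chart_dom id_ dp)).
by apply: filterS => y dy; rewrite /= (chart_toK id_).
Qed.

Lemma smooth_map_at_chart2 c d F p : A c -> B d -> chart_dom c p -> chart_dom d (F p) ->
  {for p, continuous F} ->
  smoothv (fun y => chart_to d (F (chart_from c y))) (chart_to c p) ->
  smooth_map_at A B F p.
Proof.
move=> Ac Bd cp dp cF sF; apply: (smooth_map_at_chart Bd dp cF) => j.
by apply: (smooth_fun_at_chart hA Ac cp); exact: (sF j).
Qed.

Lemma smooth_mapP (D : set S) F : open D ->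
  smooth_map A B D F <-> forall p, D p -> smooth_map_at A B F p.
Proof.
move=> oD.
have oDF : (forall x, D x -> {for x, continuous F}) -> forall d, B d ->
    open (D `&` F @^-1` chart_dom d).
  move=> cF d Bd; apply: near_open => p [Dp dp].
  apply: filterS2 (open_near oD Dp) _ => [x Dx dx|]; first by split; [|exact: dx].
  exact: near_comp (cF p Dp) (near_chart_dom (atlas_chart hB Bd) dp).
split=> [[cF sF] p Dp|sF].
  split; first exact: cF.
  move=> d Bd dp j; have := sF d Bd j.
  by rewrite (smooth_funP hA _ (oDF cF d Bd)); apply; split.
have cF x : D x -> {for x, continuous F} by move=> /sF[].
split => // d Bd j; rewrite (smooth_funP hA _ (oDF cF d Bd)) => p [Dp dp].
by have [_] := sF p Dp; apply.
Qed.

Lemma smooth_map_at_eq F F' p : {near p, F =1 F'} -> smooth_map_at A B F p -> smooth_map_at A B F' p.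
Proof.
move=> FF [cF sF]; split.
  rewrite /prop_for /continuous_at -(nbhs_singleton FF).
  exact: cvg_trans (near_eq_cvg FF) cF.
move=> d Bd; rewrite -(nbhs_singleton FF) => dp j.
apply: (smooth_fun_at_eq hA) (sF d Bd dp j).
exact: (near_eq_app (fun v => chart_to d v 0 j) FF).
Qed.

Lemma smooth_map_at_cst (q : T) p : smooth_map_at A B (fun=> q) p.
Proof.
split; first exact: cst_continuous.
by move=> d Bd dp j; exact: smooth_fun_at_cst.
Qed.

End TwoManifolds.

Lemma smooth_map_at_comp (S T U : topologicalType) m n k (A : set (chart R S m))
    (B : set (chart R T n)) (C : set (chart R U k)) F G p :
  smooth_atlas A -> smooth_atlas B ->
  smooth_map_at A B F p -> smooth_map_at B C G (F p) -> smooth_map_at A C (G \o F) p.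
Proof.
move=> hA hB sF [cG sG]; split; first by apply: continuous_comp => //; case: sF.
move=> d Cd dp j.
exact: (smooth_fun_at_comp hA hB (f := fun x => chart_to d (G x) 0 j) sF (sG d Cd dp j)).
Qed.

Lemma smooth_map_at_id (S : topologicalType) m (A : set (chart R S m)) p :
  smooth_atlas A -> smooth_map_at A A id p.
Proof.
move=> hA; split; first exact: cvg_id.
move=> d Ad dp j; apply: (smooth_fun_at_chart hA Ad dp).
apply: smooth_at_eq (smooth_at_coord j _).
apply: filterS (near_chart_im (atlas_chart hA Ad) dp) => y [_ E].
by rewrite /= E.
Qed.

Lemma jacobian_mx_comp (S T U : topologicalType) m n k (A : set (chart R S m))
    (B : set (chart R T n)) (C : set (chart R U k)) F G p a b c :
  smooth_atlas A -> smooth_atlas B -> A a -> B b -> C c ->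
  smooth_map_at A B F p -> smooth_map_at B C G (F p) ->
  chart_dom a p -> chart_dom b (F p) -> chart_dom c (G (F p)) ->
  jacobian_mx a c (G \o F) p = jacobian_mx a b F p *m jacobian_mx b c G (F p).
Proof.
move=> hA hB Aa Bb Cc sF sG ap bp cp.
have ia := atlas_chart hA Aa; have ib := atlas_chart hB Bb.
have sFv := smooth_map_at_smoothv Aa Bb ap bp sF.
have sGv := smooth_map_at_smoothv Bb Cc bp cp sG.
transitivity (jac ((fun y => chart_to c (G (chart_from b y))) \o
   (fun y => chart_to b (F (chart_from a y)))) (chart_to a p)).
  apply: jac_eq.
  have := near_chart_from ia ap (near_comp sF.1 (near_chart_dom ib bp)).
  by apply: filterS => y dy; rewrite /= (chart_toK ib).
rewrite jac_comp //; rewrite ?(chart_toK ia ap)//.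
Qed.

Lemma jacobian_mx_eq (S T : topologicalType) m n (A : set (chart R S m))
    F F' p (a : chart R S m) (b : chart R T n) : smooth_atlas A -> A a ->
  chart_dom a p -> {near p, F =1 F'} ->
  jacobian_mx a b F p = jacobian_mx a b F' p.
Proof.
move=> hA Aa ap FF; apply: jac_eq.
have := near_chart_from (atlas_chart hA Aa) ap FF.
exact: (near_eq_app (chart_to b)).
Qed.

(** Euclidean space as a manifold, so that charts and maps in coordinates obey
    the same composition rule as all other smooth maps. *)
Definition id_chart n : chart R 'rV[R]_n n := Chart setT id id.
Definition euc n : set (chart R 'rV[R]_n n) := [set id_chart n].

Lemma euc_atlas n : smooth_atlas (@euc n).
Proof.
split.
- move=> _ ->; split => //=.
  + exact: openT.
  + by rewrite image_id; exact: openT.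
  + by apply: continuous_subspaceT => x; exact: cvg_id.
  + by apply: continuous_subspaceT => x; exact: cvg_id.
- by move=> x; exists (id_chart n).
- move=> _ _ -> -> j /=; apply/euclid_smoothP.
    by rewrite setIT image_id; exact: openT.
  by move=> y _; exact: smooth_at_coord.
Qed.

Lemma smooth_map_at_euc m n (G : 'rV[R]_m -> 'rV[R]_n) y :
  smooth_map_at (@euc m) (@euc n) G y <-> smoothv G y.
Proof.
split=> [sG|sG].
  by move=> j; exact: (sG.2 (id_chart n) erefl I j (id_chart m) erefl I).
split; first exact: smoothv_cont.
by move=> _ -> _ j _ -> _; exact: (sG j).
Qed.

Section ChartMaps.
Context (T : topologicalType) (n : nat) (A : set (chart R T n)).
Hypothesis hA : smooth_atlas A.

Lemma smooth_map_at_chart_to c p : A c -> chart_dom c p -> smooth_map_at A (@euc n) (chart_to c) p.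
Proof.
move=> Ac cp; have ic := atlas_chart hA Ac; split; first exact: chart_to_cts.
by move=> _ -> _ j; have [_] := smooth_map_at_id p hA; apply.
Qed.

Lemma smooth_map_at_chart_from c p : A c -> chart_dom c p ->
  smooth_map_at (@euc n) A (chart_from c) (chart_to c p).
Proof.
move=> Ac cp; have ic := atlas_chart hA Ac.
split; first exact: chart_from_cts.
move=> d Ad; rewrite (chart_toK ic)// => dp j _ -> _.
exact: (transition_smooth hA Ac Ad cp dp j).
Qed.

End ChartMaps.

End SmoothMaps.

(** * Products of manifolds *)

Section Products.
Context {R : realType} {S T : topologicalType} {m n : nat}.
Context (A : set (chart R S m)) (B : set (chart R T n)).
Hypothesis (hA : smooth_atlas A) (hB : smooth_atlas B).

Lemma lsubmx_affine (y : 'rV[R]_(m + n)) : lsubmx y = 0 + y *m col_mx 1%:M 0.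
Proof. by rewrite add0r -{2}(hsubmxK y) mul_row_col mulmx1 mulmx0 addr0. Qed.

Lemma rsubmx_affine (y : 'rV[R]_(m + n)) : rsubmx y = 0 + y *m col_mx 0 1%:M.
Proof. by rewrite add0r -{2}(hsubmxK y) mul_row_col mulmx1 mulmx0 add0r. Qed.

Lemma smoothv_lsubmx (y : 'rV[R]_(m + n)) :
  smoothv (fun y : 'rV[R]_(m + n) => lsubmx y) y.
Proof.
apply: smoothv_eq (smoothv_affine 0 (col_mx 1%:M 0) y).
by apply: near_all => z; rewrite lsubmx_affine.
Qed.

Lemma smoothv_rsubmx (y : 'rV[R]_(m + n)) :
  smoothv (fun y : 'rV[R]_(m + n) => rsubmx y) y.
Proof.
apply: smoothv_eq (smoothv_affine 0 (col_mx 0 1%:M) y).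
by apply: near_all => z; rewrite rsubmx_affine.
Qed.

Lemma continuous_pair (U : topologicalType) (F : U -> S) (G : U -> T) p :
  {for p, continuous F} -> {for p, continuous G} ->
  {for p, continuous (fun x => (F x, G x))}.
Proof. by move=> cF cG; exact: cvg_pair. Qed.

Lemma continuous_fst (p : S * T) : {for p, continuous (@fst S T)}.
Proof. by case: p => x y; exact: cvg_fst. Qed.

Lemma continuous_snd (p : S * T) : {for p, continuous (@snd S T)}.
Proof. by case: p => x y; exact: cvg_snd. Qed.

Lemma prod_is_chart (a : chart R S m) (b : chart R T n) : is_chart a -> is_chart b -> is_chart (prod_chart a b).
Proof.
move=> ia ib.
have oI : open (chart_to (prod_chart a b) @` chart_dom (prod_chart a b)).
  apply: near_open => _ [[x y] [/= ax bY] <-].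
  have na : \forall z \near (row_mx (chart_to a x) (chart_to b y)),
      chart_dom a (chart_from a (lsubmx z)) /\
      chart_to a (chart_from a (lsubmx z)) = lsubmx z.
    apply: (@near_comp _ _ (fun z : 'rV[R]_(m + n) => lsubmx z) _
      (fun v => chart_dom a (chart_from a v) /\ chart_to a (chart_from a v) = v)).
      exact: smoothv_cont (smoothv_lsubmx _).
    by rewrite row_mxKl; exact: near_chart_im.
  have nb : \forall z \near (row_mx (chart_to a x) (chart_to b y)),
      chart_dom b (chart_from b (rsubmx z)) /\
      chart_to b (chart_from b (rsubmx z)) = rsubmx z.
    apply: (@near_comp _ _ (fun z : 'rV[R]_(m + n) => rsubmx z) _
      (fun v => chart_dom b (chart_from b v) /\ chart_to b (chart_from b v) = v)).
      exact: smoothv_cont (smoothv_rsubmx _).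
    by rewrite row_mxKr; exact: near_chart_im.
  apply: filterS2 na nb => z [a1 a2] [b1 b2].
  exists (chart_from a (lsubmx z), chart_from b (rsubmx z)) => //=.
  by rewrite a2 b2 hsubmxK.
have oD : open (chart_dom (prod_chart a b)).
  apply: near_open => -[x y] [/= ax bY].
  have na := near_comp (continuous_fst (p := (x, y))) (near_chart_dom ia ax).
  have nb := near_comp (continuous_snd (p := (x, y))) (near_chart_dom ib bY).
  exact: filterI na nb.
split => //.
- rewrite continuous_open_subspace// => -[x y]; rewrite inE => -[/= ax bY].
  apply/continuous_coordP => j; case: (split_ordP j) => k ->.
    have -> : (fun p => chart_to (prod_chart a b) p 0 (lshift n k))
      = (fun p : S * T => chart_to a p.1 0 k).
      by apply/funext => p /=; rewrite row_mxEl.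
    have /continuous_coordP/(_ k) := chart_to_cts ia ax.
    exact: (continuous_comp (continuous_fst (p := (x, y)))).
  have -> : (fun p => chart_to (prod_chart a b) p 0 (rshift m k))
    = (fun p : S * T => chart_to b p.2 0 k).
    by apply/funext => p /=; rewrite row_mxEr.
  have /continuous_coordP/(_ k) := chart_to_cts ib bY.
  exact: (continuous_comp (continuous_snd (p := (x, y)))).
- rewrite continuous_open_subspace// => z; rewrite inE => -[[x y] [/= ax bY] <-].
  apply: (@continuous_pair 'rV[R]_(m + n) (fun z => chart_from a (lsubmx z))
    (fun z => chart_from b (rsubmx z))).
    apply: (@continuous_comp _ _ _ (fun z => lsubmx z) (chart_from a)).
      exact: smoothv_cont (smoothv_lsubmx _).
    by rewrite row_mxKl; exact: chart_from_cts.
  apply: (@continuous_comp _ _ _ (fun z => rsubmx z) (chart_from b)).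
    exact: smoothv_cont (smoothv_rsubmx _).
  by rewrite row_mxKr; exact: chart_from_cts.
- move=> [x y] [/= ax bY]; rewrite row_mxKl row_mxKr.
  by rewrite (chart_toK ia)// (chart_toK ib).
Qed.

Lemma prod_smooth_atlas : smooth_atlas (prod_atlas A B).
Proof.
split.
- move=> _ [a Aa [b Bb ->]].
  exact: prod_is_chart (atlas_chart hA Aa) (atlas_chart hB Bb).
- move=> [x y]; have [a Aa ax] := atlas_cover hA x.
  have [b Bb bY] := atlas_cover hB y.
  by exists (prod_chart a b) => //; exists a => //; exists b.
- move=> _ _ [a Aa [b Bb ->]] [a' Aa' [b' Bb' ->]] j.
  have ip := prod_is_chart (atlas_chart hA Aa) (atlas_chart hB Bb).
  have ip' := prod_is_chart (atlas_chart hA Aa') (atlas_chart hB Bb').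
  rewrite (euclid_smoothP _ (chart_image_open ip (chart_open_dom ip'))).
  move=> _ [[x y] [[/= ax bY] [/= ax' bY']] <-].
  move: j; apply: smoothv_row_mx.
    apply: (@smoothv_comp _ _ _ _ (fun z => lsubmx z)
      (fun z => chart_to a' (chart_from a z))); first exact: smoothv_lsubmx.
    by rewrite row_mxKl; exact: (transition_smooth hA).
  apply: (@smoothv_comp _ _ _ _ (fun z => rsubmx z)
    (fun z => chart_to b' (chart_from b z))); first exact: smoothv_rsubmx.
  by rewrite row_mxKr; exact: (transition_smooth hB).
Qed.

Lemma prod_atlas_chart a b : A a -> B b -> prod_atlas A B (prod_chart a b).
Proof. by move=> Aa Bb; exists a => //; exists b. Qed.

Lemma smooth_map_at_pair (U : topologicalType) k (C : set (chart R U k))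
    (F : U -> S) (G : U -> T) p : smooth_atlas C ->
  smooth_map_at C A F p -> smooth_map_at C B G p ->
  smooth_map_at C (prod_atlas A B) (fun x => (F x, G x)) p.
Proof.
move=> hC sF sG; have [a Aa ap] := atlas_cover hA (F p).
have [b Bb bp] := atlas_cover hB (G p).
apply: (smooth_map_at_chart hC prod_smooth_atlas (prod_atlas_chart Aa Bb)) => //.
  by apply: continuous_pair; [case: sF|case: sG].
move=> j c Cc cp; move: j; apply: smoothv_row_mx.
  exact: smooth_map_at_smoothv Cc Aa cp ap sF.
exact: smooth_map_at_smoothv Cc Bb cp bp sG.
Qed.

Lemma smooth_map_at_fst (p : S * T) : smooth_map_at (prod_atlas A B) A (@fst S T) p.
Proof.
have [a Aa ap] := atlas_cover hA p.1; have [b Bb bp] := atlas_cover hB p.2.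
have ia := atlas_chart hA Aa.
apply: (smooth_map_at_chart2 prod_smooth_atlas hA (prod_atlas_chart Aa Bb) Aa) => //.
  exact: continuous_fst.
apply: (@smoothv_comp _ _ _ _ (fun z => lsubmx z)
  (fun z => chart_to a (chart_from a z))); first exact: smoothv_lsubmx.
by rewrite row_mxKl; exact: (transition_smooth hA).
Qed.

Lemma smooth_map_at_snd (p : S * T) : smooth_map_at (prod_atlas A B) B (@snd S T) p.
Proof.
have [a Aa ap] := atlas_cover hA p.1; have [b Bb bp] := atlas_cover hB p.2.
have ib := atlas_chart hB Bb.
apply: (smooth_map_at_chart2 prod_smooth_atlas hB (prod_atlas_chart Aa Bb) Bb) => //.
  exact: continuous_snd.
apply: (@smoothv_comp _ _ _ _ (fun z => rsubmx z)
  (fun z => chart_to b (chart_from b z))); first exact: smoothv_rsubmx.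
by rewrite row_mxKr; exact: (transition_smooth hB).
Qed.

End Products.

Lemma jacobian_mx_pair (R : realType) (S T U : topologicalType) (m n k : nat)
    (F : U -> S) (G : U -> T) p (c : chart R U k) (a : chart R S m)
    (b : chart R T n) :
  jacobian_mx c (prod_chart a b) (fun x => (F x, G x)) p =
  row_mx (jacobian_mx c a F p) (jacobian_mx c b G p).
Proof. exact: jac_row_mx. Qed.

(** * Iterated chain rule and bump functions *)

Section WordChainRule.
Context {R : realType} {m n : nat}.

Lemma smooth_comp_near (f : 'rV[R]_n -> R) (G : 'rV[R]_m -> 'rV[R]_n) y :
  smoothv G y -> smooth_at f (G y) ->
  \forall z \near y, smoothv G z /\ smooth_at f (G z).
Proof.
move=> sG sf.
have sf' : \forall z \near y, smooth_at f (G z).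
  apply: (@near_comp _ _ G y (smooth_at f)); first exact: smoothv_cont.
  exact: smooth_at_near.
exact: filterI (smoothv_near sG) sf'.
Qed.

(** Faa di Bruno without the combinatorics: it matters only that the
    coefficients depend on [G] alone and that words do not get longer.  One more
    derivative either falls on a coefficient or, by the chain rule, prolongs a
    word by one letter. *)
Lemma partial_comp (G : 'rV[R]_m -> 'rV[R]_n) (l : seq 'I_m) :
  exists (I : finType) (b : I -> 'rV[R]_m -> R) (w : I -> seq 'I_n),
    (forall q, (size (w q) <= size l)%N) /\
    forall y, smoothv G y -> (forall q, smooth_at (b q) y) /\
      forall f, smooth_at f (G y) ->
        partial l (fun z => f (G z)) y = \sum_q b q y * partial (w q) f (G y).
Proof.
elim: l => [|i l [I [b [w [sw H]]]]].
  exists 'I_1, (fun _ _ => 1), (fun=> [::]); split => // y _; split.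
    by move=> _; exact: smooth_at_cst.
  by move=> f _; rewrite big_ord1 mul1r.
pose b' (q : I + I * 'I_n) := match q with
  | inl q => 'D_(delta_mx 0 i) (b q)
  | inr p => fun z => b p.1 z * 'D_(delta_mx 0 i) (fun z => G z 0 p.2) z end.
pose w' (q : I + I * 'I_n) := match q with
  | inl q => w q | inr p => p.2 :: w p.1 end.
exists (I + I * 'I_n)%type, b', w'; split.
  move=> [q|[q j]] /=; last by rewrite ltnS.
  exact: leq_trans (sw q) (leqnSn _).
move=> y sG; have [sb Hy] := H y sG; split.
  move=> [q|[q j]] /=; first exact: smooth_at_D.
  by apply: smooth_atM => //; exact: smooth_at_D.
move=> f sf /=.
have [dG _] := smoothv_is_derive (delta_mx 0 i) sG.
have dterm q : is_derive y (delta_mx 0 i)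
    (fun z => b q z * partial (w q) f (G z))
    ('D_(delta_mx 0 i) (b q) y * partial (w q) f (G y) +
     b q y * \sum_j 'D_(delta_mx 0 i) (fun z => G z 0 j) y *
        'D_(delta_mx 0 j) (partial (w q) f) (G y)).
  have d1 : is_derive y (delta_mx 0 i) (b q) ('D_(delta_mx 0 i) (b q) y).
    by apply: derivableP; exact: smooth_at_derivable.
  have d2 := @is_derive_comp_rV _ _ _ (partial (w q) f) G y (delta_mx 0 i)
    (smooth_at_Ck 1 (smooth_at_partial (w q) sf)) dG.
  have [e1 e2] := is_deriveM d1 d2.
  split => //; rewrite [LHS]e2 /GRing.scale /= addrC mulrC; congr (_ + _ * _).
  apply: eq_bigr => j _; congr (_ * _).
  by rewrite derive_mx// mxE.
have E : {near y, (fun z => \sum_q b q z * partial (w q) f (G z)) =1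
    partial l (fun z => f (G z))}.
  apply: filterS (smooth_comp_near sG sf) => z [sGz sfz].
  by have [_ ->] := H z sGz.
rewrite -(near_eq_derive _ E).
have [_ ->] : is_derive y (delta_mx 0 i)
    (fun z => \sum_q b q z * partial (w q) f (G z))
    (\sum_q ('D_(delta_mx 0 i) (b q) y * partial (w q) f (G y) +
     b q y * \sum_j 'D_(delta_mx 0 i) (fun z => G z 0 j) y *
        'D_(delta_mx 0 j) (partial (w q) f) (G y))).
  elim: (index_enum I) => [|q r IH].
    have -> : (fun z => \sum_(q <- [::]) b q z * partial (w q) f (G z))
        = (fun _ : 'rV[R]_m => 0 : R).
      by apply/funext => z; rewrite big_nil.
    by rewrite big_nil; exact: is_derive_cst.
  have -> : (fun z => \sum_(q <- q :: r) b q z * partial (w q) f (G z))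
      = (fun z => b q z * partial (w q) f (G z)) +
        (fun z => \sum_(q <- r) b q z * partial (w q) f (G z)).
    by apply/funext => z; rewrite big_cons.
  by rewrite big_cons; apply: is_deriveD.
rewrite big_split big_sumType /=; congr (_ + _).
transitivity (\sum_q \sum_j b q y * 'D_(delta_mx 0 i) (fun z => G z 0 j) y *
    'D_(delta_mx 0 j) (partial (w q) f) (G y)).
  by apply: eq_bigr => q _; rewrite mulr_sumr; apply: eq_bigr => j _; rewrite mulrA.
by rewrite pair_bigA.
Qed.

End WordChainRule.

(** Brings the combinations produced by the chain rule into the form with one
    coefficient per word that differential operators have. *)
Lemma sum_by_word (R : realType) (J I : finType) (k : nat) (w : I -> seq J)
    (b : I -> R) (g : seq J -> R) : (forall q, (size (w q) <= k)%N) ->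
  \sum_(j < k.+1) \sum_(u : j.-tuple J) (\sum_(q | w q == u) b q) * g u
    = \sum_q b q * g (w q).
Proof.
move=> sw.
transitivity (\sum_(j < k.+1) \sum_(u : j.-tuple J) \sum_q
    (if w q == u then b q * g (w q) else 0)).
  apply: eq_bigr => j _; apply: eq_bigr => u _.
  by rewrite mulr_suml big_mkcond; apply: eq_bigr => q _; case: eqP => [->|].
under eq_bigr => j _ do rewrite exchange_big.
rewrite exchange_big; apply: eq_bigr => q _ /=.
have sq : (size (w q) < k.+1)%N by rewrite ltnS.
rewrite (bigD1 (Ordinal sq))//= [X in _ + X]big1 ?addr0; last first.
  move=> j jq; rewrite big1// => u _; case: eqP => // E; case/negP: jq.
  by apply/eqP/val_inj; rewrite /= E size_tuple.
rewrite (bigD1 (in_tuple (w q)))//= eqxx big1 ?addr0// => u uq.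
case: eqP => // E; case/negP: uq; apply/eqP/val_inj; exact: esym.
Qed.

Section Bump.
Context {R : realType}.

(** The functions x^-k exp(-1/x) on x > 0, extended by 0: a family of
    continuous functions closed under differentiation. *)
Definition flat (k : nat) (x : R) : R :=
  if 0 < x then (x^-1) ^+ k * expR (- x^-1) else 0.

(** The exponential series contains the term of degree [k.+1]. *)
Lemma flat_bound k x : `|flat k x| <= (k.+1)`!%:R * `|x|.
Proof.
rewrite /flat; case: ifPn => x0; last by rewrite normr0 mulr_ge0.
have u0 : 0 < x^-1 by rewrite invr_gt0.
rewrite ger0_norm ?mulr_ge0 ?exprn_ge0 ?expR_ge0 ?(ltW u0)// (gtr0_norm x0).
have f0 : 0 < (k.+1)`!%:R :> R by rewrite ltr0n fact_gt0.
have H : (x^-1) ^+ k.+1 <= (k.+1)`!%:R * expR (x^-1).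
  rewrite -ler_pdivrMl// mulrC.
  by apply: le_trans (expR_ge1Dxn k (ltW u0)); rewrite lerDr.
rewrite expRN ler_pdivrMr ?expR_gt0// mulrAC -ler_pdivrMr//.
by rewrite mulrC -exprS.
Qed.

Lemma flat_is_derive k x :
  is_derive x (1 : R) (flat k) (- k%:R * flat k.+1 x + flat k.+2 x).
Proof.
have [x0|x0|x0] := ltgtP x 0.
- have E : {near x, (fun _ : R => 0 : R) =1 flat k}.
    have : \forall y \near x, y < 0 by exact: lt_nbhsl.
    by apply: filterS => y y0; rewrite /flat ltNge (ltW y0).
  apply: (near_eq_is_derive E); rewrite /flat ltNge (ltW x0) /= mulr0 addr0.
  exact: is_derive_cst.
- have Xk (i : nat) (y : R) : ((fun y : R => y^-1) ^+ i) y = (y^-1) ^+ i.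
    by elim: i => [|i IH]; rewrite ?expr0// !exprS -IH.
  have E : {near x, ((fun y : R => y^-1) ^+ k * (expR \o (fun y : R => - y^-1)))
      =1 flat k}.
    have : \forall y \near x, 0 < y by exact: lt_nbhsr.
    by apply: filterS => y y0; rewrite /flat y0 [LHS]/GRing.mul /= Xk.
  apply: (near_eq_is_derive E); rewrite /flat x0.
  have xn : x != 0 by rewrite gt_eqF.
  have dV : is_derive x (1 : R) (fun y : R => y^-1) (- x ^- 2).
    have dx : derivable (id : R -> R) x 1 by exact: derivable_id.
    split; first exact: (derivableV xn dx).
    by rewrite [LHS](deriveV xn dx) derive_id /GRing.scale /= mulr1.
  have dX := is_deriveX k dV.
  have dN := is_deriveN dV.
  have dE := @is_derive1_comp R expR (fun y : R => - y^-1) x _ _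
    (is_derive_expR (- x^-1)) dN.
  apply: (is_derive_eq (is_deriveM dX dE)).
  rewrite opprK /GRing.scale /= Xk -exprVn.
  set u := x^-1; set E' := expR _.
  case: (k) => [|j]; rewrite /=; first by ring.
  by rewrite !exprS; set N := j.+1%:R; ring.
- rewrite x0 /flat ltxx mulr0 addr0.
  have E : {near 0^', flat k.+1 =1
      (fun h : R => h^-1 *: ((flat k \o shift 0) (h *: 1) - flat k 0))}.
    near=> h; rewrite /= addr0 /flat ltxx subr0 [h%:A]mulr1 /GRing.scale /=.
    by case: ifP; rewrite ?mulr0// exprS mulrA.
  have H : flat k.+1 h @[h --> 0^'] --> (0 : R).
    apply/cvgrPdist_le => e e0.
    have f0 : 0 < (k.+2)`!%:R :> R by rewrite ltr0n fact_gt0.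
    near=> h; rewrite sub0r normrN (le_trans (flat_bound _ _))//.
    rewrite -ler_pdivlMl//; near: h.
    by apply: dnbhs0_le; rewrite mulr_gt0// invr_gt0.
  have {}H := cvg_trans (@near_eq_cvg _ _ (0^') _ _ _ E) H.
  by split; [apply/cvg_ex; eexists; exact: H|apply: cvg_lim => //; exact: H].
Unshelve. all: by end_near. Qed.

Lemma Ck_flat j k (v : 'rV[R]_1) : Ck j (fun v : 'rV[R]_1 => flat k (v 0 0)) v.
Proof.
have dF l (z : 'rV[R]_1) i : is_derive z (delta_mx 0 i)
    (fun v : 'rV[R]_1 => flat l (v 0 0)) (- l%:R * flat l.+1 (z 0 0) + flat l.+2 (z 0 0)).
  have [d1 d2] := flat_is_derive l (z 0 0).
  have E : (fun h : R => h^-1 *: (((fun v : 'rV[R]_1 => flat l (v 0 0)) \o shift z)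
      (h *: delta_mx 0 i) - flat l (z 0 0)))
    = (fun h : R => h^-1 *: ((flat l \o shift (z 0 0)) (h *: 1) - flat l (z 0 0))).
    by apply/funext => h /=; rewrite !mxE ord1 eqxx.
  by split; [rewrite /derivable E|rewrite /derive E].
have cF l (z : 'rV[R]_1) : {for z, continuous (fun v : 'rV[R]_1 => flat l (v 0 0))}.
  apply: (@continuous_comp _ _ _ (fun v : 'rV[R]_1 => v 0 0) (flat l)).
    exact: coord_continuous.
  have [d1 _] := flat_is_derive l (z 0 0).
  exact/differentiable_continuous/derivable1_diffP.
elim: j k v => [|j IH] k v; first by apply: near_all => z; exact: cF.
split; first by apply: near_all => z; split => // i; have [] := dF k z i.
move=> i; have -> : 'D_(delta_mx 0 i) (fun v : 'rV[R]_1 => flat k (v 0 0)) =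
  (fun v : 'rV[R]_1 => - k%:R * flat k.+1 (v 0 0) + flat k.+2 (v 0 0)).
  by apply/funext => z; have [] := dF k z i.
by apply: CkD => //; apply: CkM => //; exact: Ck_cst.
Qed.

Lemma smooth_at_flat n k (u : 'rV[R]_n -> R) y :
  smooth_at u y -> smooth_at (fun z => flat k (u z)) y.
Proof.
move=> su.
have := @smooth_at_comp R 1 n (fun v : 'rV[R]_1 => flat k (v 0 0))
  (fun z => \row__ u z) y.
have E (j : 'I_1) : {near y, u =1 (fun z => (\row__ u z : 'rV[R]_1) 0 j)}.
  by apply: near_all => z; rewrite mxE.
move=> /(_ _ _)/smooth_at_eq; apply.
- by apply: near_all => z; rewrite mxE.
- by apply: near_all => z j; exact: Ck_flat.
- by move=> j; exact: smooth_at_eq (E j) su.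
Qed.

Definition cube_bump n (a : 'rV[R]_n) (r : R) (y : 'rV[R]_n) : R :=
  \prod_i flat 0 (r ^+ 2 - (y 0 i - a 0 i) ^+ 2).

Lemma cube_bump_smooth n (a : 'rV[R]_n) r y : smooth_at (cube_bump a r) y.
Proof.
have H i : smooth_at (fun y : 'rV[R]_n =>
    flat 0 (r ^+ 2 - (y 0 i - a 0 i) ^+ 2)) y.
  apply: smooth_at_flat; apply: smooth_atD; first exact: smooth_at_cst.
  have s1 : smooth_at (fun z : 'rV[R]_n => z 0 i - a 0 i) y.
    by apply: smooth_atD; [exact: smooth_at_coord|exact: smooth_at_cst].
  exact: smooth_atN (smooth_atM s1 s1).
rewrite /cube_bump; elim: (index_enum _) => [|i s IH].
  apply: smooth_at_eq (smooth_at_cst 1 y).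
  by apply: near_all => z; rewrite big_nil.
apply: smooth_at_eq (smooth_atM (H i) IH).
by apply: near_all => z; rewrite big_cons.
Qed.

Lemma cube_bump_gt0 n (a : 'rV[R]_n) r : 0 < r -> 0 < cube_bump a r a.
Proof.
move=> r0; apply: prodr_gt0 => i _.
by rewrite subrr expr0n subr0 /flat exprn_gt0// expr0 mul1r expR_gt0.
Qed.

Lemma cube_bump_out n (a : 'rV[R]_n) r y : 0 < r -> ~ ball a r y ->
  cube_bump a r y = 0.
Proof.
move=> r0 nb; have [i hi] : exists i, r <= `|a 0 i - y 0 i|.
  apply: contrapT => /forallNP H; apply: nb; apply/rV_ballP; split => // i.
  by rewrite ltNge; apply/negP; exact: H.
rewrite /cube_bump (bigD1 i)//= /flat ifF ?mul0r//.
apply/negbTE; rewrite -leNgt subr_le0.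
rewrite -(real_normK (num_real (y 0 i - a 0 i))) distrC.
by rewrite lerXn2r// nnegrE ltW.
Qed.

End Bump.

Section LocalCompactness.
Context {R : realType} {T : topologicalType} {n : nat} (A : set (chart R T n)).
Hypothesis hA : smooth_atlas A.

Lemma near_closed_ball (y : 'rV[R]_n) (P : 'rV[R]_n -> Prop) :
  (\forall z \near y, P z) -> exists2 r, 0 < r &
    forall z, closed_ball y r z -> P z.
Proof.
move=> /nbhs_ballP[r /= r0 H]; exists (r / 2); first by rewrite divr_gt0.
move=> z; rewrite closed_ballE ?divr_gt0// => zr; apply: H.
rewrite -ball_normE /=; apply: (le_lt_trans zr).
by rewrite ltr_pdivrMr// ltr_pMr// ltr1n.
Qed.

Lemma closed_ball_compact (y : 'rV[R]_n) r : 0 < r -> compact (closed_ball y r).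
Proof.
move=> r0; apply: bounded_closed_compact; last exact: closed_ball_closed.
rewrite closed_ballE//; exists (`|y| + r); split; first exact: num_real.
move=> M HM z /= zr; apply: le_trans (ltW HM).
rewrite -lerBlDl; apply: le_trans zr; rewrite distrC.
exact: lerB_dist.
Qed.

Definition chart_cube (c : chart R T n) p r :=
  chart_from c @` closed_ball (chart_to c p) r.

Lemma chart_cubeP c p (P : T -> Prop) : is_chart c -> chart_dom c p ->
  (\forall q \near p, P q) -> exists r, [/\ 0 < r, compact (chart_cube c p r),
    (forall q, chart_cube c p r q -> P q /\ chart_dom c q),
    (forall y, closed_ball (chart_to c p) r y ->
       chart_to c (chart_from c y) = y) &
    \forall q \near p, chart_cube c p r q].
Proof.
move=> ic cp nP.
have H : \forall y \near chart_to c p, (chart_dom c (chart_from c y) /\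
    chart_to c (chart_from c y) = y) /\ P (chart_from c y).
  exact: filterI (near_chart_im ic cp) (near_chart_from ic cp nP).
have [r r0 Hr] := near_closed_ball H.
exists r; split => //.
- apply: continuous_compact; last exact: closed_ball_compact.
  apply: continuous_in_subspaceT => y; rewrite inE => /Hr[[dy E] _].
  by have := chart_from_cts ic dy; rewrite E.
- by move=> _ [y /Hr[[dy E] Py] <-].
- by move=> y /Hr[[]].
- have nb : \forall q \near p, closed_ball (chart_to c p) r (chart_to c q).
    apply: (@near_comp _ _ (chart_to c) p (closed_ball (chart_to c p) r)).
      exact: chart_to_cts.
    apply: filterS (nbhsx_ballx (chart_to c p) r r0).
    exact: subset_closed_ball.
  apply: filterS2 (near_chart_dom ic cp) nb => q dq bq.
  by exists (chart_to c q) => //; rewrite (chart_toK ic).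
Qed.

(** Extending a cube bump by zero outside the chart is smooth, because a
    compact cube is closed in a Hausdorff space. *)
Lemma chart_bump c p : hausdorff_space T -> A c -> chart_dom c p ->
  exists chi : T -> R, [/\ forall q, smooth_fun_at A chi q, 0 < chi p &
    forall q, ~ chart_dom c q -> \forall x \near q, chi x = 0].
Proof.
move=> hT Ac cp; have ic := atlas_chart hA Ac.
have [r [r0 cK HK Hto _]] := chart_cubeP ic cp (near_chart_dom ic cp).
pose chi x := if `[< chart_dom c x >] then
  cube_bump (chart_to c p) r (chart_to c x) else 0.
have out q : ~ chart_dom c q -> \forall x \near q, chi x = 0.
  move=> nq; have clK := compact_closed hT cK.
  have nK : (~` chart_cube c p r) q by move=> /HK[].
  have : \forall x \near q, (~` chart_cube c p r) x.
    by apply: open_near => //; exact: closed_openC.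
  apply: filterS => x nx; rewrite /chi; case: asboolP => // dx.
  apply: cube_bump_out => // bx; apply: nx.
  exists (chart_to c x); first exact: subset_closed_ball.
  by rewrite (chart_toK ic).
exists chi; split => //; last first.
  by rewrite /chi asboolT//; exact: cube_bump_gt0.
move=> q; have [cq|nq] := pselect (chart_dom c q).
  apply: (smooth_fun_at_chart hA Ac cq).
  apply: smooth_at_eq (cube_bump_smooth (chart_to c p) r (chart_to c q)).
  apply: filterS (near_chart_im ic cq) => y [dy E].
  by rewrite /= /chi asboolT// E.
apply: (@smooth_fun_at_eq _ _ _ _ hA (fun=> 0)); last exact: smooth_fun_at_cst.
by apply: filterS (out q nq) => x ->.
Qed.

End LocalCompactness.

(** * Differential operators and composition with smooth maps *)

(** The sets that contain a given set with property [Q] form a filter base, to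
    which near-covering compactness applies. *)
Lemma compact_induction (T : topologicalType) (K : set T) (Q : set T -> Prop) :
  compact K -> Q set0 -> (forall E E', E `<=` E' -> Q E' -> Q E) ->
  (forall E E', Q E -> Q E' -> Q (E `|` E')) ->
  (forall p, K p -> exists2 E, nbhs p E & Q E) -> Q K.
Proof.
move=> /compact_near_coveringP cK Q0 QS QU Qloc.
pose F (X : set (set T)) := exists2 E, Q E & forall E', Q E' -> E `<=` E' -> X E'.
have FF : Filter F.
  split.
  - by exists set0.
  - move=> X Y [E QE HE] [E' QE' HE']; exists (E `|` E'); first exact: QU.
    move=> E'' QE'' EE; split; first by apply: HE => // x Ex; apply: EE; left.
    by apply: HE' => // x Ex; apply: EE; right.
  - by move=> X Y XY [E QE HE]; exists E => // E' QE' /(HE E' QE')/XY.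
have [p Kp|E QE HE] := cK (set T) F (fun E x => E x) FF.
  have [E nE QE] := Qloc p Kp.
  exists (E, [set E' | E `<=` E']); first by split => //; exists E.
  by move=> [x E'] /= [Ex EE]; exact: EE.
exact: QS (HE E QE (fun x h => h)) QE.
Qed.

Section SupNorm.
Context {R : realType} {T : topologicalType}.
Implicit Types (K : set T) (g : T -> R).

Lemma sup_norm_ge K g x : compact K -> (forall y, K y -> {for y, continuous g}) ->
  K x -> `|g x| <= sup_norm K g.
Proof.
move=> cK cg Kx; apply: ub_le_sup; last by exists x.
have cI : compact [set `|g y| | y in K].
  apply: (@continuous_compact _ _ (fun y => `|g y|)) => //.
  apply: continuous_in_subspaceT => y; rewrite inE => Ky.
  by apply: (@continuous_comp _ _ _ g (fun z : R => `|z|)); [exact: cg|exact: norm_continuous].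
have /compact_bounded/ex_strict_bound_gt0[M M0 HM] := cI.
by exists M => _ [y Ky <-]; apply: le_trans (ler_norm _) (ltW _); apply: HM; exists y.
Qed.

Lemma sup_norm_le K g M : 0 <= M -> (forall x, K x -> `|g x| <= M) ->
  sup_norm K g <= M.
Proof.
move=> M0 H; rewrite /sup_norm.
have [->|/set0P[x Kx]] := eqVneq K set0; first by rewrite image_set0 sup0.
by apply: ge_sup => [|_ [y Ky <-]]; [exists `|g x|; exists x|exact: H].
Qed.

Lemma sup_norm_ge0 K g : 0 <= sup_norm K g.
Proof.
rewrite /sup_norm; set E := [set _ | _ in _].
have [hs|nhs] := pselect (has_sup E); last by rewrite sup_out.
have [[z [y Ky _]] _] := hs.
apply: le_trans (normr_ge0 (g y)) _; apply: ub_le_sup; first by case: hs.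
by exists y.
Qed.

End SupNorm.

Section DifferentialOperators.
Context {R : realType} {T : topologicalType} {n : nat} (A : set (chart R T n)).
Hypothesis hA : smooth_atlas A.
Variable D : set T.
Hypothesis oD : open D.
Implicit Types (f g : T -> R) (P : (T -> R) -> (T -> R)).

Lemma smooth_fun_chart f c p : smooth_fun A D f -> A c -> D p ->
  chart_dom c p -> smooth_at (f \o chart_from c) (chart_to c p).
Proof. by move=> /(smooth_funP hA _ oD) sf Ac Dp; exact: (sf p Dp c Ac). Qed.

Lemma smooth_fun_at_chart_partial f c p l : smooth_fun A D f -> A c -> D p ->
  chart_dom c p ->
  smooth_fun_at A (fun x => partial l (f \o chart_from c) (chart_to c x)) p.
Proof.
move=> sf Ac Dp cp; apply: (smooth_fun_at_chart hA Ac cp).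
have := smooth_at_partial l (smooth_fun_chart sf Ac Dp cp).
apply: smooth_at_eq.
by apply: filterS (near_chart_im (atlas_chart hA Ac) cp) => y [_ E]; rewrite /= E.
Qed.

Lemma smooth_fun_at_sum (I : Type) (r : seq I) (F : I -> T -> R) p :
  (forall i, smooth_fun_at A (F i) p) -> smooth_fun_at A (fun x => \sum_(i <- r) F i x) p.
Proof. by move=> H c Ac cp; apply: smooth_at_sum => i _; exact: H. Qed.

Lemma diff_op_smooth_fun_at P f p : diff_operator A D P -> smooth_fun A D f -> D p ->
  smooth_fun_at A (P f) p.
Proof.
move=> [k HP] sf Dp; have [c Ac cp] := atlas_cover hA p.
have [a sa Ha] := HP c Ac; have ic := atlas_chart hA Ac.
have oDc : open (chart_dom c `&` D).
  by apply: openI => //; exact: chart_open_dom.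
have ma t : smooth_fun_at A (a t) p.
  have := sa t; rewrite (smooth_funP hA _ oDc); apply; split => //.
apply: (smooth_fun_at_eq hA) (_ : smooth_fun_at A (fun x => \sum_(j < k.+1) \sum_(t : j.-tuple 'I_n)
    a t x * partial t (f \o chart_from c) (chart_to c x)) p).
  by apply: filterS (open_near oDc (conj cp Dp)) => x [cx Dx]; rewrite Ha.
apply: smooth_fun_at_sum => j; apply: smooth_fun_at_sum => t; apply: smooth_fun_atM => //.
exact: smooth_fun_at_chart_partial.
Qed.

Lemma diff_op_cont P f p : diff_operator A D P -> smooth_fun A D f -> D p ->
  {for p, continuous (P f)}.
Proof. by move=> dP sf Dp; apply: (smooth_fun_at_cont hA); exact: diff_op_smooth_fun_at. Qed.

Lemma partial_sub l (f g : 'rV[R]_n -> R) y : smooth_at f y -> smooth_at g y ->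
  partial l (fun z => f z - g z) y = partial l f y - partial l g y.
Proof.
elim: l y => //= i l IH y sf sg.
have E : {near y, partial l (fun z => f z - g z) =1 partial l f - partial l g}.
  apply: filterS2 (smooth_at_near sf) (smooth_at_near sg) => z sfz sgz.
  exact: IH.
rewrite (near_eq_derive _ E) deriveB//.
  exact/smooth_at_derivable/smooth_at_partial.
exact/smooth_at_derivable/smooth_at_partial.
Qed.

Lemma smooth_fun_sub f g : smooth_fun A D f -> smooth_fun A D g ->
  smooth_fun A D (fun x => f x - g x).
Proof.
move=> /(smooth_funP hA _ oD) sf /(smooth_funP hA _ oD) sg.
apply/(smooth_funP hA _ oD) => p Dp; apply: smooth_fun_atD; first exact: sf.
by move=> c Ac cp; apply: smooth_atN; exact: sg.
Qed.

Lemma diff_op_sub P f g x : diff_operator A D P -> smooth_fun A D f ->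
  smooth_fun A D g -> D x -> P (fun x => f x - g x) x = P f x - P g x.
Proof.
move=> [k HP] sf sg Dx; have [c Ac cx] := atlas_cover hA x.
have [a sa Ha] := HP c Ac.
rewrite !Ha//; last exact: smooth_fun_sub.
rewrite -sumrB; apply: eq_bigr => j _; rewrite -sumrB; apply: eq_bigr => t _.
rewrite -mulrBr; congr (_ * _); apply: partial_sub; exact: smooth_fun_chart.
Qed.

Lemma smooth_fun_eq f g : (forall x, D x -> f x = g x) ->
  smooth_fun A D f -> smooth_fun A D g.
Proof.
move=> fg /(smooth_funP hA _ oD) sf; apply/(smooth_funP hA _ oD) => p Dp.
apply: (smooth_fun_at_eq hA) (sf p Dp); exact: filterS (open_near oD Dp).
Qed.

Lemma partial_near_eq l (f g : 'rV[R]_n -> R) y :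
  {near y, f =1 g} -> partial l f y = partial l g y.
Proof.
elim: l y => /= [y /nbhs_singleton//|i l IH y /near_join fg].
by apply: near_eq_derive; apply: filterS fg => z; exact: IH.
Qed.

Lemma diff_op_eq P f g x : diff_operator A D P -> smooth_fun A D f ->
  (forall x, D x -> f x = g x) -> D x -> P f x = P g x.
Proof.
move=> [k HP] sf fg Dx; have [c Ac cx] := atlas_cover hA x.
have [a sa Ha] := HP c Ac; have ic := atlas_chart hA Ac.
rewrite !Ha//; last exact: smooth_fun_eq sf.
apply: eq_bigr => j _; apply: eq_bigr => t _; congr (_ * _).
apply: partial_near_eq; have := near_chart_from ic cx (open_near oD Dx).
by apply: filterS => y; exact: fg.
Qed.

(** The partial derivative along a word in one chart, cut off to be globally
    defined, is a differential operator: in any other chart the chain rule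
    for words expresses it with smooth coefficients. *)
Lemma cutoff_partial_diff_operator d chi l : A d -> (forall q, smooth_fun_at A chi q) ->
  (forall q, ~ chart_dom d q -> \forall x \near q, chi x = 0) ->
  diff_operator A D
    (fun f x => chi x * partial l (f \o chart_from d) (chart_to d x)).
Proof.
move=> Ad schi out; have id_ := atlas_chart hA Ad.
exists (size l) => c Ac; have ic := atlas_chart hA Ac.
pose G := fun y => chart_to c (chart_from d y).
have [I [b [w [sw H]]]] := partial_comp G l.
exists (fun t x => \sum_(q | w q == t) chi x * b q (chart_to d x)).
  move=> t; have oDc : open (chart_dom c `&` D).
    by apply: openI => //; exact: chart_open_dom.
  apply/(smooth_funP hA _ oDc) => p [cp Dp].
  have [dp|ndp] := pselect (chart_dom d p); last first.
    apply: (@smooth_fun_at_eq _ _ _ _ hA (fun=> 0)); last exact: smooth_fun_at_cst.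
    by apply: filterS (out p ndp) => x ->; rewrite big1// => q _; rewrite mul0r.
  move=> e Ae ep; apply: smooth_at_sum => q _.
  have [sb _] := H _ (transition_smooth hA Ad Ac dp cp).
  suff sbq : smooth_fun_at A (fun x => b q (chart_to d x)) p by exact: smooth_fun_atM (schi p) sbq e Ae ep.
  apply: (smooth_fun_at_chart hA Ad dp).
  apply: smooth_at_eq (sb q).
  by apply: filterS (near_chart_im id_ dp) => y [_ E]; rewrite /= E.
move=> f x sf cx Dx.
have [dx|ndx] := pselect (chart_dom d x); last first.
  rewrite (nbhs_singleton (out x ndx)) mul0r big1// => j _; rewrite big1// => t _.
  by rewrite big1 ?mul0r// => q _; rewrite mul0r.
have sG := transition_smooth hA Ad Ac dx cx.
have [_ Hf] := H _ sG.
have E : {near chart_to d x, f \o chart_from d =1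
    fun y => (f \o chart_from c) (G y)}.
  apply: filterS (near_chart_from id_ dx (near_chart_dom ic cx)) => y cy.
  by rewrite /G /= (chart_toK ic).
rewrite (partial_near_eq _ E) Hf; last first.
  by rewrite /G (chart_toK id_ dx); exact: smooth_fun_chart.
rewrite {1}/G (chart_toK id_ dx) mulr_sumr.
rewrite (sum_by_word (fun q => chi x * b q (chart_to d x))
  (fun t => partial t (f \o chart_from c) (chart_to c x)) sw).
by apply: eq_bigr => q _; rewrite mulrA.
Qed.

End DifferentialOperators.

Section Composition.
Context {R : realType} {S T : topologicalType} {m n : nat}.
Context (A : set (chart R S m)) (B : set (chart R T n)).
Hypotheses (hA : smooth_atlas A) (hB : smooth_atlas B) (hT : hausdorff_space T).
Variables (D : set S) (D' : set T) (F : S -> T).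
Hypotheses (oD : open D) (oD' : open D').
Hypotheses (sF : forall p, D p -> smooth_map_at A B F p) (FD : forall p, D p -> D' (F p)).

Definition seminorms := seq (set T * ((T -> R) -> (T -> R))).

Definition seminorm_sum (L : seminorms) (f : T -> R) : R :=
  \sum_(q <- L) sup_norm q.1 (q.2 f).

Definition admissible (L : seminorms) := forall i, (i < size L)%N ->
  let q := nth (set0, fun f => f) L i in
  [/\ compact q.1, q.1 `<=` D' & diff_operator B D' q.2].

(** [Phi f] is controlled on [E] by finitely many of the seminorms that define
    moderate and negligible nets. *)
Definition dominated (E : set S) (Phi : (T -> R) -> S -> R) :=
  exists C L, [/\ 0 <= C, admissible L &
    forall f, smooth_fun B D' f -> forall x, E x ->
      `|Phi f x| <= C * seminorm_sum L f].

Lemma seminorm_sum_ge0 L f : 0 <= seminorm_sum L f.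
Proof. by apply: sumr_ge0 => q _; exact: sup_norm_ge0. Qed.

Lemma admissible_cat L L' : admissible L -> admissible L' -> admissible (L ++ L').
Proof.
move=> aL aL' i; rewrite size_cat nth_cat; case: (ltnP i (size L)) => iL; first by move=> _; exact: (aL _ iL).
by rewrite -ltn_subLR// => /aL'.
Qed.

Lemma seminorm_sum_cat L L' f :
  seminorm_sum (L ++ L') f = seminorm_sum L f + seminorm_sum L' f.
Proof. exact: big_cat. Qed.

Lemma dominatedS E E' Phi : E `<=` E' -> dominated E' Phi -> dominated E Phi.
Proof.
by move=> EE [C [L [C0 aL H]]]; exists C, L; split => // f sf x /EE; exact: H.
Qed.

Lemma dominated0 E : dominated E (fun _ _ => 0).
Proof.
exists 0, [::]; split => // f sf x _.
by rewrite normr0 mul0r.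
Qed.

Lemma dominated_bound C L C' L' f : 0 <= C -> 0 <= C' ->
  C * seminorm_sum L f <= (C + C') * seminorm_sum (L ++ L') f /\
  C' * seminorm_sum L' f <= (C + C') * seminorm_sum (L ++ L') f /\
  C * seminorm_sum L f + C' * seminorm_sum L' f <=
    (C + C') * seminorm_sum (L ++ L') f.
Proof.
move=> C0 C0'; have L0 := seminorm_sum_ge0 L f; have L0' := seminorm_sum_ge0 L' f.
rewrite seminorm_sum_cat; move: (seminorm_sum L f) (seminorm_sum L' f) L0 L0'.
by move=> a b a0 b0; split; [|split]; nra.
Qed.

Lemma dominatedU E E' Phi : dominated E Phi -> dominated E' Phi ->
  dominated (E `|` E') Phi.
Proof.
move=> [C [L [C0 aL H]]] [C' [L' [C0' aL' H']]].
exists (C + C'), (L ++ L'); split; [exact: addr_ge0|exact: admissible_cat|].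
move=> f sf x; have [h [h' _]] := dominated_bound L L' f C0 C0'.
by move=> [/(H f sf)|/(H' f sf)] /le_trans; apply.
Qed.

Lemma dominatedD E Phi Psi : dominated E Phi -> dominated E Psi ->
  dominated E (fun f x => Phi f x + Psi f x).
Proof.
move=> [C [L [C0 aL H]]] [C' [L' [C0' aL' H']]].
exists (C + C'), (L ++ L'); split; [exact: addr_ge0|exact: admissible_cat|].
move=> f sf x Ex; have [_ [_ h]] := dominated_bound L L' f C0 C0'.
apply: le_trans h; apply: le_trans (ler_normD _ _) _.
by apply: lerD; [exact: H|exact: H'].
Qed.

Lemma dominatedM E Phi (a : S -> R) M : (forall x, E x -> `|a x| <= M) ->
  dominated E Phi -> dominated E (fun f x => a x * Phi f x).
Proof.
move=> aM [C [L [C0 aL H]]].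
exists (`|M| * C), L; split; [by rewrite mulr_ge0|by []|].
move=> f sf x Ex; rewrite normrM -mulrA; apply: ler_pM => //; last exact: H.
by apply: le_trans (aM x Ex) (ler_norm _).
Qed.

Definition dominated_near (p : S) Phi := exists2 E, nbhs p E & dominated E Phi.

Lemma dominated_nearD p Phi Psi : dominated_near p Phi -> dominated_near p Psi ->
  dominated_near p (fun f x => Phi f x + Psi f x).
Proof.
move=> [E nE dE] [E' nE' dE']; exists (E `&` E'); first exact: filterI.
by apply: dominatedD; [apply: dominatedS dE|apply: dominatedS dE'] => x [].
Qed.

Lemma dominated_nearM p Phi (a : S -> R) : {for p, continuous a} ->
  dominated_near p Phi -> dominated_near p (fun f x => a x * Phi f x).
Proof.
move=> ca [E nE dE].
have na : \forall x \near p, `|a x| <= `|a p| + 1.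
  have /cvgrPdist_le/(_ _ ltr01) := ca; apply: filterS => x h.
  by rewrite -lerBlDl; apply: le_trans h; rewrite distrC lerB_dist.
exists (E `&` [set x | `|a x| <= `|a p| + 1]); first exact: filterI.
apply: (dominatedM (M := `|a p| + 1)); first by move=> x [].
by apply: dominatedS dE => x [].
Qed.

Lemma dominated_near_sum p (I : Type) (r : seq I) (Phi : I -> (T -> R) -> S -> R) :
  (forall i, dominated_near p (Phi i)) ->
  dominated_near p (fun f x => \sum_(i <- r) Phi i f x).
Proof.
move=> H; elim: r => [|i r IH].
  rewrite (_ : (fun _ _ => _) = (fun _ _ => 0)).
    by exists setT; [exact: filterT|exact: dominated0].
  by apply/funext => f; apply/funext => x; rewrite big_nil.
rewrite (_ : (fun _ _ => _) = (fun f x => Phi i f x + \sum_(i <- r) Phi i f x)).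
  exact: dominated_nearD.
by apply/funext => f; apply/funext => x; rewrite big_cons.
Qed.

Lemma dominated_near_eq p (W : set S) Phi Psi : nbhs p W ->
  (forall f, smooth_fun B D' f -> forall x, W x -> Phi f x = Psi f x) ->
  dominated_near p Phi -> dominated_near p Psi.
Proof.
move=> nW E [N nN [C [L [C0 aL H]]]]; exists (W `&` N); first exact: filterI.
exists C, L; split => // f sf x [Wx Nx]; rewrite -E//; exact: H.
Qed.

Lemma dominated_compact K Phi : compact K ->
  (forall p, K p -> dominated_near p Phi) -> dominated K Phi.
Proof.
move=> cK H; apply: (@compact_induction _ K (fun E => dominated E Phi) cK) => //.
- exists 0, [::]; split => // f sf x [].
- by move=> E E' EE'; exact: dominatedS.
- by move=> E E'; exact: dominatedU.
Qed.

(** Dividing by the cutoff function, which is bounded below near the point,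
    recovers the derivative from a globally defined operator. *)
Lemma dominated_near_partial p d l : D p -> B d -> chart_dom d (F p) ->
  dominated_near p
    (fun f x => partial l (f \o chart_from d) (chart_to d (F x))).
Proof.
move=> Dp Bd dp; have id_ := atlas_chart hB Bd.
have [chi [schi chi0 out]] := chart_bump hB hT Bd dp.
pose P := fun f x => chi x * partial l (f \o chart_from d) (chart_to d x).
have dP : diff_operator B D' P by exact: cutoff_partial_diff_operator.
have cc := smooth_fun_at_cont hB (schi (F p)).
have nchi : \forall y \near F p, chi (F p) / 2 <= chi y.
  have h0 : chi (F p) / 2 < chi (F p) by rewrite ltr_pdivrMr// ltr_pMr// ltr1n.
  exact: (@cvgr_ge _ _ (nbhs (F p)) _ chi (chi (F p)) cc _ h0).
have nD' := open_near oD' (FD Dp).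
have nn : \forall y \near F p, chi (F p) / 2 <= chi y /\ D' y.
  exact: filterI nchi nD'.
have [r [r0 cK HK _ nK]] := chart_cubeP id_ dp nn.
pose K := chart_cube d (F p) r.
exists (F @^-1` K); first exact: (@near_comp _ _ F p K (sF Dp).1 nK).
exists ((chi (F p) / 2)^-1), [:: (K, P)]; split.
- by rewrite invr_ge0 divr_ge0// ltW.
- by move=> [|i]// _; split => //= y /HK[[]].
- move=> f sf x Kx; have [[chiF DF] dF] := HK _ Kx.
  rewrite /seminorm_sum big_seq1 ler_pdivlMl ?divr_gt0//=.
  apply: (@le_trans _ _ (`|P f (F x)|)).
    rewrite /P normrM ler_wpM2r//; apply: le_trans chiF _; exact: ler_norm.
  apply: sup_norm_ge => // y /HK[[_ Dy] _].
  exact: (diff_op_cont hB oD' dP sf).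
Qed.

Lemma smooth_fun_comp f : smooth_fun B D' f -> smooth_fun A D (f \o F).
Proof.
move=> /(smooth_funP hB _ oD') sf; apply/(smooth_funP hA _ oD) => p Dp.
exact: (smooth_fun_at_comp hA hB (sF Dp) (sf _ (FD Dp))).
Qed.

(** Continuity of the composition with a smooth map, for the topologies of
    uniform convergence of all derivatives on compact sets.  By compactness it is
    enough to argue near one point, where the chain rule expresses the operator
    by derivatives of [f] in a single chart. *)
Lemma composition_dominated K P : compact K -> K `<=` D -> diff_operator A D P ->
  dominated K (fun f => P (f \o F)).
Proof.
move=> cK KD [k HP]; apply: dominated_compact => // p Kp.
have Dp := KD p Kp.
have [c Ac cp] := atlas_cover hA p; have ic := atlas_chart hA Ac.
have [d Bd dp] := atlas_cover hB (F p); have id_ := atlas_chart hB Bd.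
have [a sa Ha] := HP c Ac.
pose G := fun y => chart_to d (F (chart_from c y)).
have nW : \forall x \near p, [/\ D x, chart_dom c x & chart_dom d (F x)].
  apply: filterS3 (open_near oD Dp) (near_chart_dom ic cp) _ => [x ? ? h|].
    by split; [| |exact: h].
  exact: near_comp (sF Dp).1 (near_chart_dom id_ dp).
pose Q (l : seq 'I_m) f x := partial l ((f \o F) \o chart_from c) (chart_to c x).
have dQ l : dominated_near p (Q l).
  have [I [b [w [sw H]]]] := partial_comp G l.
  apply: (dominated_near_eq nW _ (dominated_near_sum (index_enum I)
    (Phi := fun q f x => b q (chart_to c x) *
      partial (w q) (f \o chart_from d) (chart_to d (F x))) _)).
    move=> f sf x [Dx cx dx].
    have sG := smooth_map_at_smoothv Ac Bd cx dx (sF Dx).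
    have [_ Hf] := H _ sG.
    have E : {near chart_to c x, (f \o F) \o chart_from c =1
        fun y => (f \o chart_from d) (G y)}.
      apply: filterS (near_chart_from ic cx (near_comp (sF Dx).1
        (near_chart_dom id_ dx))) => y dy.
      by rewrite /G /= (chart_toK id_).
    rewrite /Q (partial_near_eq _ E) Hf; last first.
      rewrite /G (chart_toK ic cx); apply: (smooth_fun_chart hB oD' sf Bd) => //.
      exact: FD.
    by rewrite /G (chart_toK ic cx).
  move=> q; apply: dominated_nearM; last exact: dominated_near_partial.
  have sG := smooth_map_at_smoothv Ac Bd cp dp (sF Dp).
  have [sb _] := H _ sG.
  apply: (@continuous_comp _ _ _ (chart_to c) (b q)); first exact: chart_to_cts.
  exact: smooth_at_cont.
have oDc : open (chart_dom c `&` D).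
  by apply: openI => //; exact: chart_open_dom.
apply: (dominated_near_eq nW _ (dominated_near_sum (index_enum 'I_k.+1)
  (Phi := fun j f x => \sum_(t : j.-tuple 'I_m) a t x * Q t f x) _)).
  by move=> f sf x [Dx cx dx]; rewrite Ha//; exact: smooth_fun_comp.
move=> j; apply: dominated_near_sum => t.
apply: dominated_nearM => //; apply: (smooth_fun_at_cont hA).
by have := sa t; rewrite (smooth_funP hA _ oDc); apply; split.
Qed.

End Composition.

(** * Moderate and negligible nets *)

Section BigO.
Context {R : realType}.
Implicit Types f g h : R -> R.

Lemma bigO_at0P f g : bigO_at0 f g <->
  exists2 k, 0 < k & \forall e \near 0^'+, `|f e| <= k * `|g e|.
Proof. by rewrite /bigO_at0 eqO_exP. Qed.

Lemma near_parameter : \forall e \near (0 : R)^'+, 0 < e <= 1.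
Proof.
near=> e; apply/andP; split; first by near: e; exact: nbhs_right_gt.
by near: e; exact: nbhs_right_le.
Unshelve. all: by end_near. Qed.

Lemma bigO_at0_le f g h C : 0 <= C -> bigO_at0 g h ->
  (\forall e \near 0^'+, `|f e| <= C * `|g e|) -> bigO_at0 f h.
Proof.
move=> C0 /bigO_at0P[k k0 H] H'; apply/bigO_at0P.
exists ((C + 1) * k); first by rewrite mulr_gt0// ltr_wpDl.
apply: filterS2 H H' => e He H'e; apply: (le_trans H'e).
rewrite -mulrA; apply: (@le_trans _ _ (C * (k * `|h e|))).
  by rewrite ler_wpM2l.
by rewrite ler_wpM2r ?lerDl// mulr_ge0// ltW.
Qed.

Lemma bigO_at0D f g h : bigO_at0 f h -> bigO_at0 g h ->
  bigO_at0 (fun e => f e + g e) h.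
Proof.
move=> /bigO_at0P[k k0 H] /bigO_at0P[k' k0' H']; apply/bigO_at0P.
exists (k + k'); first exact: addr_gt0.
apply: filterS2 H H' => e He H'e; apply: le_trans (ler_normD _ _) _.
by rewrite mulrDl lerD.
Qed.

Lemma bigO_at0_0 h : bigO_at0 (fun=> 0) h.
Proof.
by apply/bigO_at0P; exists 1 => //; apply: filterE => e; rewrite normr0 mul1r.
Qed.

Lemma bigO_at0_expN f M N : (M <= N)%N ->
  bigO_at0 f (fun e => e ^- M) -> bigO_at0 f (fun e => e ^- N).
Proof.
move=> MN /bigO_at0P[k k0 H]; apply/bigO_at0P; exists k => //.
apply: filterS2 H near_parameter => e He /andP[e0 e1].
apply: (le_trans He); rewrite ler_wpM2l ?(ltW k0)//.
rewrite !normfV !normrX lef_pV2 ?posrE ?exprn_gt0 ?normr_gt0 ?gt_eqF//.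
by rewrite ger0_norm ?(ltW e0)// ler_wiXn2l// ltW.
Qed.

End BigO.

Section NetAlgebra.
Context {R : realType} {T : topologicalType} {n : nat} (A : set (chart R T n)).
Hypothesis hA : smooth_atlas A.
Variable D : set T.
Hypothesis oD : open D.
Implicit Types u v : net R T.

Lemma negligible_eq u v : (forall e, 0 < e <= 1 -> forall x, D x -> u e x = v e x) ->
  negligible_net A D u -> negligible_net A D v.
Proof.
move=> uv [su nu]; have sv : smooth_net A D v.
  by move=> e e01; apply: (smooth_fun_eq hA oD _ (su e e01)) => x; exact: uv.
split => // K P cK KD dP k; apply: (@bigO_at0_le _ _ _ _ 1) (nu K P cK KD dP k) _ => //.
apply: filterS near_parameter => e e01; rewrite mul1r.
have -> // : sup_norm K (P (v e)) = sup_norm K (P (u e)).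
congr sup; apply/seteqP; split => _ [x Kx <-]; exists x => //.
  by rewrite (diff_op_eq hA oD dP (su e e01) (uv e e01))//; exact: KD.
by rewrite (diff_op_eq hA oD dP (su e e01) (uv e e01))//; exact: KD.
Qed.

Lemma negligible_sub u v : negligible_net A D u -> negligible_net A D v ->
  negligible_net A D (fun e x => u e x - v e x).
Proof.
move=> [su nu] [sv nv]; split; first by move=> e e01; apply: smooth_fun_sub; auto.
move=> K P cK KD dP k.
apply: (@bigO_at0_le _ _ _ _ 1) (bigO_at0D (nu K P cK KD dP k) (nv K P cK KD dP k)) _ => //.
apply: filterS near_parameter => e e01; rewrite mul1r.
rewrite !ger0_norm ?addr_ge0 ?sup_norm_ge0//.
apply: sup_norm_le; first by rewrite addr_ge0 ?sup_norm_ge0.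
move=> x Kx; rewrite (diff_op_sub hA oD dP (su e e01) (sv e e01) (KD x Kx)).
apply: le_trans (ler_normB _ _) _; apply: lerD.
  by apply: sup_norm_ge => // y /KD Dy; exact: (diff_op_cont hA oD dP (su e e01)).
by apply: sup_norm_ge => // y /KD Dy; exact: (diff_op_cont hA oD dP (sv e e01)).
Qed.

Lemma negligible0 : negligible_net A D (fun _ _ => 0).
Proof.
have s0 : smooth_fun A D (fun=> 0).
  by apply/(smooth_funP hA _ oD) => p _; exact: smooth_fun_at_cst.
split=> [e _ //|K P cK KD dP k].
apply: (@bigO_at0_le _ _ _ _ 1 ler01 (bigO_at0_0 _)); apply: filterE => e.
rewrite normr0 mulr0 ger0_norm ?sup_norm_ge0//; apply: sup_norm_le => // x Kx.
have := diff_op_sub hA oD dP s0 s0 (KD x Kx); rewrite !subrr => ->.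
by rewrite normr0.
Qed.

Lemma negligible_subrr u : negligible_net A D (fun e x => u e x - u e x).
Proof. by apply: negligible_eq negligible0 => e _ x _; rewrite subrr. Qed.

Lemma negligible_opp_sub u v : negligible_net A D (fun e x => u e x - v e x) ->
  negligible_net A D (fun e x => v e x - u e x).
Proof.
move=> H; apply: negligible_eq (negligible_sub negligible0 H) => e _ x _.
by rewrite sub0r opprB.
Qed.

Lemma negligible_trans u v w : negligible_net A D (fun e x => u e x - v e x) ->
  negligible_net A D (fun e x => v e x - w e x) ->
  negligible_net A D (fun e x => u e x - w e x).
Proof.
move=> H /negligible_opp_sub H'.
by apply: negligible_eq (negligible_sub H H') => e _ x _; rewrite opprB addrA subrK.
Qed.

End NetAlgebra.

Section NetComposition.
Context {R : realType} {S T : topologicalType} {m n : nat}.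
Context (A : set (chart R S m)) (B : set (chart R T n)).
Hypotheses (hA : smooth_atlas A) (hB : smooth_atlas B) (hT : hausdorff_space T).
Variables (D : set S) (D' : set T) (F : S -> T).
Hypotheses (oD : open D) (oD' : open D').
Hypotheses (sF : forall p, D p -> smooth_map_at A B F p) (FD : forall p, D p -> D' (F p)).

Lemma admissible_cons q L : admissible B D' (q :: L) ->
  [/\ compact q.1, q.1 `<=` D', diff_operator B D' q.2 & admissible B D' L].
Proof.
by move=> H; have [? ? ?] := H 0%N isT; split => // i iL; exact: (H i.+1).
Qed.

Lemma moderate_seminorm_sum L u : admissible B D' L -> moderate B D' u ->
  exists N, bigO_at0 (fun e => seminorm_sum L (u e)) (fun e => e ^- N).
Proof.
move=> + [su mu]; elim: L => [_|q L IH /admissible_cons[q1 q2 q3 /IH[N HN]]].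
  exists 0%N; apply: (@bigO_at0_le _ _ _ _ 1 ler01 (bigO_at0_0 _)).
  by apply: filterE => e; rewrite /seminorm_sum big_nil normr0 mulr0.
have [M HM] := mu q.1 q.2 q1 q2 q3.
exists (maxn M N); apply: (@bigO_at0_le _ _ _ _ 1 ler01
  (bigO_at0D (bigO_at0_expN (leq_maxl M N) HM) (bigO_at0_expN (leq_maxr M N) HN))).
by apply: filterE => e; rewrite /seminorm_sum big_cons mul1r.
Qed.

Lemma negligible_seminorm_sum L u k : admissible B D' L -> negligible_net B D' u ->
  bigO_at0 (fun e => seminorm_sum L (u e)) (fun e => e ^+ k).
Proof.
move=> + [su nu]; elim: L => [_|q L IH /admissible_cons[q1 q2 q3 /IH HN]].
  apply: (@bigO_at0_le _ _ _ _ 1 ler01 (bigO_at0_0 _)).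
  by apply: filterE => e; rewrite /seminorm_sum big_nil normr0 mulr0.
apply: (@bigO_at0_le _ _ _ _ 1 ler01 (bigO_at0D (nu q.1 q.2 q1 q2 q3 k) HN)).
by apply: filterE => e; rewrite /seminorm_sum big_cons mul1r.
Qed.

Lemma smooth_net_comp u : smooth_net B D' u -> smooth_net A D (fun e => u e \o F).
Proof.
by move=> su e e01; exact: (smooth_fun_comp hA hB oD oD' sF FD (su e e01)).
Qed.

Lemma sup_norm_comp K P : compact K -> K `<=` D -> diff_operator A D P ->
  exists2 L, admissible B D' L & forall u h, smooth_net B D' u ->
    bigO_at0 (fun e => seminorm_sum L (u e)) h ->
    bigO_at0 (fun e => sup_norm K (P (u e \o F))) h.
Proof.
move=> cK KD dP.
have [C [L [C0 aL H]]] := composition_dominated hA hB hT oD oD' sF FD cK KD dP.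
exists L => // u h su Lh; apply: (@bigO_at0_le _ _ _ _ C C0 Lh).
apply: filterS near_parameter => e e01.
rewrite !ger0_norm ?sup_norm_ge0 ?seminorm_sum_ge0//.
apply: sup_norm_le; first by rewrite mulr_ge0 ?seminorm_sum_ge0.
by move=> x Kx; apply: H => //; exact: su.
Qed.

Lemma moderate_comp u : moderate B D' u -> moderate A D (fun e => u e \o F).
Proof.
move=> mu; split; first by apply: smooth_net_comp; case: mu.
move=> K P cK KD dP; have [L aL HL] := sup_norm_comp cK KD dP.
have [N HN] := moderate_seminorm_sum aL mu.
by exists N; apply: HL => //; case: mu.
Qed.

Lemma negligible_comp u : negligible_net B D' u ->
  negligible_net A D (fun e => u e \o F).
Proof.
move=> nu; split; first by apply: smooth_net_comp; case: nu.
move=> K P cK KD dP k; have [L aL HL] := sup_norm_comp cK KD dP.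
by apply: HL; [case: nu|exact: negligible_seminorm_sum].
Qed.

End NetComposition.

(** * Countability arguments *)

Section Countability.

(** Lindelof's principle as a countable choice of parameters; it serves for the
    points from which an orbit is reached, for the values of locally constant
    functions and for covers of submanifolds. *)
Lemma lindelof (T : topologicalType) (Y : Type) (E : set T) (Q : Y -> T -> Prop) :
  @second_countable T ->
  (forall g, E g -> exists d, \forall h \near g, E h -> Q d h) ->
  exists2 C : set Y, countable C & forall g, E g -> exists2 d, C d & Q d g.
Proof.
move=> [B cB [oB basisB]] H.
pose P (b : set T) d := forall h, b h -> E h -> Q d h.
pose phi (b : set T) : set Y :=
  match pselect (exists d, P b d) with
  | left e => [set sval (cid e)] | right _ => set0 end.
exists (\bigcup_(b in B) phi b).
  apply: bigcup_countable => // b _; rewrite /phi.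
  by case: pselect => [e|_].
move=> g Eg; have [d nd] := H g Eg.
have [b [Bb bg] bd] := basisB g _ nd.
have ex : exists d, P b d by exists d => h bh; exact: bd.
have [d' phid'] : exists d', phi b d' /\ P b d'.
  by rewrite /phi; case: pselect => // e; exists (sval (cid e)); split => //; case: cid.
exists d'; first by exists b => //; exact: phid'.1.
exact: phid'.2.
Qed.

Lemma second_countableX (S T : topologicalType) :
  @second_countable S -> @second_countable T -> @second_countable (S * T)%type.
Proof.
move=> [B cB [oB hB]] [C cC [oC hC]].
exists [set b `*` c | b in B & c in C].
  have -> : [set b `*` c | b in B & c in C] =
     (fun p => p.1 `*` p.2) @` (B `*` C).
    apply/seteqP; split => [_ [b Bb [c Cc <-]]|_ [[b c] [/= Bb Cc] <-]].
      by exists (b, c).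
    by exists b => //; exists c.
  exact: sub_countable (card_image_le _ _) (countableX cB cC).
split=> [_ [b Bb [c Cc <-]]|[x y] W [[P Q] [/= nP nQ] PQW]].
  apply: near_open => -[x y] [/= bx cy].
  exists (b, c) => //=; split; apply: open_nbhs_nbhs; split => //.
    exact: oB.
  exact: oC.
have [b [Bb bx] bP] := hB x P nP; have [c [Cc cy] cQ] := hC y Q nQ.
exists (b `*` c); first by split => //; exists b => //; exists c.
by move=> [x' y'] [/= bx' cy']; apply: PQW; split; [exact: bP|exact: cQ].
Qed.

(** A nondegenerate interval has positive Lebesgue measure. *)
Lemma countable_connected_R (R : realType) (A : set R) : connected A ->
  countable A -> forall a b, A a -> A b -> a = b.
Proof.
move=> /connected_intervalP iA cA.
suff H a b : A a -> A b -> ~ a < b.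
  by move=> a b Aa Ab; case: (ltgtP a b) => // h; exfalso; [exact: (H a b)|exact: (H b a)].
move=> Aa Ab ab.
have sub : `[a, b] `<=` A.
  by move=> z; rewrite /= in_itv /= => zab; exact: (iA a b).
have cI : countable `[a, b]%classic by exact: sub_countable (subset_card_le sub) cA.
have := countable_lebesgue_measure0 cI.
rewrite lebesgue_measure_itv /= lte_fin ab => /eqP.
by rewrite -EFinB eqe subr_eq0 gt_eqF.
Qed.

Lemma countable_connected_rV (T : topologicalType) (R : realType) n (A : set T)
    (f : T -> 'rV[R]_n) : connected A -> {within A, continuous f} ->
  countable (f @` A) -> forall a b, A a -> A b -> f a = f b.
Proof.
move=> kA cf cA a b Aa Ab; apply/rowP => j.
have cfj : {within A, continuous (fun x => f x 0 j)}.
  by move=> x; have /cvg_coord/(_ j) := cf x.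
apply: (@countable_connected_R R ((fun x => f x 0 j) @` A)).
- exact: connected_continuous_connected.
- have -> : (fun x => f x 0 j) @` A = (fun v : 'rV[R]_n => v 0 j) @` (f @` A).
    by rewrite image_comp.
  exact: sub_countable (card_image_le _ _) cA.
- by exists a.
- by exists b.
Qed.

Lemma ball_connected (R : realType) n (a : 'rV[R]_n) r : connected (ball a r).
Proof.
have [r0|r0] := ltP 0 r; last first.
  rewrite (_ : ball a r = set0); first exact: connected0.
  apply/seteqP; split => // x /rV_ballP[]; by rewrite ltNge r0.
have -> : ball a r = \bigcup_(v in [set v | `|v| < r]) ((fun t => a + t *: v) @` `[0, 1]).
  apply/seteqP; split=> [x|x [v /= vr [t]]].
    rewrite -ball_normE /= => xr; exists (x - a); first by rewrite /= distrC.
    by exists 1; rewrite ?scale1r 1?addrC ?subrK//= in_itv /= ler01 lexx.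
  rewrite /= in_itv /= => /andP[t0 t1] <-; rewrite -ball_normE /=.
  rewrite opprD addNKr normrN normrZ ger0_norm//.
  by apply: le_lt_trans vr; rewrite ler_piMl.
apply: bigcup_connected.
  exists a => v _; exists 0; rewrite ?scale0r ?addr0//=.
  by rewrite in_itv /= lexx ler01.
move=> v _; apply: connected_continuous_connected; first exact: segment_connected.
apply: continuous_subspaceT => t; apply: cvgD; first exact: cvg_cst.
by apply: cvgZr_tmp; exact: cvg_id.
Qed.

End Countability.

(** * Local actions *)

Section ManifoldJacobians.
Context {R : realType}.

Lemma jacobian_mx_id (T : topologicalType) n (A : set (chart R T n)) a p :
  smooth_atlas A -> A a -> chart_dom a p -> jacobian_mx a a id p = 1%:M.
Proof.
move=> hA Aa ap; rewrite -(jac_id (chart_to a p)); apply: jac_eq.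
by apply: filterS (near_chart_im (atlas_chart hA Aa) ap) => y [_ E].
Qed.

Lemma jacobian_mx_cst (S T : topologicalType) m n (a : chart R S m)
    (b : chart R T n) q p : jacobian_mx a b (fun=> q) p = 0.
Proof. by apply/matrixP => i j; rewrite !mxE derive_cst. Qed.

Lemma smooth_map_at_affine_chart (T : topologicalType) n k (A : set (chart R T n)) c
    (y0 : 'rV[R]_n) (L : 'M[R]_(k, n)) w : smooth_atlas A -> A c ->
  chart_dom c (chart_from c (y0 + w *m L)) ->
  chart_to c (chart_from c (y0 + w *m L)) = y0 + w *m L ->
  smooth_map_at (@euc R k) A (fun w => chart_from c (y0 + w *m L)) w.
Proof.
move=> hA Ac dc E.
have s1 : smooth_map_at (@euc R k) (@euc R n) (fun w => y0 + w *m L) w.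
  by apply/smooth_map_at_euc; exact: smoothv_affine.
apply: (smooth_map_at_comp (@euc_atlas R k) (@euc_atlas R n) s1).
by rewrite -E; exact: smooth_map_at_chart_from.
Qed.

End ManifoldJacobians.

Section LocalAction.
Context {R : realType} {n m : nat}.
Context {X : topologicalType} {AX : set (chart R X n)}.
Context {G : topologicalSpaceGroupType} {AG : set (chart R G m)}.
Context {V : set (G * X)} {Psi : G * X -> X}.
Hypotheses (hX : smooth_atlas AX) (hG : lie_group AG)
  (hPsi : local_action AG AX V Psi).

Let hA : smooth_atlas AG := lie_atlas hG.
Let hGX : smooth_atlas (prod_atlas AG AX) := prod_smooth_atlas hA hX.

Lemma action_smooth_map_at p : V p -> smooth_map_at (prod_atlas AG AX) AX Psi p.
Proof.
have := action_smooth hPsi; rewrite (smooth_mapP hGX hX _ (action_open hPsi)).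
by apply.
Qed.

Lemma orbit_map_smooth_map_at g x : V (g, x) -> smooth_map_at AG AX (fun h => Psi (h, x)) g.
Proof.
move=> Vgx; apply: (smooth_map_at_comp hA hGX _ (action_smooth_map_at Vgx)).
by apply: (smooth_map_at_pair hA hX hA); [exact: smooth_map_at_id|exact: smooth_map_at_cst].
Qed.

Lemma translation_smooth_map_at g x : V (g, x) -> smooth_map_at AX AX (fun y => Psi (g, y)) x.
Proof.
move=> Vgx; apply: (smooth_map_at_comp hX hGX _ (action_smooth_map_at Vgx)).
by apply: (smooth_map_at_pair hA hX hX); [exact: smooth_map_at_cst|exact: smooth_map_at_id].
Qed.

Lemma mulg_smooth_map_at (S : topologicalType) k (A : set (chart R S k)) F F' p :
  smooth_atlas A -> smooth_map_at A AG F p -> smooth_map_at A AG F' p ->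
  smooth_map_at A AG (fun x => (F x * F' x)%g) p.
Proof.
move=> hS sF sF'.
have hGG := prod_smooth_atlas hA hA.
have := lie_mul hG; rewrite (smooth_mapP hGG hA _ openT) => /(_ (F p, F' p) I) sm.
exact: (smooth_map_at_comp hS hGG (smooth_map_at_pair hA hA hS sF sF') sm).
Qed.

Lemma invg_smooth_map_at (S : topologicalType) k (A : set (chart R S k)) F p :
  smooth_atlas A -> smooth_map_at A AG F p -> smooth_map_at A AG (fun x => (F x)^-1%g) p.
Proof.
move=> hS sF.
have := lie_inv hG; rewrite (smooth_mapP hA hA _ openT) => /(_ (F p) I) sm.
exact: (smooth_map_at_comp hS hA sF sm).
Qed.

Lemma near_dom (S : topologicalType) (F : S -> G) (F' : S -> X) p :
  {for p, continuous F} -> {for p, continuous F'} -> V (F p, F' p) ->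
  \forall x \near p, V (F x, F' x).
Proof.
move=> cF cF' Vp; apply: (@near_comp _ _ (fun x => (F x, F' x)) p V).
  exact: continuous_pair.
exact: open_near (action_open hPsi) Vp.
Qed.

Lemma near_dom_orbit g x : V (g, x) -> \forall h \near g, V (h, x).
Proof.
move=> Vgx; apply: (@near_dom _ id (fun=> x)) => //.
exact: cst_continuous.
Qed.

Lemma mulgr_cts (k h : G) : {for h, continuous (fun h => (h * k)%g)}.
Proof.
by have [] := mulg_smooth_map_at hA (smooth_map_at_id h hA) (smooth_map_at_cst AG AG k h).
Qed.

Lemma mulgl_cts (k h : G) : {for h, continuous (fun h => (k * h)%g)}.
Proof.
by have [] := mulg_smooth_map_at hA (smooth_map_at_cst AG AG k h) (smooth_map_at_id h hA).
Qed.

(** Moves every question about an orbit map to the identity of the group. *)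
Lemma orbit_map_shift g x : V (g, x) ->
  \forall h \near g, Psi (h, x) = Psi ((h * g^-1)%g, Psi (g, x)).
Proof.
move=> Vgx.
have n1 := near_dom_orbit Vgx.
have n2 : \forall h \near g, V ((h * g^-1)%g, Psi (g, x)).
  apply: (@near_dom _ (fun h => (h * g^-1)%g) (fun=> Psi (g, x))).
  - exact: mulgr_cts.
  - exact: cst_continuous.
  - by rewrite mulgV; exact: action_dom1 hPsi _.
apply: filterS2 n1 n2 => h V1 V2.
have E : (h * g^-1 * g)%g = h by rewrite mulgVK.
by rewrite (action_mul hPsi Vgx V2) ?E.
Qed.

Lemma orbit_map_conj g x : V (g, x) ->
  \forall h \near (1%g : G),
    Psi (h, Psi (g, x)) = Psi (g, Psi ((g^-1 * (h * g))%g, x)).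
Proof.
move=> Vgx.
have c1 : {for (1%g : G), continuous (fun h => (h * g)%g)} by exact: mulgr_cts.
have c2 : {for (1%g : G), continuous (fun h => (g^-1 * (h * g))%g)}.
  exact: (continuous_comp c1 (@mulgl_cts g^-1%g _)).
have e1 : (g^-1 * (1 * g))%g = 1%g by rewrite mul1g mulVg.
have n1 : \forall h \near (1%g : G), V (h, Psi (g, x)).
  by apply: near_dom_orbit; exact: action_dom1 hPsi _.
have n2 : \forall h \near (1%g : G), V ((h * g)%g, x).
  apply: (@near_dom _ (fun h => (h * g)%g) (fun=> x)) => //.
    exact: cst_continuous.
  by rewrite mul1g.
have n3 : \forall h \near (1%g : G), V ((g^-1 * (h * g))%g, x).
  apply: (@near_dom _ (fun h => (g^-1 * (h * g))%g) (fun=> x)) => //.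
    exact: cst_continuous.
  by rewrite e1; exact: action_dom1 hPsi _.
have n4 : \forall h \near (1%g : G), V (g, Psi ((g^-1 * (h * g))%g, x)).
  apply: (@near_dom _ (fun=> g) (fun h => Psi ((g^-1 * (h * g))%g, x))).
  - exact: cst_continuous.
  - apply: (@continuous_comp _ _ _ (fun h => (g^-1 * (h * g))%g)
      (fun k => Psi (k, x))) => //.
    rewrite e1; apply: (orbit_map_smooth_map_at _).1; exact: action_dom1 hPsi _.
  - by rewrite e1 (action_1 hPsi).
have n12 : \forall h \near (1%g : G), V (h, Psi (g, x)) /\ V ((h * g)%g, x).
  exact: filterI n1 n2.
apply: filterS3 n12 n3 n4 => h [V1 V2] V3 V4.
have E : (g * (g^-1 * (h * g)))%g = (h * g)%g by rewrite mulVKg.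
by rewrite (action_mul hPsi Vgx V1 V2) (action_mul hPsi V3 V4) ?E.
Qed.

(** The differential of the orbit map at the identity; its row space is the
    tangent space of the orbit at [x]. *)
Definition orbit_mx (a : chart R G m) (d : chart R X n) (x : X) : 'M[R]_(m, n) :=
  jacobian_mx a d (fun h => Psi (h, x)) 1%g.

(** Since [h g x = g (g^-1 h g) x], the differential of the translation by [g]
    maps the tangent space of the orbit at [x] onto the one at [g x]. *)
Lemma orbit_mx_rank_le g x a a' d d' : V (g, x) -> AG a -> AG a' ->
  AX d -> AX d' -> chart_dom a 1%g -> chart_dom a' 1%g ->
  chart_dom d x -> chart_dom d' (Psi (g, x)) ->
  (\rank (orbit_mx a' d' (Psi (g, x))) <= \rank (orbit_mx a d x))%N.
Proof.
move=> Vgx Aa Aa' Ad Ad' a1 a1' dx dx'.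
have e1 : (g^-1 * (1 * g))%g = 1%g by rewrite mul1g mulVg.
have sc : smooth_map_at AG AG (fun h => (g^-1 * (h * g))%g) 1%g.
  apply: mulg_smooth_map_at => //; first exact: smooth_map_at_cst.
  by apply: mulg_smooth_map_at => //; [exact: smooth_map_at_id|exact: smooth_map_at_cst].
have V1 := action_dom1 hPsi x.
have so := orbit_map_smooth_map_at V1.
have so' : smooth_map_at AG AX (fun h => Psi (h, x)) (g^-1 * (1 * g))%g by rewrite e1.
have st := translation_smooth_map_at Vgx.
have st' : smooth_map_at AX AX (fun y => Psi (g, y)) (Psi ((g^-1 * (1 * g))%g, x)).
  by rewrite e1 (action_1 hPsi).
have s12 := smooth_map_at_comp hA hA sc so'.
rewrite /orbit_mx (jacobian_mx_eq _ hA Aa' a1' (orbit_map_conj Vgx)).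
rewrite (jacobian_mx_comp (b := d) (G := fun y => Psi (g, y))
  (F := (fun h => Psi (h, x)) \o (fun h => (g^-1 * (h * g))%g)) hA hX Aa' Ad Ad' s12)//=;
  rewrite ?e1 ?(action_1 hPsi)//.
rewrite (jacobian_mx_comp (b := a) hA hA Aa' Aa Ad sc)//= ?e1 ?(action_1 hPsi)//.
apply: leq_trans (mxrankM_maxl _ _) _.
exact: mxrankM_maxr.
Qed.

Definition orbit_rank (x : X) (r : nat) := forall a d, AG a -> AX d ->
  chart_dom a 1%g -> chart_dom d x -> \rank (orbit_mx a d x) = r.

Lemma orbit_rank_exists x : exists r, orbit_rank x r.
Proof.
have [a Aa a1] := atlas_cover hA 1%g; have [d Ad dx] := atlas_cover hX x.
exists (\rank (orbit_mx a d x)) => a' d' Aa' Ad' a1' dx'.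
have V1 := action_dom1 hPsi x; have e1 := action_1 hPsi x.
apply/eqP; rewrite eqn_leq; apply/andP; split.
  by have := orbit_mx_rank_le V1 Aa Aa' Ad Ad' a1 a1' dx; rewrite e1; apply.
by have := orbit_mx_rank_le V1 Aa' Aa Ad' Ad a1' a1 dx'; rewrite e1; apply.
Qed.

Lemma orbit_rank_act g x r : V (g, x) -> orbit_rank x r ->
  orbit_rank (Psi (g, x)) r.
Proof.
move=> Vgx rx a' d' Aa' Ad' a1' dx'.
have [d Ad dx] := atlas_cover hX x.
rewrite -(rx a' d Aa' Ad a1' dx).
apply/eqP; rewrite eqn_leq (orbit_mx_rank_le Vgx Aa' Aa' Ad Ad' a1' a1' dx dx') /=.
have [Vi Ei] := action_inv hPsi Vgx.
have := orbit_mx_rank_le Vi Aa' Aa' Ad' Ad a1' a1' dx'.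
by rewrite Ei; apply.
Qed.

(** For a local action a single group element need not reach the whole orbit,
    hence chains. *)
Inductive reach (x : X) : X -> Prop :=
| reach_refl : reach x x
| reach_act g y : reach x y -> V (g, y) -> reach x (Psi (g, y)).

Lemma reach_trans x y z : reach x y -> reach y z -> reach x z.
Proof. by move=> xy; elim => // g w _ xw Vgw; exact: reach_act. Qed.

Lemma reach_sym x y : reach x y -> reach y x.
Proof.
elim=> [|g z _ zx Vgz]; first exact: reach_refl.
have [Vi Ei] := action_inv hPsi Vgz.
apply: reach_trans zx; rewrite -[X in reach _ X]Ei.
by apply: reach_act Vi; exact: reach_refl.
Qed.

Lemma reach_orbit x : is_orbit V Psi (reach x).
Proof.
split; first by exists x; exact: reach_refl.
  by move=> g y xy Vgy; exact: reach_act.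
move=> Q [q Qq] iQ QO; apply/seteqP; split => // y xy.
have : reach q y by apply: reach_trans xy; exact/reach_sym/QO.
by elim => // g z _ Qz Vgz; exact: iQ.
Qed.

Lemma orbit_rank_reach x y r : reach x y -> orbit_rank x r -> orbit_rank y r.
Proof. by elim => // g z _ IH Vgz rx; apply: orbit_rank_act => //; exact: IH. Qed.

End LocalAction.

Arguments orbit_mx {R n m X G} Psi a d x.
Arguments orbit_rank {R n m X} AX {G} AG Psi x r.
Arguments reach {X G} V Psi x _.

(** * Slice coordinates *)

Section Slices.
Context {R : realType} {n m : nat}.
Context {X : topologicalType} {AX : set (chart R X n)}.
Context {G : topologicalSpaceGroupType} {AG : set (chart R G m)}.
Context {V : set (G * X)} {Psi : G * X -> X}.
Hypotheses (hX : smooth_atlas AX) (hG : lie_group AG)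
  (hPsi : local_action AG AX V Psi).

Let hA : smooth_atlas AG := lie_atlas hG.
Let hGX : smooth_atlas (prod_atlas AG AX) := prod_smooth_atlas hA hX.
Let hE k : smooth_atlas (@euc R k) := @euc_atlas R k.
Let idc k := @id_chart R k.

(** Slice coordinates [zeta] around [c].  The slice through [c] is the part of its
    orbit swept by group elements near the identity; [zeta] maps it into the row
    space of the projection [Pi], and [zeta x *m (1%:M - Pi)] is the coordinate
    transverse to it.  Each point is [Psi (sigma x, tau x)] with [tau x] on a
    transversal through [c].  A projection of the whole coordinate space takes the
    place of a splitting of the dimension into [r] and [n - r].
    [slice_tangent] says that orbits of rank [r] are tangent to the level sets of
    the transverse coordinate, [slice_inner] that the slice through [c] fills a
    neighborhood of 0 in the row space of [Pi]. *)
Record is_slice (c : X) (r : nat) (Pi : 'M[R]_n) (k : chart R X n)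
    (zeta : X -> 'rV[R]_n) (sigma : X -> G) (tau : X -> X) (U : set X) : Prop := {
  slice_rank : \rank Pi = r;
  slice_open : open U;
  slice_center : U c;
  slice_chart : AX k;
  slice_dom : forall x, U x -> chart_dom k x;
  slice_zeta : forall x, U x -> smooth_map_at AX (@euc R n) zeta x;
  slice_unit : forall x, U x -> jacobian_mx k (idc n) zeta x \in unitmx;
  slice_sigma : forall x, U x -> smooth_map_at AX AG sigma x;
  slice_tau : forall x, U x -> smooth_map_at AX AX tau x;
  slice_tau_center : tau c = c;
  slice_V : forall x, U x -> V (sigma x, tau x);
  slice_Psi : forall x, U x -> Psi (sigma x, tau x) = x;
  slice_tau_eq : forall x y, zeta x *m (1%:M - Pi) = zeta y *m (1%:M - Pi) ->
    tau x = tau y;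
  slice_tangent : forall x a, U x -> orbit_rank AX AG Psi x r -> AG a ->
    chart_dom a 1%g ->
    jacobian_mx a (idc n) (fun h => zeta (Psi (h, x))) 1%g *m (1%:M - Pi) = 0;
  slice_inner : \forall w \near (0 : 'rV[R]_n), exists g,
    [/\ V (g, c), U (Psi (g, c)) & zeta (Psi (g, c)) = w *m Pi]
}.

(** A projection onto the row space of [M] along a complement. *)
Lemma row_space_proj (M : 'M[R]_(m, n)) : exists Pi : 'M[R]_n,
  [/\ (Pi <= M)%MS, M *m Pi = M, \rank Pi = \rank M & Pi *m Pi = Pi].
Proof.
pose Pi := proj_mx (genmx M) (complmx M).
have dxM : (genmx M :&: complmx M)%MS = 0.
  by apply/eqP; rewrite -submx0 -(capmx_compl M) capmxS ?genmxE.
have PM : (Pi <= M)%MS.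
  by have := proj_mx_sub (genmx M) (complmx M) (1%:M : 'M[R]_n); rewrite mul1mx genmxE.
have id_on k (W : 'M[R]_(k, n)) : (W <= M)%MS -> W *m Pi = W.
  by move=> WM; apply: proj_mx_id => //; rewrite genmxE.
exists Pi; split => //; [exact: id_on| |exact: id_on].
apply/eqP; rewrite eqn_leq mxrankS//=.
by rewrite -{1}(id_on _ M (submx_refl M)) mxrankM_maxr.
Qed.

(** The partial differential in the point is the identity because the identity
    of the group acts trivially. *)
Lemma jacobian_prod_action a d c : AG a -> AX d -> chart_dom a 1%g ->
  chart_dom d c -> jacobian_mx (prod_chart a d) d Psi (1%g, c) =
    col_mx (orbit_mx Psi a d c) 1%:M.
Proof.
move=> Aa Ad a1 dc.
have V1 := action_dom1 hPsi c; have e1 := action_1 hPsi c.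
have sP := action_smooth_map_at hX hG hPsi V1.
have Ap := prod_atlas_chart Aa Ad.
have s1 : smooth_map_at AG (prod_atlas AG AX) (fun h => (h, c)) 1%g.
  by apply: (smooth_map_at_pair hA hX hA); [exact: smooth_map_at_id|exact: smooth_map_at_cst].
have s2 : smooth_map_at AX (prod_atlas AG AX) (fun y => (1%g : G, y)) c.
  by apply: (smooth_map_at_pair hA hX hX); [exact: smooth_map_at_cst|exact: smooth_map_at_id].
have E1 : orbit_mx Psi a d c =
    usubmx (jacobian_mx (prod_chart a d) d Psi (1%g, c)).
  have := jacobian_mx_comp (b := prod_chart a d) hA hGX Aa Ap Ad s1 sP a1.
  rewrite /= e1 => /(_ (conj a1 dc) dc) E.
  rewrite /orbit_mx (_ : (fun h => Psi (h, c)) = Psi \o (fun h => (h, c)))// E.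
  rewrite jacobian_mx_pair (jacobian_mx_id hA Aa a1) jacobian_mx_cst.
  by rewrite -{1}[jacobian_mx _ d _ _]vsubmxK mul_row_col mul1mx mul0mx addr0.
have E2 : 1%:M = dsubmx (jacobian_mx (prod_chart a d) d Psi (1%g, c)).
  have := jacobian_mx_comp (b := prod_chart a d) hX hGX Ad Ap Ad s2 sP dc.
  rewrite /= e1 => /(_ (conj a1 dc) dc) E.
  rewrite -(jacobian_mx_id hX Ad dc) (_ : id = Psi \o (fun y => (1%g : G, y))).
    rewrite E jacobian_mx_pair (jacobian_mx_id hX Ad dc) jacobian_mx_cst.
    by rewrite -{1}[jacobian_mx _ d _ _]vsubmxK mul_row_col mul1mx mul0mx add0r.
  by apply/funext => y /=; rewrite (action_1 hPsi).
by rewrite E1 E2 vsubmxK.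
Qed.

Lemma jacobian_affine_chart (T : topologicalType) q (A : set (chart R T q)) d l
    (y0 : 'rV[R]_q) (L : 'M[R]_(l, q)) w : smooth_atlas A -> A d ->
  (\forall v \near w, chart_to d (chart_from d (y0 + v *m L)) = y0 + v *m L) ->
  jacobian_mx (idc l) d (fun w => chart_from d (y0 + w *m L)) w = L.
Proof. by move=> hT Ad E; rewrite -[RHS](jac_affine y0 L w); exact: jac_eq. Qed.

Section Construction.
Variables (c : X) (a0 : chart R G m) (k : chart R X n).
Hypotheses (Aa0 : AG a0) (Ak : AX k) (a01 : chart_dom a0 1%g) (kc : chart_dom k c).
Variable Pi : 'M[R]_n.
Hypotheses (PM : (Pi <= orbit_mx Psi a0 k c)%MS) (Pidem : Pi *m Pi = Pi).

(* [L] lifts [Pi] through the differential of the orbit map, so that the group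
   factor contributes [Pi] and the base factor [1 - Pi] to the differential of
   the slice map, which is thus the identity. *)
Let L := Pi *m pinvmx (orbit_mx Psi a0 k c).
Let B := 1%:M - Pi.
Definition slice_group (w : 'rV[R]_n) := chart_from a0 (chart_to a0 1%g + w *m L).
Definition slice_base (w : 'rV[R]_n) := chart_from k (chart_to k c + w *m B).
Definition slice_map (w : 'rV[R]_n) := Psi (slice_group w, slice_base w).

Lemma slice_LM : L *m orbit_mx Psi a0 k c = Pi.
Proof. exact: mulmxKpV. Qed.

Lemma slice_PiB : Pi *m B = 0.
Proof. by rewrite /B mulmxBr mulmx1 Pidem subrr. Qed.

Lemma near_affine_chart (T : topologicalType) q (A : set (chart R T q)) d p
   (D : 'M[R]_(n, q)) :
  smooth_atlas A -> A d -> chart_dom d p ->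
  \forall w \near (0 : 'rV[R]_n),
    chart_dom d (chart_from d (chart_to d p + w *m D)) /\
    chart_to d (chart_from d (chart_to d p + w *m D)) = chart_to d p + w *m D.
Proof.
move=> hT Ad dp.
apply: (@near_comp _ _ (fun w : 'rV[R]_n => chart_to d p + w *m D) 0 (fun y =>
  chart_dom d (chart_from d y) /\ chart_to d (chart_from d y) = y)).
  exact/smoothv_cont/smoothv_affine.
rewrite mul0mx addr0; exact: near_chart_im (atlas_chart hT Ad) dp.
Qed.

Lemma slice_group0 : slice_group 0 = 1%g.
Proof. by rewrite /slice_group mul0mx addr0 (chart_toK (atlas_chart hA Aa0)). Qed.

Lemma slice_base0 : slice_base 0 = c.
Proof. by rewrite /slice_base mul0mx addr0 (chart_toK (atlas_chart hX Ak)). Qed.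

Definition slice_good (w : 'rV[R]_n) :=
  [/\ smooth_map_at (@euc R n) AG slice_group w, smooth_map_at (@euc R n) AX slice_base w,
      V (slice_group w, slice_base w), chart_dom k (slice_map w) &
      smooth_map_at (@euc R n) AX slice_map w].

Lemma slice_smooth_map_at w : smooth_map_at (@euc R n) AG slice_group w ->
  smooth_map_at (@euc R n) AX slice_base w -> V (slice_group w, slice_base w) ->
  smooth_map_at (@euc R n) AX slice_map w.
Proof.
move=> sg sb Vw.
exact: (smooth_map_at_comp (hE n) hGX (smooth_map_at_pair hA hX (hE n) sg sb)
  (action_smooth_map_at hX hG hPsi Vw)).
Qed.

Lemma slice_good_near : \forall w \near (0 : 'rV[R]_n), slice_good w.
Proof.
have n1 : \forall w \near (0 : 'rV[R]_n), smooth_map_at (@euc R n) AG slice_group w.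
  apply: filterS (near_affine_chart L hA Aa0 a01) => w [d1 e1].
  exact: smooth_map_at_affine_chart.
have n2 : \forall w \near (0 : 'rV[R]_n), smooth_map_at (@euc R n) AX slice_base w.
  apply: filterS (near_affine_chart B hX Ak kc) => w [d1 e1].
  exact: smooth_map_at_affine_chart.
have sg0 := nbhs_singleton n1; have sb0 := nbhs_singleton n2.
have V0 : V (slice_group 0, slice_base 0).
  by rewrite slice_group0 slice_base0; exact: action_dom1 hPsi _.
have n3 : \forall w \near (0 : 'rV[R]_n), V (slice_group w, slice_base w).
  by apply: (near_dom hPsi) => //; [exact: sg0.1|exact: sb0.1].
have sm0 := slice_smooth_map_at sg0 sb0 V0.
have n4 : \forall w \near (0 : 'rV[R]_n), chart_dom k (slice_map w).
  apply: (near_comp sm0.1); rewrite /slice_map slice_group0 slice_base0.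
  by rewrite (action_1 hPsi); exact: near_chart_dom (atlas_chart hX Ak) kc.
have n34 : \forall w \near (0 : 'rV[R]_n),
   V (slice_group w, slice_base w) /\ chart_dom k (slice_map w).
  exact: filterI n3 n4.
apply: filterS3 n1 n2 n34 => w s1 s2 [Vw kw].
by split => //; exact: slice_smooth_map_at.
Qed.

Lemma slice_map0 : slice_map 0 = c.
Proof. by rewrite /slice_map slice_group0 slice_base0 (action_1 hPsi). Qed.

Lemma slice_jacobian : jacobian_mx (idc n) k slice_map 0 = 1%:M.
Proof.
have [sg sb V0 k0 sm] := nbhs_singleton slice_good_near.
have V1 := action_dom1 hPsi c.
have sP := action_smooth_map_at hX hG hPsi V0.
have spair := smooth_map_at_pair hA hX (hE n) sg sb.
have Ap := prod_atlas_chart Aa0 Ak.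
have := jacobian_mx_comp (a := idc n) (b := prod_chart a0 k) (hE n) hGX erefl Ap Ak spair sP I.
rewrite /= slice_group0 slice_base0 (action_1 hPsi) => /(_ (conj a01 kc) kc).
rewrite jacobian_mx_pair (jacobian_prod_action Aa0 Ak a01 kc).
rewrite (jacobian_affine_chart hA Aa0); last first.
  by apply: filterS (near_affine_chart L hA Aa0 a01) => w [].
rewrite (jacobian_affine_chart hX Ak); last first.
  by apply: filterS (near_affine_chart B hX Ak kc) => w [].
rewrite mul_row_col slice_LM mulmx1 /B addrC subrK => E.
exact: E.
Qed.

(** The base point does not see the component along [Pi], so the point moves by
    group elements alone. *)
Lemma slice_along w : slice_good w ->
  \forall v \near (0 : 'rV[R]_n), slice_map (w + v *m Pi) =
    Psi ((slice_group (w + v *m Pi) * (slice_group w)^-1)%g, slice_map w).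
Proof.
move=> [sg sb Vw kw sm].
have n1 := orbit_map_shift hG hPsi Vw.
have eb v : slice_base (w + v *m Pi) = slice_base w.
  by rewrite /slice_base mulmxDl -mulmxA slice_PiB mulmx0 addr0.
have : \forall v \near (0 : 'rV[R]_n), Psi (slice_group (w + v *m Pi), slice_base w) =
    Psi ((slice_group (w + v *m Pi) * (slice_group w)^-1)%g, slice_map w).
  apply: (@near_comp _ _ (fun v : 'rV[R]_n => slice_group (w + v *m Pi)) 0 (fun h =>
    Psi (h, slice_base w) = Psi ((h * (slice_group w)^-1)%g, slice_map w))).
    apply: (@continuous_comp _ _ _ (fun v : 'rV[R]_n => w + v *m Pi) slice_group).
      exact/smoothv_cont/smoothv_affine.
    by rewrite mul0mx addr0; exact: sg.1.
  by rewrite mul0mx addr0.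
by apply: filterS => v; rewrite /slice_map eb.
Qed.

(** The directions in the image of [Pi] are tangent to the orbit. *)
Lemma slice_jacobian_along w a : slice_good w -> AG a -> chart_dom a 1%g ->
  exists K : 'M[R]_(n, m), Pi *m jacobian_mx (idc n) k slice_map w =
    K *m orbit_mx Psi a k (slice_map w).
Proof.
move=> gw Aa a1; have [sg sb Vw kw sm] := gw.
pose aff (v : 'rV[R]_n) := w + v *m Pi.
have saff v : smooth_map_at (@euc R n) (@euc R n) aff v.
  by apply/smooth_map_at_euc; exact: smoothv_affine.
have aff0 : aff 0 = w by rewrite /aff mul0mx addr0.
pose K v := (slice_group (aff v) * (slice_group w)^-1)%g.
have K0 : K 0 = 1%g by rewrite /K aff0 mulgV.
have sK : smooth_map_at (@euc R n) AG K 0.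
  apply: (mulg_smooth_map_at hG (hE n)); last exact: smooth_map_at_cst.
  by apply: (smooth_map_at_comp (hE n) (hE n) (saff 0)); rewrite aff0.
exists (jacobian_mx (idc n) a K 0).
have V1 := action_dom1 hPsi (slice_map w).
have so : smooth_map_at AG AX (fun h => Psi (h, slice_map w)) (K 0).
  by rewrite K0; exact: (orbit_map_smooth_map_at hX hG hPsi V1).
have := jacobian_mx_comp (a := idc n) (b := a) (hE n) hA erefl Aa Ak sK so I.
rewrite K0 (action_1 hPsi) => /(_ a1 kw) <-.
have sm' : smooth_map_at (@euc R n) AX slice_map (aff 0) by rewrite aff0.
have := jacobian_mx_comp (a := idc n) (b := idc n) (hE n) (hE n) erefl erefl Ak
  (saff 0) sm' I I.
rewrite aff0 => /(_ kw).
have -> : jacobian_mx (idc n) (idc n) aff 0 = Pi by exact: jac_affine.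
move=> <-.
apply: (jacobian_mx_eq _ (hE n) erefl I).
exact: slice_along.
Qed.

End Construction.

(** The coordinates are the inverse of the slice map.  At a point [x] of rank
    [r], the differential of the slice map sends the image of [Pi] into the
    tangent space of the orbit; both have dimension [r], so they coincide, and
    this is the tangency of the orbits. *)
Theorem slice_exists c r : orbit_rank AX AG Psi c r ->
  exists Pi k zeta sigma tau U, is_slice c r Pi k zeta sigma tau U.
Proof.
move=> rc.
have [a0 Aa0 a01] := atlas_cover hA 1%g; have [k Ak kc] := atlas_cover hX c.
have ik := atlas_chart hX Ak.
have [Pi [PM MP rP Pidem]] := row_space_proj (orbit_mx Psi a0 k c).
have {}rP : \rank Pi = r by rewrite rP; exact: rc.
pose Gm := slice_group c a0 k Pi; pose Xm := slice_base c k Pi.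
pose Phi := slice_map c a0 k Pi; pose good := slice_good c a0 k Pi.
have ng : \forall w \near (0 : 'rV[R]_n), good w.
  exact: slice_good_near.
have g0 : good 0 := nbhs_singleton ng.
have Phi0 : Phi 0 = c by exact: slice_map0.
pose H w := chart_to k (Phi w).
have sH : smoothv H 0.
  have [_ _ _ k0 sm] := g0.
  exact: (smooth_map_at_smoothv (c := idc n) erefl Ak I k0 sm).
have jH : jac H 0 = 1%:M by exact: (slice_jacobian Aa0 Ak a01 kc PM).
have [z [sz z0 nHz nzH]] := inverse_function sH jH.
have H0 : H 0 = chart_to k c by rewrite /H Phi0.
rewrite H0 in sz z0 nHz.
pose zeta x := z (chart_to k x).
have zc : zeta c = 0 by [].
have szeta : \forall x \near c, smooth_map_at AX (@euc R n) zeta x.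
  have nz : \forall x \near c, smoothv z (chart_to k x).
    apply: (@near_comp _ _ (chart_to k) c (fun y => smoothv z y)).
      exact: chart_to_cts.
    exact: smoothv_near.
  apply: filterS2 nz (near_chart_dom ik kc) => x sx kx.
  apply: (smooth_map_at_comp hX (hE n) (smooth_map_at_chart_to hX Ak kx)).
  exact/smooth_map_at_euc.
have czeta : {for c, continuous zeta} := (nbhs_singleton szeta).1.
have ngood : \forall x \near c, good (zeta x).
  by apply: (@near_comp _ _ zeta c good) => //; rewrite zc.
have nback : \forall x \near c, \forall w \near zeta x, z (H w) = w.
  apply: (@near_comp _ _ zeta c (fun v => \forall w \near v, z (H w) = w)) => //.
  by rewrite zc; exact: near_join.
have nHz' : \forall x \near c, H (zeta x) = chart_to k x.
  apply: (@near_comp _ _ (chart_to k) c (fun y => H (z y) = y)) => //.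
  exact: chart_to_cts.
pose P x := [/\ chart_dom k x, smooth_map_at AX (@euc R n) zeta x, good (zeta x),
  (\forall w \near zeta x, z (H w) = w) & H (zeta x) = chart_to k x].
have nP : \forall x \near c, P x.
  have n1 : \forall x \near c, chart_dom k x /\ smooth_map_at AX (@euc R n) zeta x.
    exact: filterI (near_chart_dom ik kc) szeta.
  have n2 : \forall x \near c, (\forall w \near zeta x, z (H w) = w) /\
      H (zeta x) = chart_to k x by exact: filterI nback nHz'.
  by apply: filterS3 n1 ngood n2 => x [? ?] ? [? ?].
pose U := (P : set X)°.
have UP x : U x -> P x by exact: nbhs_singleton.
have PhiE x : P x -> Phi (zeta x) = x.
  move=> [kx _ [_ _ _ kP _] _ E].
  by rewrite -[RHS](chart_toK ik kx) -E /H (chart_toK ik kP).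
have JJ x : P x -> jacobian_mx (idc n) k Phi (zeta x) *m
    jacobian_mx k (idc n) zeta x = 1%:M.
  move=> Px; have [kx sx [_ _ _ kP sP] nb _] := Px.
  have sx' : smooth_map_at AX (@euc R n) zeta (Phi (zeta x)) by rewrite PhiE.
  have := jacobian_mx_comp (a := idc n) (c := idc n) (hE n) hX erefl Ak erefl
    sP sx' I kP I.
  rewrite -/Phi (PhiE x Px) => <-; rewrite -(jac_id (zeta x)).
  exact: jac_eq.
exists Pi, k, zeta, (Gm \o zeta), (Xm \o zeta), U; split => //.
- exact: open_interior.
- by move=> x /UP[].
- by move=> x /UP[].
- by move=> x /UP/JJ /mulmx1_unit[].
- by move=> x /UP[_ sx [sg _ _ _ _] _ _]; exact: (smooth_map_at_comp hX (hE n) sx sg).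
- by move=> x /UP[_ sx [_ sb _ _ _] _ _]; exact: (smooth_map_at_comp hX (hE n) sx sb).
- by rewrite /= zc; exact: slice_base0.
- by move=> x /UP[_ _ []].
- by move=> x /UP/PhiE.
- by move=> x y E; rewrite /= /Xm /slice_base E.
- move=> x a /UP Px rx Aa a1.
  have [kx sx gx _ _] := Px.
  have V1 := action_dom1 hPsi x; have e1 := action_1 hPsi x.
  have so := orbit_map_smooth_map_at hX hG hPsi V1.
  have sx' : smooth_map_at AX (@euc R n) zeta (Psi (1%g, x)) by rewrite e1.
  have := jacobian_mx_comp (a := a) (b := k) (c := idc n) hA hX Aa Ak erefl so sx' a1.
  rewrite e1 => /(_ kx I) ->.
  have [K EK] := slice_jacobian_along Ak Pidem gx Aa a1.
  rewrite -/Phi (PhiE x Px) in EK.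
  set M := orbit_mx Psi a k x in EK *; set J := jacobian_mx (idc n) k Phi _ in EK.
  have JZ := JJ x Px; rewrite -/J in JZ.
  have uJ : J \in unitmx by have [] := mulmx1_unit JZ.
  have PJM : (Pi *m J <= M)%MS by apply/submxP; exists K.
  have MPJ : (M <= Pi *m J)%MS.
    have := mxrank_leqif_sup PJM => /geq_leqif <-.
    rewrite mxrankMfree ?row_free_unit// rP.
    by have := rx a k Aa Ak a1 kx => ->.
  have /submxP[W EW] := MPJ.
  rewrite -/(orbit_mx Psi a k x) -/M EW -!mulmxA (mulmxA J) JZ mul1mx.
  by rewrite mulmxBr mulmx1 Pidem subrr mulmx0.
- have PhiPi w : Xm (w *m Pi) = c.
    rewrite /Xm /slice_base -mulmxA mulmxBr mulmx1 Pidem subrr mulmx0 addr0.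
    exact: (chart_toK ik).
  have cPi : {for (0 : 'rV[R]_n), continuous (fun w : 'rV[R]_n => w *m Pi)}.
    have -> : (fun w : 'rV[R]_n => w *m Pi) = (fun w => 0 + w *m Pi).
      by apply/funext => w; rewrite add0r.
    exact: smoothv_cont (smoothv_affine 0 Pi 0).
  have nU : \forall w \near (0 : 'rV[R]_n), U (Phi w).
    apply: (@near_comp _ _ Phi 0 U); first by have [_ _ _ _ []] := g0.
    by rewrite Phi0; apply: open_near => //; exact: open_interior.
  have nall : \forall w \near (0 : 'rV[R]_n), [/\ good w, U (Phi w) & z (H w) = w].
    by apply: filterS3 ng nU nzH => w.
  have := @near_comp _ _ (fun w : 'rV[R]_n => w *m Pi) 0
    (fun w => [/\ good w, U (Phi w) & z (H w) = w]) cPi.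
  rewrite mul0mx => /(_ nall); apply: filterS => w [[_ _ Vw _ _] UPhi zHw].
  exists (Gm (w *m Pi)).
  by move: Vw UPhi zHw; rewrite /H /Phi /slice_map -/(Xm _) PhiPi.
Qed.

End Slices.

(** * Orbits in slice coordinates *)

Lemma zero_differential_const (R : realType) (S : topologicalType) m n
    (A : set (chart R S m)) (f : S -> 'rV[R]_n) p : smooth_atlas A ->
  (\forall q \near p, smooth_map_at A (@euc R n) f q /\
     forall b, A b -> chart_dom b q -> jacobian_mx b (@id_chart R n) f q = 0) ->
  \forall q \near p, f q = f p.
Proof.
move=> hA nf; have [b Ab bp] := atlas_cover hA p; have ib := atlas_chart hA Ab.
pose F y := f (chart_from b y).
have nF : \forall y \near chart_to b p, smoothv F y /\ jac F y = 0.
  apply: filterS2 (near_chart_im ib bp) (near_chart_from ib bp nf).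
  move=> y [by_ E] [sf Jf].
  have := smooth_map_at_smoothv (d := @id_chart R n) Ab erefl by_ I sf.
  rewrite E => sF; split => //.
  by have := Jf b Ab by_; rewrite /jacobian_mx E.
have [r /= r0 Hr] := (nbhs_ballP _ _).1 nF.
have cst y : ball (chart_to b p) r y -> F y = F (chart_to b p).
  move=> yr; apply/rowP => j.
  apply: (@partials_zero_const _ _ (fun y => F y 0 j) (chart_to b p) r) => //.
  move=> z zr i; have [sF JF] := Hr z zr; split.
    exact: smooth_at_derivable.
  by have /matrixP/(_ i j) := JF; rewrite !mxE.
have nb : \forall q \near p, ball (chart_to b p) r (chart_to b q).
  apply: (@near_comp _ _ (chart_to b) p (ball (chart_to b p) r)).
    exact: chart_to_cts.
  exact: nbhsx_ballx.
apply: filterS2 (near_chart_dom ib bp) nb => q bq /cst.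
by rewrite /F !(chart_toK ib).
Qed.

(** If no [Z d] had interior points, their complements would be dense open sets,
    and the intersection of these would meet [O]. *)
Lemma baire_countable_cover (R : realType) n (Y : Type) (O : set 'rV[R]_n)
    (C : set Y) (Z : Y -> set 'rV[R]_n) : open O -> O !=set0 -> countable C ->
  (forall d, C d -> closed (Z d)) -> (forall w, O w -> exists2 d, C d & Z d w) ->
  exists2 d, C d & exists2 O', open O' /\ O' !=set0 & O' `<=` Z d.
Proof.
move=> oO O0 /countable_injP[code inj] clZ cov; apply: contrapT => H.
pose F i := [set w : 'rV[R]_n | forall d, C d -> code d = i -> ~ Z d w].
have [w [Ow Fw]] : (O `&` \bigcap_i F i) !=set0; last first.
  have [d Cd Zd] := cov w Ow; exact: (Fw (code d) I d Cd erefl Zd).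
suff : dense (\bigcap_i F i) by apply.
apply: Baire => i.
have [[d [Cd di]]|nd] := pselect (exists d, C d /\ code d = i); last first.
  have -> : F i = setT.
    by apply/seteqP; split => // w _ d Cd di; case: nd; exists d.
  by split; [exact: openT|move=> O' [w Ow] _; exists w].
have -> : F i = ~` Z d.
  apply/seteqP; split => [w Fw|w nZ d' Cd' di'].
    exact: (Fw d Cd di).
  by rewrite (inj d' d) ?inE// di' di.
split; first exact/closed_openC/clZ.
move=> O' O'0 oO'; apply: contrapT => /set0P/negP; rewrite negbK => /eqP E.
apply: H; exists d => //; exists O' => //.
by move=> w O'w; apply: contrapT => nZ; have : (O' `&` ~` Z d) w by []; rewrite E.
Qed.

Section OrbitGeometry.
Context {R : realType} {n m : nat}.
Context {X : topologicalType} {AX : set (chart R X n)}.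
Context {G : topologicalSpaceGroupType} {AG : set (chart R G m)}.
Context {V : set (G * X)} {Psi : G * X -> X}.
Hypotheses (hX : smooth_atlas AX) (hG : lie_group AG)
  (hPsi : local_action AG AX V Psi).

Let hA : smooth_atlas AG := lie_atlas hG.
Let hE k : smooth_atlas (@euc R k) := @euc_atlas R k.
Let idc k := @id_chart R k.

(** By associativity, acting on [c] by an element close to [g] and then by one
    close to [h] amounts to a single step from [h g c]; as G x G is second
    countable, countably many such points serve for all pairs. *)
Lemma two_steps_countable c : exists2 D : set X,
  countable D /\ D `<=` reach V Psi c &
  forall g h, V (g, c) -> V (h, Psi (g, c)) ->
    exists2 d, D d & exists2 k, V (k, d) & Psi (h, Psi (g, c)) = Psi (k, d).
Proof.
pose E := [set p : G * G | V (p.1, c) /\ V (p.2, Psi (p.1, c))].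
pose Q d (p : G * G) := reach V Psi c d /\
  exists2 k, V (k, d) & Psi (p.2, Psi (p.1, c)) = Psi (k, d).
have sc := second_countableX (lie_second_countable hG) (lie_second_countable hG).
have loc p : E p -> exists d, \forall q \near p, E q -> Q d q.
  case: p => g h [/= V1 V2]; pose d := Psi (h, Psi (g, c)); exists d.
  have rd : reach V Psi c d.
    by apply: reach_act => //; apply: reach_act => //; exact: reach_refl.
  have sfst := smooth_map_at_fst hA hA (g, h); have ssnd := smooth_map_at_snd hA hA (g, h).
  have hGG := prod_smooth_atlas hA hA.
  have s1 := mulg_smooth_map_at hG hGG sfst (smooth_map_at_cst (prod_atlas AG AG) AG g^-1%g (g, h)).
  have s2 := mulg_smooth_map_at hG hGG ssnd s1.
  have s3 := mulg_smooth_map_at hG hGG s2 (smooth_map_at_cst (prod_atlas AG AG) AG h^-1%g (g, h)).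
  have c1 := s1.1; have c2 := s2.1; have c3 := s3.1.
  have n1 : \forall p \near (g, h), V ((p.1 * g^-1)%g, Psi (g, c)).
    apply: (near_dom hPsi (F := fun p : G * G => (p.1 * g^-1)%g)
      (F' := fun=> Psi (g, c))) => //; first exact: cst_continuous.
    by rewrite /= mulgV; exact: action_dom1 hPsi _.
  have n2 : \forall p \near (g, h), V ((p.2 * (p.1 * g^-1))%g, Psi (g, c)).
    apply: (near_dom hPsi (F := fun p : G * G => (p.2 * (p.1 * g^-1))%g)
      (F' := fun=> Psi (g, c))) => //; first exact: cst_continuous.
    by rewrite /= mulgV mulg1.
  have n3 : \forall p \near (g, h), V ((p.2 * (p.1 * g^-1) * h^-1)%g, d).
    apply: (near_dom hPsi (F := fun p : G * G => (p.2 * (p.1 * g^-1) * h^-1)%g)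
      (F' := fun=> d)) => //; first exact: cst_continuous.
    by rewrite /= mulgV mulg1 mulgV; exact: action_dom1 hPsi _.
  apply: filterS3 n1 n2 n3 => -[g' h'] /= v1 v2 v3 [/= V1' V2']; split => //.
  exists (h' * (g' * g^-1) * h^-1)%g => //=.
  have e1 : Psi (g', c) = Psi ((g' * g^-1)%g, Psi (g, c)).
    by rewrite (action_mul hPsi V1 v1) mulgVK.
  have e2 : (h' * (g' * g^-1) * h^-1 * h)%g = (h' * (g' * g^-1))%g by rewrite mulgVK.
  rewrite /d (action_mul hPsi V2 v3) e2//.
  by rewrite e1 (action_mul hPsi v1) -?e1.
have [C cC HC] := lindelof sc loc.
exists (C `&` reach V Psi c).
  by split; [exact: sub_countable (subset_card_le (@subIsetl _ _ _)) cC|move=> x []].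
move=> g h V1 V2; have [d Cd [rd kd]] := HC (g, h) (conj V1 V2).
by exists d.
Qed.

Lemma reach_countable x : exists2 D : set X, countable D &
  forall y, reach V Psi x y -> exists2 d, D d /\ reach V Psi x d &
    exists2 k, V (k, d) & y = Psi (k, d).
Proof.
pose next c := sval (cid2 (two_steps_countable c)).
have nextP c : (countable (next c) /\ next c `<=` reach V Psi c) /\
    forall g h, V (g, c) -> V (h, Psi (g, c)) ->
    exists2 d, next c d & exists2 k, V (k, d) & Psi (h, Psi (g, c)) = Psi (k, d).
  by rewrite /next; case: cid2.
pose D_ := fix D_ k := if k is k'.+1 then \bigcup_(c in D_ k') next c else [set x].
have cD k : countable (D_ k).
  elim: k => [|k IH] /=; first exact: countable1.
  by apply: bigcup_countable => // c _; exact: (nextP c).1.1.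
have rD k d : D_ k d -> reach V Psi x d.
  elim: k d => [|k IH] d /=; first by move=> ->; exact: reach_refl.
  by move=> [c /IH rc] /(nextP c).1.2; exact: reach_trans.
exists (\bigcup_k D_ k); first exact: bigcup_countable.
move=> y; elim=> [|g z _ [d [[k _ Dk] rd] [h Vh ->]] Vg].
  exists x; first by split; [exists 0%N|exact: reach_refl].
  by exists 1%g; [exact: action_dom1 hPsi _|rewrite (action_1 hPsi)].
have [d' nd' [k' Vk' E]] := (nextP d).2 h g Vh Vg.
have Dk' : D_ k.+1 d' by exists d.
by exists d'; [split; [exists k.+1|exact: rD Dk']|exists k'].
Qed.

Section InSlice.
Variables (c : X) (r : nat) (Pi : 'M[R]_n) (k : chart R X n).
Variables (zeta : X -> 'rV[R]_n) (sigma : X -> G) (tau : X -> X) (U : set X).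
Hypothesis hS : is_slice (AX := AX) (AG := AG) (V := V) (Psi := Psi)
  c r Pi k zeta sigma tau U.

(** The coordinate that labels the slices. *)
Definition transverse (x : X) : 'rV[R]_n := zeta x *m (1%:M - Pi).

Lemma transverse_smooth_map_at x : U x -> smooth_map_at AX (@euc R n) transverse x.
Proof.
move=> Ux.
have : smooth_map_at (@euc R n) (@euc R n) (fun v => 0 + v *m (1%:M - Pi)) (zeta x).
  by apply/smooth_map_at_euc; exact: smoothv_affine.
move=> /(smooth_map_at_comp hX (hE n) (slice_zeta hS Ux)); apply: (smooth_map_at_eq hX).
by apply: near_all => y /=; rewrite add0r.
Qed.

Lemma transverse_comp_jacobian (S : topologicalType) l (A : set (chart R S l))
    (F : S -> X) p a : smooth_atlas A -> A a -> chart_dom a p ->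
  smooth_map_at A AX F p -> U (F p) ->
  jacobian_mx a (idc n) (transverse \o F) p =
  jacobian_mx a (idc n) (zeta \o F) p *m (1%:M - Pi).
Proof.
move=> hS' Aa ap sF Up.
have sz := smooth_map_at_comp hS' hX sF (slice_zeta hS Up).
have sl : smooth_map_at (@euc R n) (@euc R n) (fun v => 0 + v *m (1%:M - Pi)) (zeta (F p)).
  by apply/smooth_map_at_euc; exact: smoothv_affine.
have := jacobian_mx_comp (b := idc n) (c := idc n) hS' (hE n) Aa erefl erefl sz sl ap I I.
have -> : jacobian_mx (idc n) (idc n) (fun v => 0 + v *m (1%:M - Pi)) ((zeta \o F) p)
    = 1%:M - Pi by exact: jac_affine.
move=> <-; apply: (jacobian_mx_eq _ hS' Aa ap).
by apply: near_all => y; rewrite /= add0r.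
Qed.

(** By translation to the identity, the differential vanishes at all group
    elements near [g]; constancy of the rank along the orbit makes the tangency
    apply to each of these points. *)
Lemma orbit_map_transverse_const x g : orbit_rank AX AG Psi x r -> V (g, x) ->
  U (Psi (g, x)) ->
  \forall h \near g, transverse (Psi (h, x)) = transverse (Psi (g, x)).
Proof.
move=> rx Vgx Ug.
have so := orbit_map_smooth_map_at hX hG hPsi Vgx.
have nU : \forall h \near g, U (Psi (h, x)).
  by apply: (near_comp so.1); apply: open_near => //; exact: slice_open hS.
apply: (zero_differential_const (f := fun h => transverse (Psi (h, x))) hA).
apply: filterS2 (near_dom_orbit hPsi Vgx) nU => h Vh Uh.
have soh := orbit_map_smooth_map_at hX hG hPsi Vh.
split; first exact: (smooth_map_at_comp hA hX soh (transverse_smooth_map_at Uh)).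
move=> b Ab bh; set y := Psi (h, x) in Uh.
have [a Aa a1] := atlas_cover hA 1%g.
have ry : orbit_rank AX AG Psi y r by exact: (orbit_rank_act hX hG hPsi Vh).
have V1 := action_dom1 hPsi y; have e1 := action_1 hPsi y.
have sy := orbit_map_smooth_map_at hX hG hPsi V1.
have szy : smooth_map_at AG (@euc R n) (fun k => zeta (Psi (k, y))) 1%g.
  apply: (smooth_map_at_comp hA hX sy); rewrite e1; exact: (slice_zeta hS Uh).
have tang := slice_tangent hS Uh ry Aa a1.
have sR : smooth_map_at AG AG (fun k => (k * h^-1)%g) h.
  by apply: (mulg_smooth_map_at hG hA); [exact: smooth_map_at_id|exact: smooth_map_at_cst].
have eR : (h * h^-1)%g = 1%g by rewrite mulgV.
rewrite (@transverse_comp_jacobian G m AG (fun h => Psi (h, x)))//.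
have -> : jacobian_mx b (idc n) (zeta \o (fun h => Psi (h, x))) h =
  jacobian_mx b (idc n) ((fun k => zeta (Psi (k, y))) \o (fun k => (k * h^-1)%g)) h.
  apply: (jacobian_mx_eq _ hA Ab bh).
  by apply: filterS (orbit_map_shift hG hPsi Vh) => k' /= ->.
have szy' : smooth_map_at AG (@euc R n) (fun k => zeta (Psi (k, y))) (h * h^-1)%g.
  by rewrite eR.
have := jacobian_mx_comp (b := a) (c := idc n) hA hA Ab Aa erefl sR szy' bh.
by rewrite eR => /(_ a1 I) ->; rewrite -mulmxA tang mulmx0.
Qed.

Lemma transverse_values_countable x : orbit_rank AX AG Psi x r ->
  countable (transverse @` (U `&` reach V Psi x)).
Proof.
move=> rx; have [D cD HD] := reach_countable x.
pose E d := [set h | [/\ V (h, d), U (Psi (h, d)) & reach V Psi x d]].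
have cE d : countable ((fun h => transverse (Psi (h, d))) @` E d).
  have loc g : E d g -> exists v, \forall h \near g, E d h ->
      transverse (Psi (h, d)) = v.
    move=> [Vg Ug rd]; exists (transverse (Psi (g, d))).
    have rkd := orbit_rank_reach hX hG hPsi rd rx.
    by apply: filterS (orbit_map_transverse_const rkd Vg Ug).
  have [C cC HC] := lindelof (lie_second_countable hG) loc.
  apply: sub_countable (subset_card_le _) cC => _ [h Eh <-].
  by have [v Cv ->] := HC h Eh.
apply: sub_countable (subset_card_le _) (bigcup_countable cD (fun d _ => cE d)).
move=> _ [y [Uy ry] <-]; have [d [Dd rd] [h Vh E']] := HD y ry.
exists d => //; exists h; last by rewrite E'.
by split => //; rewrite -E'.
Qed.

(** On a connected set of points of one orbit, the transverse coordinate takes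
    countably many values, hence one. *)
Lemma transverse_connected x W : orbit_rank AX AG Psi x r ->
  connected W -> W `<=` U `&` reach V Psi x ->
  forall a b, W a -> W b -> transverse a = transverse b.
Proof.
move=> rx cW WU a b Wa Wb.
apply: (@countable_connected_rV _ R n W) => //.
  apply: continuous_in_subspaceT => y; rewrite inE => /WU[Uy _].
  exact: (transverse_smooth_map_at Uy).1.
apply: sub_countable (subset_card_le _) (transverse_values_countable rx).
by move=> _ [y /WU Wy <-]; exists y.
Qed.

End InSlice.

End OrbitGeometry.

(** * Rank and dimension of orbits *)

Section OrbitDimension.
Context {R : realType} {n m s : nat}.
Context {X : topologicalType} {AX : set (chart R X n)}.
Context {G : topologicalSpaceGroupType} {AG : set (chart R G m)}.
Context {V : set (G * X)} {Psi : G * X -> X}.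
Hypotheses (hX : smooth_atlas AX) (hG : lie_group AG)
  (hPsi : local_action AG AX V Psi).

Let hA : smooth_atlas AG := lie_atlas hG.
Let hE k : smooth_atlas (@euc R k) := @euc_atlas R k.
Let idc k := @id_chart R k.

Section Immersed.
Variables (N : topologicalType) (AN : set (chart R N s)) (phi : N -> X) (x : X).
Hypotheses (hN : smooth_atlas AN) (iphi : immersion AN AX phi)
  (rphi : range phi = reach V Psi x).
Variables (r : nat) (Pi : 'M[R]_n) (k : chart R X n).
Variables (zeta : X -> 'rV[R]_n) (sigma : X -> G) (tau : X -> X) (U : set X).
Hypotheses (hS : is_slice (AX := AX) (AG := AG) (V := V) (Psi := Psi)
  x r Pi k zeta sigma tau U) (rx : orbit_rank AX AG Psi x r).

Lemma immersion_smooth_map_at p : smooth_map_at AN AX phi p.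
Proof.
have [sphi _] := iphi.
by move: sphi; rewrite (smooth_mapP hN hX _ openT) => /(_ p I).
Qed.

Lemma immersion_slice_jacobian p e : AN e -> chart_dom e p -> U (phi p) ->
  row_free (jacobian_mx e (idc n) (zeta \o phi) p).
Proof.
move=> Ne ep Up; have kp := slice_dom hS Up.
rewrite (jacobian_mx_comp (b := k) (c := idc n) hN hX Ne (slice_chart hS) erefl
  (immersion_smooth_map_at p) (slice_zeta hS Up))//.
rewrite /row_free mxrankMfree ?row_free_unit ?(slice_unit hS)//.
by apply/eqP; exact: iphi.2 Ne (slice_chart hS) ep kp.
Qed.

Lemma near_immersion p : U (phi p) -> \forall q \near p, U (phi q).
Proof.
move=> Up; apply: (near_comp (immersion_smooth_map_at p).1).
by apply: open_near => //; exact: slice_open hS.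
Qed.

(** The transverse coordinate is constant along the orbit, even for the
    topology of the submanifold, so the latter is tangent to the slices. *)
Lemma submanifold_dim_le_rank : (s <= r)%N.
Proof.
have [p _ px] : range phi x by rewrite rphi; exact: reach_refl.
have Up : U (phi p) by rewrite px; exact: slice_center hS.
have [e Ne ep] := atlas_cover hN p; have ie := atlas_chart hN Ne.
have nU : \forall q \near p, U (phi q) by exact: near_immersion.
have nb : \forall y \near chart_to e p,
    (chart_dom e (chart_from e y) /\ chart_to e (chart_from e y) = y) /\
    U (phi (chart_from e y)).
  exact: filterI (near_chart_im ie ep) (near_chart_from ie ep nU).
have [d /= d0 Hd] := (nbhs_ballP _ _).1 nb.
pose t := transverse Pi zeta.
pose W := (phi \o chart_from e) @` ball (chart_to e p) d.
have cW : connected W.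
  apply: connected_continuous_connected; first exact: ball_connected.
  apply: continuous_in_subspaceT => y; rewrite inE => /Hd[[ey E] Uy].
  apply: continuous_comp; last exact: (immersion_smooth_map_at _).1.
  by have := chart_from_cts ie ey; rewrite E.
have WU : W `<=` U `&` reach V Psi x.
  move=> _ [y /Hd[_ Uy] <-]; split => //=.
  by rewrite -rphi; exists (chart_from e y).
have tc := transverse_connected hX hG hPsi hS rx cW WU.
have Wp : W (phi p).
  by exists (chart_to e p); [exact: ballxx|rewrite /= (chart_toK ie)].
have ncst : {near p, t \o phi =1 fun=> t (phi p)}.
  have nball : \forall q \near p, ball (chart_to e p) d (chart_to e q).
    apply: (@near_comp _ _ (chart_to e) p (ball (chart_to e p) d)).
      exact: chart_to_cts.
    exact: nbhsx_ballx.
  apply: filterS2 (near_chart_dom ie ep) nball => q eq bq.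
  apply: tc => //; exists (chart_to e q) => //=.
  by rewrite (chart_toK ie).
have := transverse_comp_jacobian hX hS hN Ne ep (immersion_smooth_map_at p) Up.
rewrite (jacobian_mx_eq _ hN Ne ep ncst) jacobian_mx_cst => /esym.
have := immersion_slice_jacobian Ne ep Up.
set Q := jacobian_mx e _ _ _ => fQ; rewrite mulmxBr mulmx1 => /eqP.
rewrite subr_eq0 => /eqP QPi.
rewrite -(slice_rank hS); move: fQ; rewrite /row_free => /eqP <-.
by rewrite QPi mxrankM_maxr.
Qed.

(** Composed with a linear left inverse of its differential, the immersion in
    slice coordinates has identity differential, hence is injective. *)
Lemma immersion_locally_graph p : U (phi p) ->
  exists (D : set N) (L : 'M[R]_(n, s)), [/\ compact D, nbhs p D,
    D `<=` phi @^-1` U &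
    forall a b, D a -> D b -> zeta (phi a) *m L = zeta (phi b) *m L -> a = b].
Proof.
move=> Up; have [e Ne ep] := atlas_cover hN p; have ie := atlas_chart hN Ne.
have /row_freeP[L JL] := immersion_slice_jacobian Ne ep Up.
pose F y := zeta (phi (chart_from e y)) *m L.
have sz := smooth_map_at_comp hN hX (immersion_smooth_map_at p) (slice_zeta hS Up).
have szv : smoothv (fun y => zeta (phi (chart_from e y))) (chart_to e p).
  exact: (smooth_map_at_smoothv (d := idc n) Ne erefl ep I sz).
have sl v : smoothv (fun v : 'rV[R]_n => v *m L) v.
  apply: smoothv_eq (smoothv_affine 0 L v).
  by apply: near_all => w; rewrite add0r.
have sF : smoothv F (chart_to e p) by
  exact: (@smoothv_comp _ _ _ _ (fun y => zeta (phi (chart_from e y)))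
    (fun v : 'rV[R]_n => v *m L) _ szv (sl _)).
have JF : jac F (chart_to e p) = 1%:M.
  rewrite -JL.
  have -> : F = (fun v : 'rV[R]_n => 0 + v *m L) \o
      (fun y => zeta (phi (chart_from e y))).
    by apply/funext => y; rewrite /= add0r.
  rewrite jac_comp//; last exact: smoothv_affine.
  by rewrite jac_affine.
have [d d0 Hd] := jac1_expands sF JF.
have nball : \forall q \near p, ball (chart_to e p) d (chart_to e q).
  apply: (@near_comp _ _ (chart_to e) p (ball (chart_to e p) d)).
    exact: chart_to_cts.
  exact: nbhsx_ballx.
have nall : \forall q \near p, U (phi q) /\ ball (chart_to e p) d (chart_to e q).
  exact: filterI (near_immersion Up) nball.
have [l [l0 cD HD _ nD]] := chart_cubeP ie ep nall.
exists (chart_cube e p l), L; split => //.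
  by move=> q /HD[[]].
move=> a b /HD[[Ua ba] ea] /HD[[Ub bb] eb] E.
rewrite -(chart_toK ie ea) -(chart_toK ie eb); congr (chart_from e _).
have [_ h] := Hd _ _ ba bb.
move: h; rewrite /F !(chart_toK ie)// E subrr normr0 mulr0 normr_le0 subr_eq0.
by move=> /eqP.
Qed.

(** Countably many of these compact pieces cover the slice through [x], which in
    slice coordinates contains a neighborhood of 0 in the row space of [Pi]; by
    Baire's theorem one piece contains an open subset of it.  On that piece a linear map to a space of dimension [s]
    is injective, so it is injective on the row space of [Pi]. *)
Lemma rank_le_submanifold_dim : @second_countable N -> (r <= s)%N.
Proof.
move=> scN.
pose valid (d : set N * 'M[R]_(n, s)) := [/\ compact d.1, d.1 `<=` phi @^-1` U &
    forall a b, d.1 a -> d.1 b -> zeta (phi a) *m d.2 = zeta (phi b) *m d.2 -> a = b].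
have loc p : (phi @^-1` U) p -> exists d, \forall q \near p,
    (phi @^-1` U) q -> valid d /\ d.1 q.
  move=> /immersion_locally_graph[D [L [cD nD DU inj]]].
  by exists (D, L); apply: filterS nD => q Dq _.
have [C cC HC] := lindelof scN loc.
have /nbhs_ballP[d /= d0 Hd] := slice_inner hS.
pose Z (d : set N * 'M[R]_(n, s)) :=
  [set w : 'rV[R]_n | ((zeta \o phi) @` d.1) (w *m Pi)].
have czphi q : U (phi q) -> {for q, continuous (zeta \o phi)}.
  move=> Uq; apply: continuous_comp; first exact: (immersion_smooth_map_at q).1.
  exact: (slice_zeta hS Uq).1.
have clZ e : (C `&` valid) e -> closed (Z e).
  move=> [_ [ce eU _]].
  have cPi : continuous (fun w : 'rV[R]_n => w *m Pi).
    move=> w; have -> : (fun w : 'rV[R]_n => w *m Pi) = (fun w => 0 + w *m Pi).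
      by apply/funext => v; rewrite add0r.
    exact: smoothv_cont (smoothv_affine 0 Pi w).
  apply: (closed_comp (f := fun w : 'rV[R]_n => w *m Pi)) => //.
  apply: compact_closed; first exact: norm_hausdorff.
  apply: continuous_compact => //.
  apply: continuous_in_subspaceT => q; rewrite inE => /eU; exact: czphi.
have cov w : ball (0 : 'rV[R]_n) d w -> exists2 e, (C `&` valid) e & Z e w.
  move=> /Hd[g [Vg Ug Eg]].
  have [q _ qg] : range phi (Psi (g, x)).
    by rewrite rphi; apply: reach_act => //; exact: reach_refl.
  have Uq : (phi @^-1` U) q by rewrite /= qg.
  have [e Ce [ve eq]] := HC q Uq; exists e => //.
  by exists q => //=; rewrite qg.
have B0 : ball (0 : 'rV[R]_n) d !=set0 by exists 0; exact: ballxx.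
have cCv : countable (C `&` valid).
  exact: sub_countable (subset_card_le (@subIsetl _ _ _)) cC.
have [e [Ce [ce eU inj]] [W [oW [w0 Ww0]] WZ]] :=
  baire_countable_cover (ball_open _ _) B0 cCv clZ cov.
(* Two points of the piece that differ by a multiple of [v *m Pi] have the same
   image under [e.2], hence coincide. *)
have ker (v : 'rV[R]_n) : v *m (Pi *m e.2) = 0 -> v *m Pi = 0.
  move=> vPL.
  have [t [t0 Wt]] : exists t : R, t != 0 /\ W (w0 + t *: v).
    have : \forall t \near (0 : R), W (w0 + t *: v).
      apply: (@near_comp _ _ (fun t : R => w0 + t *: v) 0 W).
        by apply: cvgD; [exact: cvg_cst|apply: cvgZr_tmp; exact: cvg_id].
      by rewrite scale0r addr0; exact: open_near.
    move=> /nbhs_ballP[l /= l0 Hl]; exists (l / 2).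
    split; first by rewrite gt_eqF// divr_gt0.
    apply: Hl; rewrite /ball /= sub0r normrN gtr0_norm ?divr_gt0//.
    by rewrite ltr_pdivrMr// ltr_pMr// ltr1n.
  have [a ea Ea] := WZ _ Wt; have [b eb Eb] := WZ _ Ww0.
  have ab : a = b.
    apply: inj => //; rewrite /= in Ea Eb; rewrite Ea Eb.
    by rewrite !mulmxDl -!scalemxAl -[v *m Pi *m e.2]mulmxA vPL scaler0 addr0.
  move: Ea; rewrite ab Eb mulmxDl -scalemxAl => /eqP.
  rewrite -subr_eq0 opprD addNKr oppr_eq0 scaler_eq0 (negPf t0) /= => /eqP.
  exact.
have kk : (kermx (Pi *m e.2) <= kermx Pi)%MS.
  apply/sub_kermxP/row_matrixP => i; rewrite row_mul row0; apply: ker.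
  by rewrite -row_mul mulmx_ker row0.
have rk : (\rank Pi <= \rank (Pi *m e.2))%N.
  have := mxrankS kk; rewrite !mxrank_ker => h.
  have := rank_leq_row Pi; have := rank_leq_row (Pi *m e.2); lia.
rewrite -(slice_rank hS); apply: leq_trans rk _; exact: rank_leq_col.
Qed.

End Immersed.

Theorem orbit_rank_dim x : submanifold AX s (reach V Psi x) ->
  orbit_rank AX AG Psi x s.
Proof.
move=> [N [AN [phi [[hN [_ scN]] iphi _ rphi]]]].
have [r rx] := orbit_rank_exists hX hG hPsi x.
have [Pi [k [zeta [sigma [tau [U hS]]]]]] := slice_exists hX hG hPsi rx.
suff <- : r = s by [].
apply/eqP; rewrite eqn_leq.
rewrite (rank_le_submanifold_dim hN iphi rphi hS)//.
exact: (submanifold_dim_le_rank hN iphi rphi hS rx).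
Qed.

End OrbitDimension.

(** * Cross sections and invariant generalized functions *)

Lemma hausdorff_prod (S T : topologicalType) : hausdorff_space S ->
  hausdorff_space T -> hausdorff_space (S * T)%type.
Proof.
move=> hS hT [x y] [x' y'] cl; congr pair.
  apply: hS => P Q nP nQ.
  have [[a b] [/= Pa Qa]] := cl (fst @^-1` P) (fst @^-1` Q)
    (continuous_fst (p := (x, y)) nP) (continuous_fst (p := (x', y')) nQ).
  by exists a.
apply: hT => P Q nP nQ.
have [[a b] [/= Pb Qb]] := cl (snd @^-1` P) (snd @^-1` Q)
  (continuous_snd (p := (x, y)) nP) (continuous_snd (p := (x', y')) nQ).
by exists b.
Qed.

Section CrossSection.
Context {R : realType} {n m s : nat}.
Context {X : topologicalType} {AX : set (chart R X n)}.
Context {G : topologicalSpaceGroupType} {AG : set (chart R G m)}.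
Context {V : set (G * X)} {Psi : G * X -> X}.
Hypotheses (hX : smooth_atlas AX) (hG : lie_group AG)
  (hPsi : local_action AG AX V Psi) (hreg : regular_action V Psi AX s).

Let hA : smooth_atlas AG := lie_atlas hG.

(** Two points of [U] on one orbit lie in the connected set in which a small
    neighborhood meets that orbit, so their transverse coordinates agree.  To be
    stable under [tau], [U] consists of the points that [tau] keeps in the
    neighborhood. *)
Theorem cross_section x0 : exists (U : set X) (tau : X -> X) (gamma : X -> G),
  [/\ open U, U x0,
   (forall x, U x -> [/\ smooth_map_at AX AX tau x, smooth_map_at AX AG gamma x, U (tau x),
      V (gamma x, x) & Psi (gamma x, x) = tau x]) &
   (forall p, restricted_dom V Psi U p -> tau (Psi p) = tau p.2)].
Proof.
have rk x : orbit_rank AX AG Psi x s.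
  by apply: (orbit_rank_dim hX hG hPsi); apply: hreg.1; exact: reach_orbit hPsi x.
have [Pi [k [zeta [sigma [tau [U0 hS]]]]]] := slice_exists hX hG hPsi (rk x0).
have [B [nB cB]] := hreg.2 x0.
have nU0 : nbhs x0 U0.
  by apply: open_nbhs_nbhs; split; [exact: slice_open hS|exact: slice_center hS].
have [W BW WU0] : filter_from B id U0 by rewrite -nB.
have nW : nbhs x0 W by rewrite nB; exists W.
have inv x y : W x -> W y -> reach V Psi x y -> tau x = tau y.
  move=> Wx Wy xy; apply: (slice_tau_eq hS).
  apply: (transverse_connected hX hG hPsi hS (rk x)
    (cB W _ BW (reach_orbit hPsi x))).
  - by move=> z [/WU0 Uz rz].
  - by split => //; exact: reach_refl.
  - by split.
have tau_reach x : U0 x -> reach V Psi x (tau x).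
  move=> Ux; apply: (reach_sym hPsi); rewrite -[X in reach _ _ _ X](slice_Psi hS Ux).
  by apply: reach_act; [exact: reach_refl|exact: slice_V hS _ Ux].
have WW x : W° x -> W x by exact: nbhs_singleton.
exists [set x | W° x /\ W° (tau x)], tau, (fun x => (sigma x)^-1%g); split.
- apply: near_open => x [Wx Wtx].
  have oW : open W° by exact: open_interior.
  have nt : \forall y \near x, W° (tau y).
    apply: (@near_comp _ _ tau x W°); last exact: open_near.
    exact: (slice_tau hS (WU0 _ (WW _ Wx))).1.
  exact: filterI (open_near oW Wx) nt.
- by rewrite /= (slice_tau_center hS).
- move=> x [Wx Wtx]; have Ux := WU0 _ (WW _ Wx).
  have [Vi Ei] := action_inv hPsi (slice_V hS Ux).
  rewrite (slice_Psi hS Ux) in Vi Ei.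
  split => //; first exact: slice_tau hS _ Ux.
    by apply: (invg_smooth_map_at hG hX); exact: slice_sigma hS _ Ux.
  split => //; rewrite -(inv x (tau x)) //; [exact: WW|exact: WW|exact: tau_reach].
- move=> [g x] [/= Vgx [Wx _] [Wy _]]; apply/esym/inv; [exact: WW|exact: WW|].
  by apply: reach_act => //; exact: reach_refl.
Qed.

End CrossSection.

Section ColombeauInvariance.
Context {R : realType} {n m : nat}.
Context {X : topologicalType} {AX : set (chart R X n)}.
Context {G : topologicalSpaceGroupType} {AG : set (chart R G m)}.
Context {V : set (G * X)} {Psi : G * X -> X}.
Hypotheses (hX : smooth_atlas AX) (hXhaus : hausdorff_space X)
  (hG : lie_group AG) (hPsi : local_action AG AX V Psi).
Variable U : set X.
Hypothesis oU : open U.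

Let hA : smooth_atlas AG := lie_atlas hG.
Let hGX : smooth_atlas (prod_atlas AG AX) := prod_smooth_atlas hA hX.
Let VU := restricted_dom V Psi U.

Lemma restricted_dom_open : open VU.
Proof.
apply: near_open => p [Vp Up UPp].
have n1 : \forall q \near p, U q.2.
  by apply: (@near_comp _ _ snd p U); [exact: continuous_snd|exact: open_near].
have n2 : \forall q \near p, U (Psi q).
  apply: (@near_comp _ _ Psi p U); last exact: open_near.
  exact: (action_smooth_map_at hX hG hPsi Vp).1.
exact: filterS3 (open_near (action_open hPsi) Vp) n1 n2.
Qed.

Let oVU := restricted_dom_open.

Lemma Psi_restricted p : VU p -> smooth_map_at (prod_atlas AG AX) AX Psi p.
Proof. by move=> [Vp _ _]; exact: (action_smooth_map_at hX hG hPsi Vp). Qed.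

Lemma Psi_into p : VU p -> U (Psi p).
Proof. by case. Qed.

Lemma snd_restricted p : VU p -> smooth_map_at (prod_atlas AG AX) AX snd p.
Proof. by move=> _; exact: smooth_map_at_snd. Qed.

Lemma snd_into p : VU p -> U p.2.
Proof. by case. Qed.

Lemma colombeau_class_refl u : moderate AX U u -> colombeau_class AX U u u.
Proof. by move=> mu; split => //; exact: (negligible_subrr hX oU). Qed.

Lemma colombeau_class_negligible u v w : colombeau_class AX U u v ->
  colombeau_class AX U u w -> negligible_net AX U (fun e x => v e x - w e x).
Proof.
move=> [_ nv] [_ nw]; apply: (negligible_trans hX oU nv).
exact: (negligible_opp_sub hX oU nw).
Qed.

(** Another representative differs from [v] by a negligible net, and so do their
    compositions with the action and with the projection; on [v] itself these
    compositions coincide. *)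
Lemma invariant_representative u v : moderate AX U u -> colombeau_class AX U u v ->
  (forall e, 0 < e <= 1 -> invariant_fun V Psi U (v e)) ->
  invariant_gen AG AX V Psi U (colombeau_class AX U u).
Proof.
move=> mu uv vinv.
suff incl F F' : (forall p, VU p -> smooth_map_at (prod_atlas AG AX) AX F p) ->
    (forall p, VU p -> U (F p)) ->
    (forall e, 0 < e <= 1 -> forall p, VU p -> v e (F p) = v e (F' p)) ->
    colombeau_comp (prod_atlas AG AX) VU F (colombeau_class AX U u) `<=`
    colombeau_comp (prod_atlas AG AX) VU F' (colombeau_class AX U u).
  apply/seteqP; split.
    apply: incl => [|p|e e01 p VUp]; [exact: Psi_restricted|exact: Psi_into|].
    exact: vinv.
  apply: incl => [|p|e e01 p VUp]; [exact: snd_restricted|exact: snd_into|].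
  exact/esym/vinv.
move=> sF FU vF w [v1 uv1 [mw nw]]; exists v => //; split => //.
apply: (negligible_trans hGX oVU nw).
have := negligible_comp hGX hX hXhaus oVU oU sF FU
  (colombeau_class_negligible uv1 uv).
by apply: (negligible_eq hGX oVU) => e e01 p VUp /=; rewrite vF.
Qed.

Lemma invariant_gen_negligible u : moderate AX U u ->
  invariant_gen AG AX V Psi U (colombeau_class AX U u) ->
  negligible_net (prod_atlas AG AX) VU (fun e p => u e (Psi p) - u e p.2).
Proof.
move=> mu iu.
have : colombeau_comp (prod_atlas AG AX) VU Psi (colombeau_class AX U u)
    (fun e => u e \o Psi).
  exists u; first exact: colombeau_class_refl.
  split; last exact: (negligible_subrr hGX oVU).
  exact: (moderate_comp hGX hX hXhaus oVU oU Psi_restricted Psi_into).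
rewrite iu => -[v uv [_ nv]].
apply: (negligible_trans hGX oVU nv).
exact: (negligible_comp hGX hX hXhaus oVU oU snd_restricted snd_into
  (colombeau_class_negligible uv (colombeau_class_refl mu))).
Qed.

(** [u o tau - u] is the pullback of the negligible net [u o Psi - u o snd] along
    the map [x |-> (gamma x, x)]. *)
Lemma cross_section_representative u (tau : X -> X) (gamma : X -> G) :
  (forall x, U x -> [/\ smooth_map_at AX AX tau x, smooth_map_at AX AG gamma x, U (tau x),
      V (gamma x, x) & Psi (gamma x, x) = tau x]) ->
  moderate AX U u -> invariant_gen AG AX V Psi U (colombeau_class AX U u) ->
  colombeau_class AX U u (fun e => u e \o tau).
Proof.
move=> H mu iu.
have stau x : U x -> smooth_map_at AX AX tau x by move=> /H[].
have tauU x : U x -> U (tau x) by move=> /H[].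
split; first exact: (moderate_comp hX hX hXhaus oU oU stau tauU).
have sF x : U x -> smooth_map_at AX (prod_atlas AG AX) (fun x => (gamma x, x)) x.
  move=> /H[_ sg _ _ _]; apply: (smooth_map_at_pair hA hX hX) => //; exact: smooth_map_at_id.
have FV x : U x -> VU (gamma x, x) by move=> Ux; have [_ _ Ut Vg E] := H x Ux; split; rewrite ?E.
have := negligible_comp hX hGX (hausdorff_prod (lie_hausdorff hG) hXhaus) oU oVU
  sF FV (invariant_gen_negligible mu iu).
apply: (negligible_eq hX oU) => e e01 x Ux /=.
by have [_ _ _ _ ->] := H x Ux.
Qed.

End ColombeauInvariance.

Theorem theorem3p6 (R : realType) (n m s : nat)
    (X : topologicalType) (AX : set (chart R X n))
    (G : topologicalSpaceGroupType) (AG : set (chart R G m))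
    (V : set (G * X)) (Psi : G * X -> X)
    (hX : smooth_atlas AX) (hXconn : connected [set: X])
    (hXpara : paracompact X) (hXhaus : hausdorff_space X)
    (hG : lie_group AG) (hPsi : local_action AG AX V Psi)
    (hreg : regular_action V Psi AX s) (x0 : X) :
  exists U : set X, [/\ open U, U x0 &
    forall u : set (net R X), colombeau AX U u ->
      (invariant_gen AG AX V Psi U u <->
       exists2 v : net R X, u v &
         forall eps : R, 0 < eps <= 1 ->
           smooth_fun AX U (v eps) /\ invariant_fun V Psi U (v eps))].
Proof.
have [U [tau [gamma [oU Ux0 H inv]]]] := cross_section hX hG hPsi hreg x0.
exists U; split => // _ [u mu ->]; split=> [iu|[v uv vinv]]; last first.
  apply: (invariant_representative hX hXhaus hG hPsi oU mu uv) => e e01.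
  by have [] := vinv e e01.
exists (fun e => u e \o tau).
  exact: (cross_section_representative hX hXhaus hG hPsi oU H mu iu).
move=> e e01; split; last by move=> p VUp; rewrite /= inv.
have stau x : U x -> smooth_map_at AX AX tau x by move=> /H[].
have tauU x : U x -> U (tau x) by move=> /H[].
exact: (smooth_fun_comp hX hX oU oU stau tauU (mu.1 e e01)).
Qed.
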